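(* The following are equivalent over $\mathsf{RCA}_0$: (i) The strong cohesive principle $\mathsf{StCOH}$. (ii) The Arzelà-Ascoli theorem: if a sequence of continuous functions $f_n\colon[0,1]\to[-B,B]$ with $B\in\mathbb N$ is uniformly equicontinuous, i.e., if any $\varepsilon>0$ admits a $\delta>0$ with $|f_n(x)-f_n(y)|<\varepsilon$ for all $n\in\mathbb N$ and all $x,y\in[0,1]$ with $|x-y|<\delta$, then a subsequence of $(f_n)$ is uniformly convergent (with continuous limit).
   Context: $\mathsf{RCA}_0$ is the usual base system of second-order arithmetic (basic arithmetic axioms, $\Sigma^0_1$-induction, $\Delta^0_1$-comprehension). ''Equivalent over $\mathsf{RCA}_0$'' means that the equivalence, formalized in second-order arithmetic, is provable in $\mathsf{RCA}_0$. Reals. A real is a Cauchy sequence $x=(x_n)_{n\in\mathbb N}$ of rationals with no rate of convergence given: for each rational $\varepsilon>0$ there is an $N\in\mathbb N$ with $|x_m-x_n|<\varepsilon$ for all $m,n\geq N$. For reals $x,y$: $x\leq y$ means that for each rational $\varepsilon>0$ there is an $N$ with $x_n\leq y_n+\varepsilon$ for all $n\geq N$; $x=y$ means $x\leq y$ and $y\leq x$; $x<y$ means $x\leq y$ but not $x=y$. Addition, multiplication and absolute value are defined pointwise; rationals are identified with constant sequences. Put $B_\delta(y)=\{z\in\mathbb R:|y-z|<\delta\}$; $[a,b]=\{x\in\mathbb R:a\leq x\leq b\}$. Continuous functions. A partial continuous function on $\mathbb R$ is (represented by) an arbitrary function $f\colon\mathbb Q\to\mathbb Q^{\mathbb N}$,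 $f(q)=(f(q)_i)_{i\in\mathbb N}$. A real $x$ lies in $\operatorname{dom}(f)$ if each $\varepsilon>0$ admits a (positive) $N\in\mathbb N$ such that $|f(q)_i-f(r)_j|<\varepsilon$ for all rationals $q,r\in B_{1/N}(x)$ and all $i,j\geq N$. For $x=(x_i)\in\operatorname{dom}(f)$ the value is the real $f(x)=(f(x_i)_i)_{i\in\mathbb N}$. A continuous function $f\colon D\to\mathbb R$ is such an $f$ with $D\subseteq\operatorname{dom}(f)$; $f\colon D\to E$ means in addition that $f(x)\in E$ for all $x\in D$. Sequences of functions. A family of continuous functions $f_n\colon D\to\mathbb R$ (with representations $f_n(q)=(f_n(q)_i)_{i\in\mathbb N}$) is called a sequence of functions if all $x\in D$ and $\varepsilon>0$ admit an $N\in\mathbb N$ such that $|f_n(q)_i-f_n(q)_j|<\varepsilon$ for any rational $q\in B_{1/N}(x)$, all $n\in\mathbb N$ and all $i,j\geq N$. Uniform convergence of $(f_n)$ to $f\colon D\to\mathbb R$ means: each $\varepsilon>0$ admits an $N$ with $|f_n(x)-f(x)|<\varepsilon$ for all $x\in D$ and $n\geq N$. A subsequence is given by a strictly increasing function $i\mapsto n(i)$. Principles. $\mathsf{IPP}$ (infinite pigeonhole principle): for any $N\in\mathbb N$ and any $c\colon\mathbb N\to\{0,\ldots,N\}$ there is an $n\leq N$ such that $\{i\in\mathbb N:c(i)=n\}$ is infinite. $\mathsf{COH}$ (cohesive principle): for any family of sets $(R_i)_{i\in\mathbb N}$, $R_i\subseteq\mathbb N$, there is an infinite set $C\subseteq\mathbb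 N$ such that for each $i$, $C\setminus R_i$ is finite or $C\setminus(\mathbb N\setminus R_i)$ is finite. $\mathsf{StCOH}$ is the conjunction of $\mathsf{COH}$ and $\mathsf{IPP}$. *)

(* Defs.v *)
From Stdlib Require Import List.
Import ListNotations.

(** The two-sorted language of second-order arithmetic, with de Bruijn indices.
    Number variables and set variables are indexed independently, so a number
    quantifier does not affect set indices and conversely.  Equality is a
    primitive for numbers only; equality of sets does not occur. *)

Inductive term : Type :=
| Var (i : nat)
| Zero
| One
| Plus (t u : term)
| Mult (t u : term).

Inductive form : Type :=
| Eq (t u : term)
| Lt (t u : term)
| Mem (t : term) (X : nat)
| Bot
| Imp (p q : form)
| And (p q : form)
| Or (p q : form)
| AllN (p : form)
| ExN (p : form)
| AllS (p : form)
| ExS (p : form).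

Definition Not (p : form) : form := Imp p Bot.
Definition Iff (p q : form) : form := And (Imp p q) (Imp q p).

Definition scons {A : Type} (a : A) (f : nat -> A) (i : nat) : A :=
  match i with 0 => a | S j => f j end.

Fixpoint subst_term (sg : nat -> term) (t : term) : term :=
  match t with
  | Var i => sg i
  | Zero => Zero
  | One => One
  | Plus t u => Plus (subst_term sg t) (subst_term sg u)
  | Mult t u => Mult (subst_term sg t) (subst_term sg u)
  end.

Definition shift_term : term -> term := subst_term (fun i => Var (S i)).

Definition up_term (sg : nat -> term) : nat -> term :=
  scons (Var 0) (fun i => shift_term (sg i)).

Definition up_set (rho : nat -> nat) : nat -> nat :=
  scons 0 (fun i => S (rho i)).

(** Simultaneous substitution of terms for the number variables ([sg]) and of
    set variables for the set variables ([rho]). *)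
Fixpoint subst (sg : nat -> term) (rho : nat -> nat) (p : form) : form :=
  match p with
  | Eq t u => Eq (subst_term sg t) (subst_term sg u)
  | Lt t u => Lt (subst_term sg t) (subst_term sg u)
  | Mem t X => Mem (subst_term sg t) (rho X)
  | Bot => Bot
  | Imp p q => Imp (subst sg rho p) (subst sg rho q)
  | And p q => And (subst sg rho p) (subst sg rho q)
  | Or p q => Or (subst sg rho p) (subst sg rho q)
  | AllN p => AllN (subst (up_term sg) rho p)
  | ExN p => ExN (subst (up_term sg) rho p)
  | AllS p => AllS (subst sg (up_set rho) p)
  | ExS p => ExS (subst sg (up_set rho) p)
  end.

Definition shiftN : form -> form := subst (fun i => Var (S i)) (fun X => X).
Definition shiftS : form -> form := subst Var S.
Definition instN (t : term) : form -> form := subst (scons t Var) (fun X => X).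
Definition instS (X : nat) : form -> form := subst Var (scons X (fun Y => Y)).

(** [Ax] is a set of axioms, whose free variables are understood as universally
    quantified: an axiom may be used in any context, so that the quantifier
    introduction rules apply to its free variables. *)

Inductive proves (Ax : form -> Prop) : list form -> form -> Prop :=
| pr_ax G p : Ax p -> proves Ax G p
| pr_hyp G p : In p G -> proves Ax G p
| pr_imp_i G p q : proves Ax (p :: G) q -> proves Ax G (Imp p q)
| pr_imp_e G p q : proves Ax G (Imp p q) -> proves Ax G p -> proves Ax G q
| pr_and_i G p q : proves Ax G p -> proves Ax G q -> proves Ax G (And p q)
| pr_and_e1 G p q : proves Ax G (And p q) -> proves Ax G p
| pr_and_e2 G p q : proves Ax G (And p q) -> proves Ax G q
| pr_or_i1 G p q : proves Ax G p -> proves Ax G (Or p q)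
| pr_or_i2 G p q : proves Ax G q -> proves Ax G (Or p q)
| pr_or_e G p q r : proves Ax G (Or p q) ->
    proves Ax (p :: G) r -> proves Ax (q :: G) r -> proves Ax G r
| pr_raa G p : proves Ax (Not p :: G) Bot -> proves Ax G p
| pr_allN_i G p : proves Ax (map shiftN G) p -> proves Ax G (AllN p)
| pr_allN_e G p t : proves Ax G (AllN p) -> proves Ax G (instN t p)
| pr_exN_i G p t : proves Ax G (instN t p) -> proves Ax G (ExN p)
| pr_exN_e G p q : proves Ax G (ExN p) ->
    proves Ax (p :: map shiftN G) (shiftN q) -> proves Ax G q
| pr_allS_i G p : proves Ax (map shiftS G) p -> proves Ax G (AllS p)
| pr_allS_e G p X : proves Ax G (AllS p) -> proves Ax G (instS X p)
| pr_exS_i G p X : proves Ax G (instS X p) -> proves Ax G (ExS p)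
| pr_exS_e G p q : proves Ax G (ExS p) ->
    proves Ax (p :: map shiftS G) (shiftS q) -> proves Ax G q
| pr_eq_refl G t : proves Ax G (Eq t t)
| pr_eq_subst G p t u :
    proves Ax G (Eq t u) -> proves Ax G (instN t p) -> proves Ax G (instN u p).

Definition provable (Ax : form -> Prop) (p : form) : Prop := proves Ax [] p.

Inductive bounded : form -> Prop :=
| bd_eq t u : bounded (Eq t u)
| bd_lt t u : bounded (Lt t u)
| bd_mem t X : bounded (Mem t X)
| bd_bot : bounded Bot
| bd_imp p q : bounded p -> bounded q -> bounded (Imp p q)
| bd_and p q : bounded p -> bounded q -> bounded (And p q)
| bd_or p q : bounded p -> bounded q -> bounded (Or p q)
| bd_all t p : bounded p -> bounded (AllN (Imp (Lt (Var 0) (shift_term t)) p))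
| bd_ex t p : bounded p -> bounded (ExN (And (Lt (Var 0) (shift_term t)) p)).

Inductive Sigma01 : form -> Prop :=
| Sigma01_ex p : bounded p -> Sigma01 (ExN p).

Inductive Pi01 : form -> Prop :=
| Pi01_all p : bounded p -> Pi01 (AllN p).

(** In the two schemes number variable [0] of [p] and [q] is the distinguished
    variable; all other free variables, of both sorts, are parameters. *)
Definition succ_inst : form -> form :=
  subst (scons (Plus (Var 0) One) (fun i => Var (S i))) (fun X => X).

Definition induction (p : form) : form :=
  Imp (And (instN Zero p) (AllN (Imp p (succ_inst p)))) (AllN p).

Definition comprehension (p q : form) : form :=
  Imp (AllN (Iff p q)) (ExS (AllN (Iff (Mem (Var 0) 0) (shiftS p)))).

Inductive RCA0 : form -> Prop :=
| rca_succ_ne_0 : RCA0 (Not (Eq (Plus (Var 0) One) Zero))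
| rca_succ_inj :
    RCA0 (Imp (Eq (Plus (Var 0) One) (Plus (Var 1) One)) (Eq (Var 0) (Var 1)))
| rca_add_0 : RCA0 (Eq (Plus (Var 0) Zero) (Var 0))
| rca_add_succ :
    RCA0 (Eq (Plus (Var 0) (Plus (Var 1) One)) (Plus (Plus (Var 0) (Var 1)) One))
| rca_mul_0 : RCA0 (Eq (Mult (Var 0) Zero) Zero)
| rca_mul_succ :
    RCA0 (Eq (Mult (Var 0) (Plus (Var 1) One)) (Plus (Mult (Var 0) (Var 1)) (Var 0)))
| rca_lt_0 : RCA0 (Not (Lt (Var 0) Zero))
| rca_lt_succ :
    RCA0 (Iff (Lt (Var 0) (Plus (Var 1) One))
              (Or (Lt (Var 0) (Var 1)) (Eq (Var 0) (Var 1))))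
| rca_induction p : Sigma01 p -> RCA0 (induction p)
| rca_comprehension p q : Sigma01 p -> Pi01 q -> RCA0 (comprehension p q).

(** To write concrete formulas with binders we use expressions that depend on
    the number of enclosing number quantifiers [n] and set quantifiers [s].
    The variable bound by a quantifier at depth [n] has de Bruijn index
    [m - S n] when it occurs at depth [m].  A closed formula is the value at
    depth [0, 0], see [sentence]. *)

Definition tm : Type := nat -> term.
Definition st : Type := nat -> nat.
Definition fm : Type := nat -> nat -> form.

Definition sentence (p : fm) : form := p 0 0.

Definition t0 : tm := fun _ => Zero.
Definition t1 : tm := fun _ => One.
Definition tadd (t u : tm) : tm := fun n => Plus (t n) (u n).
Definition tmul (t u : tm) : tm := fun n => Mult (t n) (u n).

Definition f_eq (t u : tm) : fm := fun n _ => Eq (t n) (u n).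
Definition f_lt (t u : tm) : fm := fun n _ => Lt (t n) (u n).
Definition f_mem (t : tm) (X : st) : fm := fun n s => Mem (t n) (X s).
Definition f_bot : fm := fun _ _ => Bot.
Definition f_imp (p q : fm) : fm := fun n s => Imp (p n s) (q n s).
Definition f_and (p q : fm) : fm := fun n s => And (p n s) (q n s).
Definition f_or (p q : fm) : fm := fun n s => Or (p n s) (q n s).
Definition f_allN (P : tm -> fm) : fm :=
  fun n s => AllN (P (fun m => Var (m - S n)) (S n) s).
Definition f_exN (P : tm -> fm) : fm :=
  fun n s => ExN (P (fun m => Var (m - S n)) (S n) s).
Definition f_allS (P : st -> fm) : fm :=
  fun n s => AllS (P (fun m => m - S s) n (S s)).
Definition f_exS (P : st -> fm) : fm :=
  fun n s => ExS (P (fun m => m - S s) n (S s)).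

Definition f_top : fm := f_imp f_bot f_bot.
Definition f_not (p : fm) : fm := f_imp p f_bot.
Definition f_iff (p q : fm) : fm := f_and (f_imp p q) (f_imp q p).
Definition f_le (t u : tm) : fm := f_or (f_lt t u) (f_eq t u).

Declare Scope tm_scope.
Delimit Scope tm_scope with tm.
Bind Scope tm_scope with tm.
Declare Scope fm_scope.
Delimit Scope fm_scope with fm.
Bind Scope fm_scope with fm.

Notation "0" := t0 : tm_scope.
Notation "1" := t1 : tm_scope.
Notation "t + u" := (tadd t u) : tm_scope.
Notation "t * u" := (tmul t u) : tm_scope.

Notation "t = u" := (f_eq t%tm u%tm) : fm_scope.
Notation "t < u" := (f_lt t%tm u%tm) : fm_scope.
Notation "t <= u" := (f_le t%tm u%tm) : fm_scope.
Notation "t ∈ X" := (f_mem t%tm X) (at level 70) : fm_scope.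
Notation "~ p" := (f_not p) : fm_scope.
Notation "p /\ q" := (f_and p q) : fm_scope.
Notation "p \/ q" := (f_or p q) : fm_scope.
Notation "p <-> q" := (f_iff p q) : fm_scope.
Notation "p ⇒ q" := (f_imp p q)
  (at level 99, right associativity, q at level 200) : fm_scope.
Notation "'All' x , p" := (f_allN (fun x => p%fm))
  (at level 200, x name, right associativity) : fm_scope.
Notation "'Ex' x , p" := (f_exN (fun x => p%fm))
  (at level 200, x name, right associativity) : fm_scope.
Notation "'AllSet' X , p" := (f_allS (fun X => p%fm))
  (at level 200, X name, right associativity) : fm_scope.
Notation "'ExSet' X , p" := (f_exS (fun X => p%fm))
  (at level 200, X name, right associativity) : fm_scope.

Local Open Scope fm_scope.

(** Objects that are not terms of the language, such as the value of a function
    coded by a set, are eliminated by their description: for [e : expr A] and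
    [k : A -> fm], the formula [e k] says that [e] has a value [v] with [k v]. *)

Definition expr (A : Type) : Type := (A -> fm) -> fm.

Definition ret {A : Type} (a : A) : expr A := fun k => k a.
Definition bind {A B : Type} (e : expr A) (f : A -> expr B) : expr B :=
  fun k => e (fun a => f a k).

Definition npair (a b : tm) : tm := ((a + b) * (a + b) + a)%tm.

Definition app (F : st) (a : tm) : expr tm := fun k => Ex b, npair a b ∈ F /\ k b.

Definition is_nat : tm -> fm := fun _ => f_top.

Definition is_fun (dom cod : tm -> fm) (F : st) : fm :=
  (All p, p ∈ F ⇒ Ex a, Ex b, p = npair a b /\ dom a /\ cod b) /\
  (All a, dom a ⇒
     Ex b, npair a b ∈ F /\ All c, npair a c ∈ F ⇒ b = c).

(** [Frac a b d] stands for (a - b) / d, where d is positive. *)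

Record frac : Type := Frac { pos : tm; neg : tm; den : tm }.

Definition frac_add (x y : frac) : frac :=
  Frac (pos x * den y + pos y * den x)%tm
       (neg x * den y + neg y * den x)%tm
       (den x * den y)%tm.
Definition frac_opp (x : frac) : frac := Frac (neg x) (pos x) (den x).
Definition frac_eq (x y : frac) : fm :=
  pos x * den y + neg y * den x = pos y * den x + neg x * den y.
Definition frac_lt (x y : frac) : fm :=
  pos x * den y + neg y * den x < pos y * den x + neg x * den y.
Definition frac_le (x y : frac) : fm := frac_lt x y \/ frac_eq x y.

(** The fraction coded by a number. *)
Definition code_frac (q : tm) : expr frac :=
  fun k => Ex a, Ex b, Ex c, q = npair (npair a b) c /\ k (Frac a b (c + 1)%tm).

(** Each rational is represented by the least code of a fraction equal to it;
    thus equality of rationals is equality of numbers. *)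
Definition is_rat (q : tm) : fm :=
  code_frac q (fun x =>
    All r, r < q ⇒ ~ code_frac r (fun y => frac_eq x y)).

Definition rat : Type := expr frac.

Definition rat_of_nat (n : tm) : rat := ret (Frac n t0 t1).
Definition rat_zero : rat := rat_of_nat t0.
Definition rat_inv (n : tm) : rat := ret (Frac t1 t0 n).
Definition rat_add (x y : rat) : rat :=
  bind x (fun u => bind y (fun v => ret (frac_add u v))).
Definition rat_opp (x : rat) : rat := bind x (fun u => ret (frac_opp u)).
Definition rat_sub (x y : rat) : rat := rat_add x (rat_opp y).
Definition rat_abs (x : rat) : rat := fun k =>
  x (fun u => (frac_le (Frac t0 t0 t1) u /\ k u) \/
              (frac_lt u (Frac t0 t0 t1) /\ k (frac_opp u))).
Definition rat_lt (x y : rat) : fm := x (fun u => y (fun v => frac_lt u v)).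
Definition rat_le (x y : rat) : fm := x (fun u => y (fun v => frac_le u v)).

Definition all_pos_rat (P : rat -> fm) : fm :=
  All e, is_rat e ⇒ rat_lt rat_zero (code_frac e) ⇒ P (code_frac e).
Definition ex_pos_rat (P : rat -> fm) : fm :=
  Ex e, is_rat e /\ rat_lt rat_zero (code_frac e) /\ P (code_frac e).

Notation "'AllEps' e , p" := (all_pos_rat (fun e => p%fm))
  (at level 200, e name, right associativity) : fm_scope.
Notation "'ExEps' e , p" := (ex_pos_rat (fun e => p%fm))
  (at level 200, e name, right associativity) : fm_scope.

(** A real given by a set variable is coded by a function from N to Q; the
    operations act on arbitrary defined sequences of rationals. *)

Definition is_real (X : st) : fm :=
  is_fun is_nat is_rat X /\
  AllEps e, Ex N, All m, All n, N <= m ⇒ N <= n ⇒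
    rat_lt (rat_abs (rat_sub (bind (app X m) code_frac)
                             (bind (app X n) code_frac))) e.

Definition real : Type := tm -> rat.

Definition real_of_set (X : st) : real := fun n => bind (app X n) code_frac.
Definition real_of_rat (q : rat) : real := fun _ => q.
Definition real_sub (x y : real) : real := fun n => rat_sub (x n) (y n).
Definition real_abs (x : real) : real := fun n => rat_abs (x n).

Definition real_le (x y : real) : fm :=
  AllEps e, Ex N, All n, N <= n ⇒ rat_le (x n) (rat_add (y n) e).
Definition real_eq (x y : real) : fm := real_le x y /\ real_le y x.
Definition real_lt (x y : real) : fm := real_le x y /\ ~ real_eq x y.

Definition all_real (P : st -> fm) : fm := AllSet X, is_real X ⇒ P X.

Notation "'AllReal' x , p" := (all_real (fun x => p%fm))
  (at level 200, x name, right associativity) : fm_scope.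

(** [z] lies in the ball of radius [d] around [y]. *)
Definition ball (d : rat) (y z : real) : fm :=
  real_lt (real_abs (real_sub y z)) (real_of_rat d).

Definition interval (a b : rat) (x : real) : fm :=
  real_le (real_of_rat a) x /\ real_le x (real_of_rat b).

(** [f q i] is the rational f(q)_i. *)

Definition repr : Type := tm -> tm -> rat.

Definition in_dom (f : repr) (x : real) : fm :=
  AllEps e, Ex N, 0 < N /\
    All q, All r, is_rat q ⇒ is_rat r ⇒
      ball (rat_inv N) x (real_of_rat (code_frac q)) ⇒
      ball (rat_inv N) x (real_of_rat (code_frac r)) ⇒
      All i, All j, N <= i ⇒ N <= j ⇒
        rat_lt (rat_abs (rat_sub (f q i) (f r j))) e.

(** f(x) = (f(x_i)_i)_i *)
Definition value (f : repr) (X : st) : real :=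
  fun i => bind (app X i) (fun q => f q i).

Definition continuous_on (D : real -> fm) (f : repr) : fm :=
  AllReal x, D (real_of_set x) ⇒ in_dom f (real_of_set x).
Definition maps_to (D E : real -> fm) (f : repr) : fm :=
  AllReal x, D (real_of_set x) ⇒ E (value f x).

(** A set coding a function from Q to Q^N, as a function from Q x N to Q. *)
Definition is_repr (F : st) : fm :=
  is_fun (fun a => Ex q, Ex i, a = npair q i /\ is_rat q) is_rat F.
Definition repr_of_set (F : st) : repr :=
  fun q i => bind (app F (npair q i)) code_frac.

(** A set coding a family of functions from Q to Q^N indexed by N. *)
Definition is_repr_family (F : st) : fm :=
  is_fun (fun a => Ex n, Ex q, Ex i, a = npair n (npair q i) /\ is_rat q) is_rat F.
Definition family_of_set (F : st) : tm -> repr :=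
  fun n q i => bind (app F (npair n (npair q i))) code_frac.

Definition sequence_of_functions (D : real -> fm) (f : tm -> repr) : fm :=
  (All n, continuous_on D (f n)) /\
  AllReal x, D (real_of_set x) ⇒
    AllEps e, Ex N, 0 < N /\
      All q, is_rat q ⇒
        ball (rat_inv N) (real_of_set x) (real_of_rat (code_frac q)) ⇒
        All n, All i, All j, N <= i ⇒ N <= j ⇒
          rat_lt (rat_abs (rat_sub (f n q i) (f n q j))) e.

Definition uniformly_equicontinuous (D : real -> fm) (f : tm -> repr) : fm :=
  AllEps e, ExEps d, All n,
    AllReal x, AllReal y, D (real_of_set x) ⇒ D (real_of_set y) ⇒
      real_lt (real_abs (real_sub (real_of_set x) (real_of_set y)))
              (real_of_rat d) ⇒
      real_lt (real_abs (real_sub (value (f n) x) (value (f n) y)))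
              (real_of_rat e).

Definition converges_uniformly (D : real -> fm) (f : tm -> repr) (g : repr) : fm :=
  AllEps e, Ex N, AllReal x, D (real_of_set x) ⇒
    All n, N <= n ⇒
      real_lt (real_abs (real_sub (value (f n) x) (value g x))) (real_of_rat e).

Definition strictly_increasing (G : st) : fm :=
  is_fun is_nat is_nat G /\
  All i, All j, i < j ⇒ app G i (fun a => app G j (fun b => a < b)).

Definition subsequence (f : tm -> repr) (G : st) : tm -> repr :=
  fun i q j => bind (app G i) (fun n => f n q j).

Definition finite (P : tm -> fm) : fm := Ex k, All m, P m ⇒ m < k.
Definition infinite (P : tm -> fm) : fm := ~ finite P.

Definition IPP : fm :=
  All N, AllSet c, is_fun is_nat (fun n => n <= N) c ⇒
    Ex n, n <= N /\ infinite (fun i => app c i (fun v => v = n)).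

(** [R] codes the family of the sets R_i = { m | npair i m ∈ R }. *)
Definition COH : fm :=
  AllSet R, ExSet C,
    infinite (fun m => m ∈ C) /\
    All i,
      finite (fun m => m ∈ C /\ ~ (npair i m ∈ R)) \/
      finite (fun m => m ∈ C /\ ~ ~ (npair i m ∈ R)).

Definition StCOH : fm := COH /\ IPP.

Definition ArzelaAscoli : fm :=
  let D := interval rat_zero (rat_of_nat t1) in
  AllSet F, is_repr_family F ⇒
    let f := family_of_set F in
    sequence_of_functions D f ⇒
    All B,
      (All n, maps_to D (interval (rat_opp (rat_of_nat B)) (rat_of_nat B)) (f n)) ⇒
      uniformly_equicontinuous D f ⇒
      ExSet G, strictly_increasing G /\
        ExSet H, is_repr H /\ continuous_on D (repr_of_set H) /\
          converges_uniformly D (subsequence f G) (repr_of_set H).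

(* Main.v *)
(** The calculus is complete for Henkin structures: a sentence that holds in every countable
    two-sorted model of RCA0 is provable.  So fix a model, with possibly nonstandard numbers M,
    and let K be the ordered field of fractions of M.  Finite sets of numbers are coded by
    divisibility, which gives primitive recursion in M.

    From Arzela-Ascoli to StCOH, constant functions suffice: the theorem then says that a bounded
    sequence of rationals has a Cauchy subsequence (without a rate).  For a finite colouring, such
    a subsequence is eventually constant.  For sets (R_i), take the subsequence of
    x_n = sum_(i < n, n in R_i) 3^-i; membership in R_i is determined by a good approximation to x_n.

    Conversely, apply COH to the sets { n | f_n(q)_n < r } with q, r rational.  On the cohesive set
    each comparison of f_n(q)_n with r is eventually constant.  The pigeonhole principle yields
    collection for Pi-0-1 formulas, which makes this uniform over finitely many q and r; by
    equicontinuity a finite grid of arguments q controls the whole unit interval.  Hence the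
    functions f_n with n in the cohesive set are uniformly Cauchy, and the diagonal f_n(q)_n
    represents their limit. *)

From HB Require Import structures.
From mathcomp Require Import ssreflect ssrfun ssrbool eqtype ssrnat seq choice order ssralg ssrnum.
From mathcomp Require Import boolp.
From mathcomp Require Import ring lra.
From Stdlib Require Import List.
Require Import Defs.
Import Order.TTheory GRing.Theory Num.Theory.

(** * Substitution and derivations *)

(** Passing to models replaces derivations in the calculus by ordinary mathematics. The weakness of
    RCA0 survives as a restriction on definability: induction is available for Sigma1 predicates,
    comprehension and minimization for Delta1 ones. Every auxiliary function therefore has to be
    shown definable, and much of the middle of the development consists of closure properties of
    [Delta0], [Sigma1], [Delta1fun] and [Delta1rat]. These are classes of predicates and functions
    on assignments, so that closure is checked without handling syntax, and countability of the
    model lets each of its elements occur as a parameter. The passage to [K] removes the coding from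
    the analysis: rationals of the model become elements of an ordered field, to which linear
    arithmetic applies, and reals become definable Cauchy functions from [M] to [K]. As reals carry
    no rate of convergence, inequalities between them hold only from some index on and up to an
    error, and strict ones are proved through a fixed gap. *)

Lemma subst_term_comp s1 s2 t :
  subst_term s2 (subst_term s1 t) = subst_term (fun i => subst_term s2 (s1 i)) t.
Proof. by elim: t => //= t -> u ->. Qed.

Lemma subst_term_Var t : subst_term Var t = t.
Proof. by elim: t => //= t -> u ->. Qed.

Lemma up_term_comp s1 s2 :
  (fun i => subst_term (up_term s2) (up_term s1 i)) =
  up_term (fun i => subst_term s2 (s1 i)).
Proof. by apply/funext => -[|i] //=; rewrite /shift_term !subst_term_comp. Qed.

Lemma up_set_comp r1 r2 :
  (fun i => up_set r2 (up_set r1 i)) = up_set (fun i => r2 (r1 i)).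
Proof. by apply/funext => -[|i]. Qed.

Lemma up_term_Var : up_term Var = Var.
Proof. by apply/funext => -[|i]. Qed.

Lemma up_set_id : up_set (fun X => X) = (fun X => X).
Proof. by apply/funext => -[|i]. Qed.

Lemma subst_comp p s1 r1 s2 r2 :
  subst s2 r2 (subst s1 r1 p) =
  subst (fun i => subst_term s2 (s1 i)) (fun X => r2 (r1 X)) p.
Proof.
elim: p s1 r1 s2 r2 => //=; intros; rewrite ?subst_term_comp //; f_equal => //;
  by rewrite H ?up_term_comp ?up_set_comp.
Qed.

Lemma subst_id p : subst Var (fun X => X) p = p.
Proof.
by elim: p => //=; intros; rewrite ?subst_term_Var ?up_term_Var ?up_set_id; congruence.
Qed.

Lemma subst_instN s r t p :
  subst s r (instN t p) = instN (subst_term s t) (subst (up_term s) r p).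
Proof.
rewrite /instN !subst_comp; congr subst; apply/funext => -[|i] //=.
by rewrite /shift_term subst_term_comp /= subst_term_Var.
Qed.

Lemma subst_instS s r X p :
  subst s r (instS X p) = instS (r X) (subst s (up_set r) p).
Proof.
rewrite /instS !subst_comp; congr subst; last by apply/funext => -[|i].
by apply/funext => i /=; rewrite subst_term_Var.
Qed.

Lemma subst_shiftN s r p :
  subst (up_term s) r (shiftN p) = shiftN (subst s r p).
Proof. by rewrite /shiftN !subst_comp. Qed.

Lemma subst_shiftS s r p :
  subst s (up_set r) (shiftS p) = shiftS (subst s r p).
Proof.
rewrite /shiftS !subst_comp; congr subst.
by apply/funext => i; rewrite subst_term_Var.
Qed.

Lemma instN_up t s r p :
  instN t (subst (up_term s) r p) = subst (scons t s) r p.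
Proof.
rewrite /instN subst_comp; congr subst; apply/funext => -[|i] //=.
by rewrite /shift_term subst_term_comp /= subst_term_Var.
Qed.

Lemma instS_up X s r p :
  instS X (subst s (up_set r) p) = subst s (scons X r) p.
Proof.
rewrite /instS subst_comp; congr subst; last by apply/funext => -[|i].
by apply/funext => i; rewrite subst_term_Var.
Qed.

Section Derivations.
Context {Ax : form -> Prop}.
(** Instances need only be provable, not axioms themselves: an arithmetical axiom of [RCA0] is one
    open formula, and its instances are obtained by generalization and instantiation. *)
Hypothesis Ax_subst : forall p s r, Ax p -> proves Ax nil (subst s r p).

Lemma incl_cons2 (p : form) G G' : incl G G' -> incl (p :: G) (p :: G').
Proof. by move=> H x [->|/H]; [left|right]. Qed.

Lemma weakening G G' p : proves Ax G p -> incl G G' -> proves Ax G' p.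
Proof.
move=> H; elim: H G' => {G p}.
- by move=> G p H G' _; apply: pr_ax.
- by move=> G p H G' GG; apply: pr_hyp; apply: GG.
- by move=> G p q _ IH G' GG; apply: pr_imp_i; apply: IH; apply: incl_cons2.
- by move=> G p q _ IH1 _ IH2 G' GG; apply: pr_imp_e (IH1 _ GG) (IH2 _ GG).
- by move=> G p q _ IH1 _ IH2 G' GG; apply: pr_and_i (IH1 _ GG) (IH2 _ GG).
- by move=> G p q _ IH G' GG; apply: pr_and_e1 (IH _ GG).
- by move=> G p q _ IH G' GG; apply: pr_and_e2 (IH _ GG).
- by move=> G p q _ IH G' GG; apply: pr_or_i1 (IH _ GG).
- by move=> G p q _ IH G' GG; apply: pr_or_i2 (IH _ GG).
- move=> G p q r _ IH1 _ IH2 _ IH3 G' GG; apply: pr_or_e (IH1 _ GG) _ _.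
    by apply: IH2; apply: incl_cons2.
  by apply: IH3; apply: incl_cons2.
- by move=> G p _ IH G' GG; apply: pr_raa; apply: IH; apply: incl_cons2.
- by move=> G p _ IH G' GG; apply: pr_allN_i; apply: IH; apply: incl_map.
- by move=> G p t _ IH G' GG; apply: pr_allN_e; apply: IH.
- by move=> G p t _ IH G' GG; apply: pr_exN_i; apply: IH.
- move=> G p q _ IH1 _ IH2 G' GG; apply: pr_exN_e (IH1 _ GG) _.
  by apply: IH2; apply: incl_cons2; apply: incl_map.
- by move=> G p _ IH G' GG; apply: pr_allS_i; apply: IH; apply: incl_map.
- by move=> G p t _ IH G' GG; apply: pr_allS_e; apply: IH.
- by move=> G p t _ IH G' GG; apply: pr_exS_i; apply: IH.
- move=> G p q _ IH1 _ IH2 G' GG; apply: pr_exS_e (IH1 _ GG) _.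
  by apply: IH2; apply: incl_cons2; apply: incl_map.
- by move=> G t G' _; apply: pr_eq_refl.
- by move=> G p t u _ IH1 _ IH2 G' GG; apply: pr_eq_subst (IH1 _ GG) (IH2 _ GG).
Qed.

Lemma map_shiftN_subst s r G :
  List.map (subst (up_term s) r) (List.map shiftN G) =
  List.map shiftN (List.map (subst s r) G).
Proof. by rewrite !map_map; apply: map_ext => p; apply: subst_shiftN. Qed.

Lemma map_shiftS_subst s r G :
  List.map (subst s (up_set r)) (List.map shiftS G) =
  List.map shiftS (List.map (subst s r) G).
Proof. by rewrite !map_map; apply: map_ext => p; apply: subst_shiftS. Qed.

Lemma proves_subst G p s r :
  proves Ax G p -> proves Ax (List.map (subst s r) G) (subst s r p).
Proof.
move=> H; elim: H s r => {G p} /=.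
- by move=> G p H s r; apply: weakening (Ax_subst _ s r H) (incl_nil_l _).
- by move=> G p H s r; apply: pr_hyp; apply: in_map.
- by move=> G p q _ IH s r; apply: pr_imp_i; apply: IH.
- by move=> G p q _ IH1 _ IH2 s r; apply: pr_imp_e (IH1 s r) (IH2 s r).
- by move=> G p q _ IH1 _ IH2 s r; apply: pr_and_i (IH1 s r) (IH2 s r).
- by move=> G p q _ IH s r; apply: pr_and_e1 (IH s r).
- by move=> G p q _ IH s r; apply: pr_and_e2 (IH s r).
- by move=> G p q _ IH s r; apply: pr_or_i1 (IH s r).
- by move=> G p q _ IH s r; apply: pr_or_i2 (IH s r).
- by move=> G p q t _ IH1 _ IH2 _ IH3 s r; apply: pr_or_e (IH1 s r) (IH2 s r) (IH3 s r).
- by move=> G p _ IH s r; apply: pr_raa; apply: IH.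
- by move=> G p _ IH s r; apply: pr_allN_i; rewrite -map_shiftN_subst.
- by move=> G p t _ IH s r; rewrite subst_instN; apply: pr_allN_e; apply: IH.
- by move=> G p t _ IH s r; apply: (pr_exN_i Ax _ _ (subst_term s t)); rewrite -subst_instN.
- move=> G p q _ IH1 _ IH2 s r; apply: pr_exN_e (IH1 s r) _.
  by rewrite -map_shiftN_subst -subst_shiftN; apply: IH2.
- by move=> G p _ IH s r; apply: pr_allS_i; rewrite -map_shiftS_subst.
- by move=> G p t _ IH s r; rewrite subst_instS; apply: pr_allS_e; apply: IH.
- by move=> G p t _ IH s r; apply: (pr_exS_i Ax _ _ (r t)); rewrite -subst_instS.
- move=> G p q _ IH1 _ IH2 s r; apply: pr_exS_e (IH1 s r) _.
  by rewrite -map_shiftS_subst -subst_shiftS; apply: IH2.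
- by move=> G t s r; apply: pr_eq_refl.
- move=> G p t u _ IH1 _ IH2 s r; rewrite subst_instN.
  by apply: pr_eq_subst (IH1 s r) _; rewrite -subst_instN.
Qed.

Lemma proves_cut G p q : proves Ax G p -> proves Ax (p :: G) q -> proves Ax G q.
Proof. by move=> Hp Hq; apply: pr_imp_e Hp; apply: pr_imp_i. Qed.

Lemma proves_exfalso G p : proves Ax G Bot -> proves Ax G p.
Proof. by move=> H; apply: pr_raa; apply: weakening H _; apply: incl_tl. Qed.

(** The variables below [k] include all free variables of [p], of both sorts. *)
Definition closed_below (k : nat) (p : form) : Prop :=
  forall s s' r r', (forall i, i < k -> s i = s' i /\ r i = r' i) ->
    subst s r p = subst s' r' p.

Lemma closed_below_term t : exists k, forall s s',
  (forall i, i < k -> s i = s' i) -> subst_term s t = subst_term s' t.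
Proof.
have bin u v (f : term -> term -> term) :
    (exists k, forall s s', (forall i, i < k -> s i = s' i) -> subst_term s u = subst_term s' u) ->
    (exists k, forall s s', (forall i, i < k -> s i = s' i) -> subst_term s v = subst_term s' v) ->
    exists k, forall s s', (forall i, i < k -> s i = s' i) ->
      f (subst_term s u) (subst_term s v) = f (subst_term s' u) (subst_term s' v).
  move=> [k Hk] [l Hl]; exists (maxn k l) => s s' H.
  by rewrite (Hk s s') ?(Hl s s') // => i Hi; apply: H; rewrite leq_max Hi ?orbT.
elim: t => [i||| u Hu v Hv|u Hu v Hv]; try by exists 0.
- by exists i.+1 => s s' H; apply: H.
- exact: bin.
- exact: bin.
Qed.

Lemma closed_below_leq k l p : k <= l -> closed_below k p -> closed_below l p.
Proof. by move=> kl H s s' r r' E; apply: H => i ik; apply: E; apply: leq_trans kl. Qed.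

Lemma closed_below_ex p : exists k, closed_below k p.
Proof.
have bin u v (f : form -> form -> form) :
    (exists k, closed_below k u) -> (exists k, closed_below k v) ->
    exists k, forall s s' r r', (forall i, i < k -> s i = s' i /\ r i = r' i) ->
      f (subst s r u) (subst s r v) = f (subst s' r' u) (subst s' r' v).
  move=> [k /(closed_below_leq _ _ _ (leq_maxl _ _)) Hk].
  move=> [l /(closed_below_leq _ _ _ (leq_maxr k _)) Hl].
  by exists (maxn k l) => s s' r r' H; rewrite (Hk l s s' r r') // (Hl s s' r r').
have bint t u (f : term -> term -> form) :
    exists k, forall s s' (r r' : nat -> nat), (forall i, i < k -> s i = s' i /\ r i = r' i) ->
      f (subst_term s t) (subst_term s u) = f (subst_term s' t) (subst_term s' u).
  have [k Hk] := closed_below_term (Plus t u).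
  exists k => s s' r r' H.
  by case: (Hk s s' (fun i ik => (H i ik).1)) => -> ->.
elim: p => [t u|t u|t X||p Hp q Hq|p Hp q Hq|p Hp q Hq|p Hp|p Hp|p Hp|p Hp];
  try exact: bin; try exact: bint.
- have [k Hk] := closed_below_term t; exists (maxn k X.+1) => s s' r r' H /=.
  rewrite (Hk s s') => [|i ik]; last by apply: (H i _).1; rewrite leq_max ik.
  by rewrite (H X _).2 // leq_max ltnS leqnn orbT.
- by exists 0.
- case: Hp => k Hk; exists k => s s' r r' H /=; congr AllN; apply: Hk.
  by case=> [|i] ik //=; [split=> //; apply: (H _ ik).2|rewrite (H i (ltnW ik)).1 (H _ ik).2].
- case: Hp => k Hk; exists k => s s' r r' H /=; congr ExN; apply: Hk.
  by case=> [|i] ik //=; [split=> //; apply: (H _ ik).2|rewrite (H i (ltnW ik)).1 (H _ ik).2].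
- case: Hp => k Hk; exists k => s s' r r' H /=; congr AllS; apply: Hk.
  by case=> [|i] ik //=; [split=> //; apply: (H _ ik).1|rewrite (H i (ltnW ik)).2 (H _ ik).1].
- case: Hp => k Hk; exists k => s s' r r' H /=; congr ExS; apply: Hk.
  by case=> [|i] ik //=; [split=> //; apply: (H _ ik).1|rewrite (H i (ltnW ik)).2 (H _ ik).1].
Qed.

Lemma closed_below_list G : exists k, forall p, In p G -> closed_below k p.
Proof.
elim: G => [|q G [k Hk]]; first by exists 0.
have [l Hl] := closed_below_ex q; exists (maxn k l) => p [<-|Hp].
  exact: closed_below_leq (leq_maxr _ _) Hl.
exact: closed_below_leq (leq_maxl _ _) (Hk p Hp).
Qed.

Definition consistent (G : list form) : Prop := ~ proves Ax G Bot.

(** No new constants are needed: contexts are finite, so a variable beyond all their free variables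
    can serve as Henkin witness. *)
Lemma consistent_exN G q :
  consistent G -> In (ExN q) G ->
  exists t, consistent (instN t q :: G).
Proof.
move=> cG qG; have [k Hk] := closed_below_list (q :: G).
exists (Var k) => H; apply: cG.
apply: (pr_exN_e Ax _ q); first exact: pr_hyp.
(* The renaming sends the fresh variable to the bound one and shifts those below it, so it turns the
   instance back into [q] and acts on [G] as [shiftN], which is the form required by existential
   elimination. *)
pose s i := if i == k then Var 0 else Var i.+1.
have sE i : i < k -> s i = Var i.+1 by rewrite /s => /ltn_eqF->.
have := proves_subst _ _ s (fun X => X) H; rewrite /= /instN subst_comp.
have -> : subst (fun i => subst_term s (scons (Var k) Var i)) (fun X => X) q = q.
  rewrite -[RHS]subst_id; apply: (Hk q); first by left.
  by case=> [|i] ik; split=> //=; [rewrite /s eqxx|exact: sE (ltnW ik)].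
rewrite (map_ext_in (subst s _) shiftN) // => p pG.
by apply: (Hk p); [right|move=> i /sE].
Qed.

Lemma consistent_exS G q :
  consistent G -> In (ExS q) G ->
  exists X, consistent (instS X q :: G).
Proof.
move=> cG qG; have [k Hk] := closed_below_list (q :: G).
exists k => H; apply: cG.
apply: (pr_exS_e Ax _ q); first exact: pr_hyp.
pose r i := if i == k then 0 else i.+1.
have rE i : i < k -> r i = i.+1 by rewrite /r => /ltn_eqF->.
have := proves_subst _ _ Var r H; rewrite /= /instS subst_comp.
have -> : subst Var (fun X => r (scons k (fun Y => Y) X)) q = q.
  rewrite -[RHS]subst_id; apply: (Hk q); first by left.
  by case=> [|i] ik; split=> //=; [rewrite /r eqxx|exact: rE (ltnW ik)].
rewrite (map_ext_in (subst Var r) shiftS) // => p pG.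
by apply: (Hk p); [right|move=> i /rE].
Qed.

End Derivations.

(** * Completeness for two-sorted structures *)

(** Countability is part of the notion: the two enumerations let parameters of
    formulas be supplied by one fixed assignment. *)
Record structure := Structure {
  dom :> Type;
  dzero : dom;
  dunit : dom;
  dadd : dom -> dom -> dom;
  dmul : dom -> dom -> dom;
  dlt : dom -> dom -> Prop;
  dset : Type;
  dmem : dom -> dset -> Prop;
  dnum : nat -> dom;
  dnum_surj : forall a, exists i, dnum i = a;
  dnumS : nat -> dset;
  dnumS_surj : forall X, exists i, dnumS i = X }.

Arguments dadd {_} _ _.
Arguments dmul {_} _ _.
Arguments dlt {_} _ _.
Arguments dmem {_} _ _.

Fixpoint eval (Mo : structure) (e : nat -> Mo) (t : term) : Mo :=
  match t with
  | Var i => e i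
  | Zero => dzero Mo
  | One => dunit Mo
  | Plus t u => dadd (eval Mo e t) (eval Mo e u)
  | Mult t u => dmul (eval Mo e t) (eval Mo e u)
  end.

Fixpoint sat (Mo : structure) (e : nat -> Mo) (E : nat -> dset Mo) (p : form) : Prop :=
  match p with
  | Eq t u => eval Mo e t = eval Mo e u
  | Lt t u => dlt (eval Mo e t) (eval Mo e u)
  | Mem t X => dmem (eval Mo e t) (E X)
  | Bot => False
  | Imp p q => sat Mo e E p -> sat Mo e E q
  | And p q => sat Mo e E p /\ sat Mo e E q
  | Or p q => sat Mo e E p \/ sat Mo e E q
  | AllN p => forall a, sat Mo (scons a e) E p
  | ExN p => exists a, sat Mo (scons a e) E p
  | AllS p => forall X, sat Mo e (scons X E) p
  | ExS p => exists X, sat Mo e (scons X E) p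
  end.

Lemma eval_subst (Mo : structure) (e : nat -> Mo) s t :
  eval Mo e (subst_term s t) = eval Mo (fun i => eval Mo e (s i)) t.
Proof. by elim: t => //= t -> u ->. Qed.

Lemma eval_up (Mo : structure) (e : nat -> Mo) s a :
  (fun i => eval Mo (scons a e) (up_term s i)) = scons a (fun i => eval Mo e (s i)).
Proof. by apply/funext => -[|i] //=; rewrite /shift_term eval_subst. Qed.

Lemma scons_up {A : Type} (X : A) E r :
  (fun i => scons X E (up_set r i)) = scons X (fun i => E (r i)).
Proof. by apply/funext => -[|i]. Qed.

Lemma sat_subst (Mo : structure) (e : nat -> Mo) E s r p :
  sat Mo e E (subst s r p) = sat Mo (fun i => eval Mo e (s i)) (fun X => E (r X)) p.
Proof.
elim: p e E s r => /=; try by move=> *; rewrite ?eval_subst.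
- by move=> p IHp q IHq *; rewrite IHp IHq.
- by move=> p IHp q IHq *; rewrite IHp IHq.
- by move=> p IHp q IHq *; rewrite IHp IHq.
- by move=> p IHp e E s r; apply: eq_forall => a; rewrite IHp eval_up.
- by move=> p IHp e E s r; apply: eq_exists => a; rewrite IHp eval_up.
- by move=> p IHp e E s r; apply: eq_forall => a; rewrite IHp scons_up.
- by move=> p IHp e E s r; apply: eq_exists => a; rewrite IHp scons_up.
Qed.

Fixpoint tree_of_term (t : term) : GenTree.tree nat :=
  match t with
  | Var i => GenTree.Leaf i
  | Zero => GenTree.Node 0 [::]
  | One => GenTree.Node 1 [::]
  | Plus t u => GenTree.Node 2 [:: tree_of_term t; tree_of_term u]
  | Mult t u => GenTree.Node 3 [:: tree_of_term t; tree_of_term u]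
  end.

Fixpoint tree_of_form (p : form) : GenTree.tree nat :=
  match p with
  | Eq t u => GenTree.Node 0 [:: tree_of_term t; tree_of_term u]
  | Lt t u => GenTree.Node 1 [:: tree_of_term t; tree_of_term u]
  | Mem t X => GenTree.Node 2 [:: tree_of_term t; GenTree.Leaf X]
  | Bot => GenTree.Node 3 [::]
  | Imp p q => GenTree.Node 4 [:: tree_of_form p; tree_of_form q]
  | And p q => GenTree.Node 5 [:: tree_of_form p; tree_of_form q]
  | Or p q => GenTree.Node 6 [:: tree_of_form p; tree_of_form q]
  | AllN p => GenTree.Node 7 [:: tree_of_form p]
  | ExN p => GenTree.Node 8 [:: tree_of_form p]
  | AllS p => GenTree.Node 9 [:: tree_of_form p]
  | ExS p => GenTree.Node 10 [:: tree_of_form p]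
  end.

Lemma tree_of_term_inj : injective tree_of_term.
Proof.
elim=> [i|||t IHt u IHu|t IHt u IHu] [j|||t' u'|t' u'] //= [].
- by move=> ->.
- by move=> /IHt-> /IHu->.
- by move=> /IHt-> /IHu->.
Qed.

Lemma tree_of_form_inj : injective tree_of_form.
Proof.
elim=> [t u|t u|t X||p IHp q IHq|p IHp q IHq|p IHp q IHq|p IHp|p IHp|p IHp|p IHp]
  [t' u'|t' u'|t' X'||p' q'|p' q'|p' q'|p'|p'|p'|p'] //= [];
  try by move=> /IHp-> /IHq->.
- by move=> /tree_of_term_inj-> /tree_of_term_inj->.
- by move=> /tree_of_term_inj-> /tree_of_term_inj->.
- by move=> /tree_of_term_inj-> ->.
- by move=> /IHp->.
- by move=> /IHp->.
- by move=> /IHp->.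
- by move=> /IHp->.
Qed.

Lemma surjection_of_tree {A : Type} (f : A -> GenTree.tree nat) (a0 : A) :
  injective f -> exists g : nat -> A, forall a, exists n, g n = a.
Proof.
move=> f_inj.
have H n : exists a, forall b, pickle (f b) = n -> a = b.
  have [[a ax]|no] := EM (exists a, pickle (f a) = n); last first.
    by exists a0 => b bn; case: no; exists b.
  by exists a => b; rewrite -ax => /(pcan_inj pickleK)/f_inj.
have [g gP] := choice H.
by exists g => a; exists (pickle (f a)); apply: gP.
Qed.

(** * Maximal consistent theories with witnesses *)

Section Henkin.
Context {Ax : form -> Prop}.
Hypothesis Ax_subst : forall p s r, Ax p -> proves Ax nil (subst s r p).

Notation consistent := (@consistent Ax).

(** One stage of the Lindenbaum construction. A formula that is inconsistent with the stage calls
    for no action, since its negation is then derivable. *)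
Definition Henkin_step (p : form) (G G' : list form) : Prop :=
  [/\ incl G G', consistent G -> consistent G' &
    consistent (p :: G) ->
    [/\ In p G', forall q, p = ExN q -> exists t, In (instN t q) G' &
      forall q, p = ExS q -> exists X, In (instS X q) G']].

Lemma Henkin_step_ex pG : exists G', Henkin_step pG.1 pG.2 G'.
Proof.
case: pG => p G /=.
have [c|nc] := EM (consistent (p :: G)); last first.
  by exists G; split=> // x.
have inp : In p (p :: G) by left.
have cons2 q G' : incl G' (q :: G') by move=> x; right.
have [[q pE]|no1] := EM (exists q, p = ExN q).
  have := @consistent_exN _ Ax_subst (p :: G) q c.
  rewrite -pE => /(_ inp) [t ct].
  exists (instN t q :: p :: G); split=> //; first by move=> x; right; right.
  move=> _; split; first by right; left.
    by move=> q'; rewrite pE => -[<-]; exists t; left.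
  by move=> q'; rewrite pE.
have [[q pE]|no2] := EM (exists q, p = ExS q).
  have := @consistent_exS _ Ax_subst (p :: G) q c.
  rewrite -pE => /(_ inp) [X ct].
  exists (instS X q :: p :: G); split=> //; first by move=> x; right; right.
  move=> _; split; first by right; left.
    by move=> q'; rewrite pE.
  by move=> q'; rewrite pE => -[<-]; exists X; left.
exists (p :: G); split=> // _; split=> //.
  by move=> q pE; case: no1; exists q.
by move=> q pE; case: no2; exists q.
Qed.

Variable G0 : list form.
Hypothesis G0_consistent : consistent G0.

(** [T] is the deductive closure of the union of the stages. A formula of [T] is consistent with the
    stage at which it is enumerated, because both are absorbed by some later consistent stage; so
    its witness was added there. *)
Lemma Henkin_theory_ex : exists T : form -> Prop,
  [/\ forall G p, (forall q, In q G -> T q) -> proves Ax G p -> T p,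
     ~ T Bot, forall q, In q G0 -> T q,
     forall p, T p \/ T (Not p) &
     (forall q, T (ExN q) -> exists t, T (instN t q)) /\
     (forall q, T (ExS q) -> exists X, T (instS X q))].
Proof.
have [en en_surj] := @surjection_of_tree _ tree_of_form Bot tree_of_form_inj.
have [step stepP] := choice Henkin_step_ex.
pose stage := fix stage n := if n is m.+1 then step (en m, stage m) else G0.
have mono n m : n <= m -> incl (stage n) (stage m).
  move=> /subnK <-; elim: (m - n)%N => [|k IH] x //.
  move=> /IH xk; have [+ _ _] := stepP (en (k + n)%N, stage (k + n)%N).
  by apply.
have cons n : consistent (stage n).
  elim: n => //= n IH; have [_ + _] := stepP (en n, stage n); exact.
pose T p := exists n, proves Ax (stage n) p.
have Tmem n p : In p (stage n) -> T p by exists n; apply: pr_hyp.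
have Tprove G p : (forall q, In q G -> T q) -> proves Ax G p -> T p.
  elim: G p => [|q G IH] p HG Hp.
    by exists 0; apply: weakening Hp (incl_nil_l _).
  have [n Hn] : T (Imp q p) by apply: IH (pr_imp_i _ _ _ _ Hp) => r Hr; apply: HG; right.
  have [m Hm] := HG q (or_introl erefl).
  exists (maxn n m); apply: (pr_imp_e _ _ q).
    by apply: weakening Hn _; apply: mono; rewrite leq_maxl.
  by apply: weakening Hm _; apply: mono; rewrite leq_maxr.
have TBot : ~ T Bot by case=> n; apply: cons.
have key n p : en n = p -> T p -> Henkin_step p (stage n) (stage n.+1) /\ consistent (p :: stage n).
  move=> np [m Hm]; split; first by rewrite -np; exact: (stepP (en n, stage n)).
  move=> HB; apply: (cons (maxn n m)); apply: (@proves_cut _ _ p).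
    by apply: weakening Hm _; apply: mono; rewrite leq_maxr.
  by apply: weakening HB _; apply: incl_cons2; apply: mono; rewrite leq_maxl.
exists T; split=> //.
- by move=> q; apply: (Tmem 0).
- move=> p; have [n np] := en_surj p.
  have [c|nc] := EM (consistent (p :: stage n)); last first.
    by right; exists n; apply: pr_imp_i; apply: contrapT.
  left; have [_ _] := stepP (en n, stage n).
  by rewrite /= np => /(_ c)[Hp _ _]; apply: (Tmem n.+1); rewrite /= np.
- split=> q Tq.
    have [n nq] := en_surj (ExN q).
    have [[_ _ +] c] := key _ _ nq Tq => /(_ c)[_ /(_ q erefl)[t Ht] _].
    by exists t; apply: Tmem Ht.
  have [n nq] := en_surj (ExS q).
  have [[_ _ +] c] := key _ _ nq Tq => /(_ c)[_ _ /(_ q erefl)[t Ht]].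
  by exists t; apply: Tmem Ht.
Qed.

End Henkin.

(** * The canonical model of a Henkin theory *)

Section Canonical.
Context {Ax : form -> Prop}.
Variable T : form -> Prop.
Hypothesis T_proves : forall G p, (forall q, In q G -> T q) -> proves Ax G p -> T p.
Hypothesis T_Bot : ~ T Bot.
Hypothesis T_total : forall p, T p \/ T (Not p).
Hypothesis T_exN : forall q, T (ExN q) -> exists t, T (instN t q).
Hypothesis T_exS : forall q, T (ExS q) -> exists X, T (instS X q).

Lemma T_prove1 p q : proves Ax (p :: nil) q -> T p -> T q.
Proof. by move=> H Tp; apply: T_proves H => r [<-|[]]. Qed.

Lemma T_prove2 p p' q : proves Ax (p :: p' :: nil) q -> T p -> T p' -> T q.
Proof. by move=> H Tp Tp'; apply: T_proves H => r [<-|[<-|[]]]. Qed.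

Lemma T_prove0 q : proves Ax nil q -> T q.
Proof. by move=> H; apply: T_proves H. Qed.

Let hyp0 p G : proves Ax (p :: G) p.
Proof. by apply: pr_hyp; left. Qed.

Let hyp1 p q G : proves Ax (q :: p :: G) p.
Proof. by apply: pr_hyp; right; left. Qed.

Lemma T_imp p q : T (Imp p q) <-> (T p -> T q).
Proof.
split=> [|H]; first by apply: T_prove2; apply: pr_imp_e (hyp0 _ _) (hyp1 _ _ _).
have [/H|] := T_total p.
  by apply: T_prove1; apply: pr_imp_i; apply: hyp1.
apply: T_prove1; apply: pr_imp_i; apply: proves_exfalso.
by apply: (pr_imp_e _ _ p) (hyp1 _ _ _) (hyp0 _ _).
Qed.

Lemma T_not p : T (Not p) <-> ~ T p.
Proof.
split; first by move=> /T_imp H Tp; apply/T_Bot/H.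
by move=> H; have [/H|] := T_total p.
Qed.

Lemma T_and p q : T (And p q) <-> T p /\ T q.
Proof.
split=> [H|[]].
  by split; move: H; apply: T_prove1; [apply: (pr_and_e1 _ _ _ q)|apply: (pr_and_e2 _ _ p)].
by apply: T_prove2; apply: pr_and_i (hyp0 _ _) (hyp1 _ _ _).
Qed.

Lemma T_or p q : T (Or p q) <-> T p \/ T q.
Proof.
split=> [H|[]].
- have [|/T_not nTp] := EM (T p); first by left.
  right; apply: T_prove2 H nTp.
  apply: pr_or_e (hyp0 _ _) _ (hyp0 _ _).
  apply: proves_exfalso; apply: (pr_imp_e _ _ p) (hyp0 _ _).
  by apply: pr_hyp; right; right; left.
- by apply: T_prove1; apply: pr_or_i1.
- by apply: T_prove1; apply: pr_or_i2.
Qed.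

Lemma T_ExN q : T (ExN q) <-> exists t, T (instN t q).
Proof. by split=> [/T_exN//|[t]]; apply: T_prove1; apply: pr_exN_i (hyp0 _ _). Qed.

Lemma T_ExS q : T (ExS q) <-> exists X, T (instS X q).
Proof. by split=> [/T_exS//|[t]]; apply: T_prove1; apply: pr_exS_i (hyp0 _ _). Qed.

Lemma T_AllN q : T (AllN q) <-> forall t, T (instN t q).
Proof.
split=> [H t|H]; first by move: H; apply: T_prove1; apply: pr_allN_e.
apply: contrapT => /T_not nT.
have : T (ExN (Not q)).
  apply: T_prove1 nT; apply: pr_raa; apply: (pr_imp_e _ _ _ _ (hyp1 _ _ _)).
  apply: pr_allN_i; apply: pr_raa => /=.
  apply: (pr_imp_e _ _ (shiftN (ExN (Not q)))) (hyp1 _ _ _) _.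
  (* The eigenvariable [Var 0] itself is the witness against the universal statement. *)
  apply: (pr_exN_i _ _ (subst (up_term _) (fun X => X) (Not q)) (Var 0)).
  have E : scons (Var 0) (fun i => Var i.+1) = Var by apply/funext => -[].
  by rewrite instN_up E subst_id; apply: hyp0.
by move=> /T_ExN[t] /T_not; apply; apply: H.
Qed.

Lemma T_AllS q : T (AllS q) <-> forall X, T (instS X q).
Proof.
split=> [H t|H]; first by move: H; apply: T_prove1; apply: pr_allS_e.
apply: contrapT => /T_not nT.
have : T (ExS (Not q)).
  apply: T_prove1 nT; apply: pr_raa; apply: (pr_imp_e _ _ _ _ (hyp1 _ _ _)).
  apply: pr_allS_i; apply: pr_raa => /=.
  apply: (pr_imp_e _ _ (shiftS (ExS (Not q)))) (hyp1 _ _ _) _.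
  apply: (pr_exS_i _ _ (subst Var (up_set _) (Not q)) 0).
  have E : scons 0 S = id by apply/funext => -[].
  by rewrite instS_up E subst_id; apply: hyp0.
by move=> /T_ExS[t] /T_not; apply; apply: H.
Qed.

Lemma T_refl t : T (Eq t t).
Proof. by apply: T_prove0; apply: pr_eq_refl. Qed.

Lemma T_subst p t u : T (Eq t u) -> T (instN t p) -> T (instN u p).
Proof. by apply: T_prove2; apply: pr_eq_subst (hyp0 _ _) (hyp1 _ _ _). Qed.

Let subst_shift t u : subst_term (scons t Var) (shift_term u) = u.
Proof. by rewrite /shift_term subst_term_comp subst_term_Var. Qed.

Lemma T_sym t u : T (Eq t u) -> T (Eq u t).
Proof.
move=> H; have := T_subst (Eq (Var 0) (shift_term t)) _ _ H.
by rewrite /instN /= !subst_shift; apply; apply: T_refl.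
Qed.

Lemma T_trans t u v : T (Eq t u) -> T (Eq u v) -> T (Eq t v).
Proof.
move=> H1 H2; have := T_subst (Eq (shift_term t) (Var 0)) _ _ H2.
by rewrite /instN /= !subst_shift; apply.
Qed.

Lemma T_congr (f : term -> term -> term) t u t' u' :
  (forall s t u, subst_term s (f t u) = f (subst_term s t) (subst_term s u)) ->
  T (Eq t t') -> T (Eq u u') -> T (Eq (f t u) (f t' u')).
Proof.
move=> fE H1 H2.
have := T_subst (Eq (shift_term (f t u)) (f (Var 0) (shift_term u))) _ _ H1.
rewrite /instN /= !subst_shift !fE /= !subst_shift => /(_ (T_refl _)) H3.
have := T_subst (Eq (shift_term (f t u)) (f (shift_term t') (Var 0))) _ _ H2.
by rewrite /instN /= !subst_shift !fE /= !subst_shift; apply.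
Qed.

Lemma T_congr_lt t u t' u' :
  T (Eq t t') -> T (Eq u u') -> T (Lt t u) -> T (Lt t' u').
Proof.
move=> H1 H2 H.
have := T_subst (Lt (Var 0) (shift_term u)) _ _ H1.
rewrite /instN /= !subst_shift => /(_ H) H3.
have := T_subst (Lt (shift_term t') (Var 0)) _ _ H2.
by rewrite /instN /= !subst_shift; apply.
Qed.

Lemma T_congr_mem t t' X : T (Eq t t') -> T (Mem t X) -> T (Mem t' X).
Proof. by move=> H1; apply: (T_subst (Mem (Var 0) X) _ _ H1). Qed.

(** Equivalence classes are needed because [sat] interprets [Eq] by equality in the domain. Coded as
    predicates, they are equal as soon as they are equivalent. *)
Definition term_class : Type := {P : term -> Prop | exists t, P = fun u => T (Eq t u)}.

Definition class_of (t : term) : term_class := exist _ _ (ex_intro _ t erefl).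

Lemma class_of_surj (a : term_class) : exists t, class_of t = a.
Proof. by case: a => P [t Pt]; exists t; apply: eq_exist. Qed.

Lemma class_of_eq t u : class_of t = class_of u <-> T (Eq t u).
Proof.
split=> [[/(congr1 (fun f => f u))]|H].
  by move=> ->; apply: T_refl.
apply: eq_exist; apply/funext => v; apply/propext; split; apply: T_trans => //.
exact: T_sym.
Qed.

Definition repr_of (a : term_class) : term := proj1_sig (cid (class_of_surj a)).

Lemma repr_ofK a : class_of (repr_of a) = a.
Proof. by rewrite /repr_of; case: cid. Qed.

Lemma T_repr t : T (Eq (repr_of (class_of t)) t).
Proof. by apply/class_of_eq; rewrite repr_ofK. Qed.

(** Set variables themselves form the second sort; equality of sets does not occur in the language,
    so they need no quotient. The truth lemma is stated for all substitutions in order that the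
    induction passes through quantifiers. *)
Lemma canonical_structure_ex : exists Mo : structure,
  exists2 cl : term -> Mo, forall a, exists t, cl t = a &
  exists2 sel : nat -> dset Mo, forall X, exists i, sel i = X &
  forall s r p, sat Mo (fun i => cl (s i)) (fun i => sel (r i)) p <-> T (subst s r p).
Proof.
have [en en_surj] := @surjection_of_tree _ tree_of_term Zero tree_of_term_inj.
have num_surj (a : term_class) : exists i, class_of (en i) = a.
  by have [t <-] := class_of_surj a; have [i <-] := en_surj t; exists i.
have nat_surj (X : nat) : exists i, i = X by exists X.
pose Mo := @Structure term_class (class_of Zero) (class_of One)
  (fun a b => class_of (Plus (repr_of a) (repr_of b)))
  (fun a b => class_of (Mult (repr_of a) (repr_of b)))
  (fun a b => T (Lt (repr_of a) (repr_of b)))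
  nat (fun a X => T (Mem (repr_of a) X)) _ num_surj id nat_surj.
exists Mo; exists class_of; first exact: class_of_surj.
exists id; first exact: nat_surj.
have evalE s t : eval Mo (fun i => class_of (s i)) t = class_of (subst_term s t).
  elim: t => //= t -> u ->; apply/class_of_eq; apply: (T_congr _) => //; exact: T_repr.
move=> s r p; elim: p s r => /=.
- by move=> t u s r; rewrite !evalE class_of_eq.
- move=> t u s r; rewrite !evalE; split; apply: T_congr_lt; by [apply: T_repr|apply: T_sym; apply: T_repr].
- move=> t X s r; rewrite !evalE; split; apply: T_congr_mem; by [apply: T_repr|apply: T_sym; apply: T_repr].
- by move=> s r; split=> // /T_Bot.
- by move=> p IHp q IHq s r; rewrite T_imp IHp IHq.
- by move=> p IHp q IHq s r; rewrite T_and IHp IHq.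
- by move=> p IHp q IHq s r; rewrite T_or IHp IHq.
- move=> p IHp s r; rewrite T_AllN; split=> [H t|H a].
    rewrite instN_up -IHp; move: (H (class_of t)).
    by congr (sat Mo _ _ _); apply/funext => -[].
  have [t <-] := class_of_surj a; move: (H t); rewrite instN_up -IHp.
  by congr (sat Mo _ _ _); apply/funext => -[].
- move=> p IHp s r; rewrite T_ExN; split=> [[a]|[t]].
    have [t <-] := class_of_surj a => H; exists t; rewrite instN_up -IHp; move: H.
    by congr (sat Mo _ _ _); apply/funext => -[].
  rewrite instN_up -IHp => H; exists (class_of t); move: H.
  by congr (sat Mo _ _ _); apply/funext => -[].
- move=> p IHp s r; rewrite T_AllS; split=> H X.
    rewrite instS_up -IHp; move: (H X).
    by congr (sat Mo _ _ _); apply/funext => -[].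
  move: (H X); rewrite instS_up -IHp.
  by congr (sat Mo _ _ _); apply/funext => -[].
- move=> p IHp s r; rewrite T_ExS; split=> -[X].
    move=> H; exists X; rewrite instS_up -IHp; move: H.
    by congr (sat Mo _ _ _); apply/funext => -[].
  rewrite instS_up -IHp => H; exists X; move: H.
  by congr (sat Mo _ _ _); apply/funext => -[].
Qed.

End Canonical.

Definition models (Mo : structure) (Ax : form -> Prop) : Prop :=
  forall p, Ax p -> forall e E, sat Mo e E p.

Theorem completeness (Ax : form -> Prop) (p : form) :
  (forall q s r, Ax q -> proves Ax nil (subst s r q)) ->
  (forall Mo : structure, models Mo Ax -> forall e E, sat Mo e E p) ->
  provable Ax p.
Proof.
move=> Ax_subst H; apply: contrapT => np.
have c : @consistent Ax (Not p :: nil) by move=> /pr_raa.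
have [T [T1 T2 T3 T4 [T5 T6]]] := @Henkin_theory_ex _ Ax_subst _ c.
have [Mo [cl cl_surj [sel sel_surj MoP]]] :=
  @canonical_structure_ex _ T T1 T2 T4 T5 T6.
have MoAx : models Mo Ax.
  move=> q Aq e E.
  have [s sP] := choice (fun i => cl_surj (e i)).
  have [r rP] := choice (fun i => sel_surj (E i)).
  have := MoP s r q; rewrite (funext sP) (funext rP) => ->.
  exact: (@T_prove0 Ax) (Ax_subst _ _ _ Aq).
have /MoP := H Mo MoAx (fun i => cl (Var i)) (fun i => sel i).
rewrite subst_id => Tp.
by move: (T3 _ (or_introl erefl)) => /(T_not _ T1 T2 T4).
Qed.

(** * Models of RCA0 *)

Lemma subst_shift_term s t :
  subst_term (up_term s) (shift_term t) = shift_term (subst_term s t).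
Proof. by rewrite /shift_term !subst_term_comp. Qed.

Lemma bounded_subst p s r : bounded p -> bounded (subst s r p).
Proof.
move=> H; elim: H s r => {p} /=; try by intros; constructor.
- by move=> t p _ IH s r; rewrite subst_shift_term; apply: bd_all.
- by move=> t p _ IH s r; rewrite subst_shift_term; apply: bd_ex.
Qed.

Lemma subst_succ_inst s r p :
  subst (up_term s) r (succ_inst p) = succ_inst (subst (up_term s) r p).
Proof.
rewrite /succ_inst !subst_comp; congr subst; apply/funext => -[|i] //=.
by rewrite /shift_term !subst_term_comp.
Qed.

Lemma subst_induction s r p :
  subst s r (induction p) = induction (subst (up_term s) r p).
Proof. by rewrite /induction /= subst_instN subst_succ_inst. Qed.

Lemma subst_comprehension s r p q :
  subst s r (comprehension p q) =
  comprehension (subst (up_term s) r p) (subst (up_term s) r q).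
Proof. by rewrite /comprehension /= subst_shiftS. Qed.

Lemma RCA0_subst p s r : RCA0 p -> proves RCA0 nil (subst s r p).
Proof.
(* The arithmetical axioms contain at most the variables 0 and 1, so two generalizations followed by
   two instantiations produce every instance. The schemes are closed under substitution outright. *)
have two q : RCA0 q -> proves RCA0 nil (subst (scons (s 0) (scons (s 1) Var)) (fun X => X) q).
  move=> Hq; have H : proves RCA0 nil (AllN (AllN q)).
    by apply: pr_allN_i; apply: pr_allN_i; apply: pr_ax.
  have := pr_allN_e _ _ _ (s 1) H.
  by move=> /(pr_allN_e _ _ _ (s 0)); rewrite instN_up.
move=> Ap; case: Ap (Ap); try by move=> /two.
- move=> q [q' Hq'] _; apply: pr_ax; rewrite subst_induction.
  by apply: rca_induction; constructor; apply: bounded_subst.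
- move=> q q' [u Hu] [v Hv] _; apply: pr_ax; rewrite subst_comprehension.
  by apply: rca_comprehension; constructor; apply: bounded_subst.
Qed.

Definition second_order_model : Type := {Mo : structure | models Mo RCA0}.

Definition num (W : second_order_model) : Type := dom (proj1_sig W).
Definition sets (W : second_order_model) : Type := dset (proj1_sig W).

(** * Definability with parameters *)

Section Definability.
Variable W : second_order_model.
Notation Mo := (proj1_sig W).
Notation M := (num W).
Implicit Types (P Q : (nat -> M) -> Prop) (f g : (nat -> M) -> M).

(** Even indices hold the arguments, odd indices the parameters. *)
Definition mix (e : nat -> M) (i : nat) : M :=
  if odd i then dnum Mo i./2 else e i./2.

Lemma mix_even e k : mix e k.*2 = e k.
Proof. by rewrite /mix odd_double doubleK. Qed.

Lemma mix_odd e k : mix e k.*2.+1 = dnum Mo k.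
Proof. by rewrite /mix /= odd_double /= uphalf_double. Qed.

Lemma even_odd_ind (A : nat -> Prop) :
  (forall k, A k.*2) -> (forall k, A k.*2.+1) -> forall i, A i.
Proof.
by move=> H0 H1 i; rewrite -(odd_double_half i); case: (odd i); rewrite ?add1n ?add0n.
Qed.

Definition TermFun f : Prop := exists t, forall e, f e = eval Mo (mix e) t.

(** Assignments are infinite, so one notion covers predicates of every arity, and a quantified
    variable is simply put in front. *)
Definition Delta0 P : Prop :=
  exists2 p, bounded p & forall e, P e <-> sat Mo (mix e) (dnumS Mo) p.

Lemma Delta0_ext P Q : (forall e, Q e <-> P e) -> Delta0 P -> Delta0 Q.
Proof. by move=> H [p bp Hp]; exists p => // e; rewrite H. Qed.

Lemma TermFun_var i : TermFun (fun e => e i).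
Proof. by exists (Var i.*2) => e /=; rewrite mix_even. Qed.

Lemma TermFun_const (a : M) : TermFun (fun _ => a).
Proof.
have [i <-] := dnum_surj Mo a.
by exists (Var i.*2.+1) => e; rewrite -(mix_odd e).
Qed.

Lemma TermFun_add0 f g : TermFun f -> TermFun g -> TermFun (fun e => dadd (f e) (g e)).
Proof. by move=> [t Ht] [u Hu]; exists (Plus t u) => e; rewrite Ht Hu. Qed.

Lemma TermFun_mul0 f g : TermFun f -> TermFun g -> TermFun (fun e => dmul (f e) (g e)).
Proof. by move=> [t Ht] [u Hu]; exists (Mult t u) => e; rewrite Ht Hu. Qed.

Lemma Delta0_eq f g : TermFun f -> TermFun g -> Delta0 (fun e => f e = g e).
Proof.
by move=> [t Ht] [u Hu]; exists (Eq t u); [constructor|move=> e; rewrite Ht Hu].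
Qed.

Lemma Delta0_lt0 f g : TermFun f -> TermFun g -> Delta0 (fun e => dlt (f e) (g e)).
Proof.
by move=> [t Ht] [u Hu]; exists (Lt t u); [constructor|move=> e; rewrite Ht Hu].
Qed.

Lemma Delta0_mem0 f X : TermFun f -> Delta0 (fun e => @dmem Mo (f e) X).
Proof.
move=> [t Ht]; have [i <-] := dnumS_surj Mo X.
by exists (Mem t i); [constructor|move=> e; rewrite Ht].
Qed.

Lemma Delta0_false : Delta0 (fun _ => False).
Proof. by exists Bot; [constructor|]. Qed.

Lemma Delta0_imp P Q : Delta0 P -> Delta0 Q -> Delta0 (fun e => P e -> Q e).
Proof.
by move=> [p bp Hp] [q bq Hq]; exists (Imp p q); [constructor|move=> e /=; rewrite Hp Hq].
Qed.

Lemma Delta0_and P Q : Delta0 P -> Delta0 Q -> Delta0 (fun e => P e /\ Q e).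
Proof.
by move=> [p bp Hp] [q bq Hq]; exists (And p q); [constructor|move=> e /=; rewrite Hp Hq].
Qed.

Lemma Delta0_or P Q : Delta0 P -> Delta0 Q -> Delta0 (fun e => P e \/ Q e).
Proof.
by move=> [p bp Hp] [q bq Hq]; exists (Or p q); [constructor|move=> e /=; rewrite Hp Hq].
Qed.

Lemma Delta0_not P : Delta0 P -> Delta0 (fun e => ~ P e).
Proof. by move=> HP; apply: Delta0_imp HP Delta0_false. Qed.

Lemma Delta0_iff P Q : Delta0 P -> Delta0 Q -> Delta0 (fun e => P e <-> Q e).
Proof. by move=> HP HQ; apply: Delta0_and; apply: Delta0_imp. Qed.

(** An element added inside [mix] moves the arguments by two places and leaves the parameters; an
    element added outside moves everything by one. The renaming translates between the two. *)
Let ren (k : nat) : term := if odd k then Var k.+1 else Var k.-1.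

Lemma sat_mix_scons x e p :
  sat Mo (mix (scons x e)) (dnumS Mo) p <->
  sat Mo (scons x (mix e)) (dnumS Mo) (subst ren (fun X => X) p).
Proof.
rewrite sat_subst; suff -> : mix (scons x e) = fun i => eval Mo (scons x (mix e)) (ren i) by [].
apply/funext; apply: even_odd_ind => k; rewrite /ren /= odd_double /=.
  by case: k => [|k] //; rewrite mix_even doubleS /= mix_even.
by rewrite !mix_odd.
Qed.

Lemma Delta0_ball f (Q : (nat -> M) -> M -> Prop) :
  TermFun f -> Delta0 (fun e => Q (fun i => e i.+1) (e 0)) ->
  Delta0 (fun e => forall x : M, dlt x (f e) -> Q e x).
Proof.
move=> [t Ht] [q bq Hq].
exists (AllN (Imp (Lt (Var 0) (shift_term t)) (subst ren (fun X => X) q))).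
  by constructor; apply: bounded_subst.
move=> e /=; split=> H x.
  by rewrite /shift_term eval_subst -Ht => /H/(Hq (scons x e)) /sat_mix_scons.
move=> Hx; apply/(Hq (scons x e))/sat_mix_scons/H.
by rewrite /shift_term eval_subst -Ht.
Qed.

Lemma Delta0_bex f (Q : (nat -> M) -> M -> Prop) :
  TermFun f -> Delta0 (fun e => Q (fun i => e i.+1) (e 0)) ->
  Delta0 (fun e => exists x : M, dlt x (f e) /\ Q e x).
Proof.
move=> [t Ht] [q bq Hq].
exists (ExN (And (Lt (Var 0) (shift_term t)) (subst ren (fun X => X) q))).
  by constructor; apply: bounded_subst.
move=> e /=; split=> -[x].
  by move=> [Hx /(Hq (scons x e))/sat_mix_scons H]; exists x; rewrite /shift_term eval_subst -Ht.
rewrite /shift_term eval_subst -Ht => -[Hx H]; exists x; split=> //.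
by apply/(Hq (scons x e))/sat_mix_scons.
Qed.

(** Only the arguments 0 and 2 carry the variables [y] and [x]; parameter number [i] becomes
    [Var (i + 2)], and all remaining arguments are fixed to [dnum Mo 0]. This yields a literal
    formula of the axiom schemes under the assignment [dnum Mo]. *)
Let ren2 (k : nat) : term :=
  if odd k then Var (k./2).+2 else if k is 0 then Var 0 else if k is 2 then Var 1 else Var 2.

Lemma Sigma1_form Q : Delta0 Q -> exists2 p, bounded p & forall x,
  (exists y, Q (scons y (scons x (fun _ => dnum Mo 0)))) <->
  sat Mo (scons x (dnum Mo)) (dnumS Mo) (ExN p).
Proof.
move=> [q bq Hq]; exists (subst ren2 (fun X => X) q); first exact: bounded_subst.
have E y x : mix (scons y (scons x (fun _ => dnum Mo 0))) =
    fun i => eval Mo (scons y (scons x (dnum Mo))) (ren2 i).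
  apply/funext; apply: even_odd_ind => k; rewrite /ren2 /= odd_double ?mix_even ?mix_odd.
    by case: k => [|[|k]].
  by rewrite /= uphalf_double.
have key y x : sat Mo (scons y (scons x (dnum Mo))) (dnumS Mo) (subst ren2 (fun X => X) q) <->
    Q (scons y (scons x (fun _ => dnum Mo 0))) by rewrite sat_subst -E Hq.
by move=> x; split=> -[y H]; exists y; apply/key.
Qed.

Definition Sigma1 P : Prop :=
  exists2 Q, Delta0 Q & forall e, P e <-> exists y, Q (scons y e).

Lemma Delta0_scons1 Q : Delta0 Q -> Delta0 (fun e => Q (fun i => e i.+1)).
Proof.
move=> [q bq Hq].
exists (subst (fun k => if odd k then Var k else Var k.+2) (fun X => X) q).
  exact: bounded_subst.
move=> e; rewrite Hq sat_subst.
suff -> : mix (fun i => e i.+1) = fun i => eval Mo (mix e) (if odd i then Var i else Var i.+2) by [].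
apply/funext; apply: even_odd_ind => k; rewrite /= odd_double /=.
  by rewrite -doubleS !mix_even.
by rewrite !mix_odd.
Qed.

Lemma Delta0_Sigma1 P : Delta0 P -> Sigma1 P.
Proof.
move=> HP; exists (fun e => P (fun i => e i.+1)); first exact: Delta0_scons1.
by move=> e; split=> [Pe|[]//]; exists (dzero Mo).
Qed.

Lemma Sigma1_induction0 (P : M -> Prop) : Sigma1 (fun e => P (e 0)) ->
  P (dzero Mo) -> (forall x, P x -> P (dadd x (dunit Mo))) -> forall x, P x.
Proof.
move=> [Q /Sigma1_form[p bp Hp] PQ] H0 HS.
have {PQ}PE x : P x <-> sat Mo (scons x (dnum Mo)) (dnumS Mo) (ExN p).
  by rewrite -Hp (PQ (scons x (fun=> dnum Mo 0))).
have /= := proj2_sig W _ (rca_induction (ExN p) (Sigma01_ex p bp)) (dnum Mo) (dnumS Mo).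
move=> H x; apply/PE; apply: H; split.
  move/PE: H0 => [a]; exists a; move: p0; rewrite sat_subst.
  by congr (sat Mo _ _ _); apply/funext => -[|[|i]].
move=> a /PE/HS/PE[b Hb]; exists b; rewrite sat_subst; move: Hb.
by congr (sat Mo _ _ _); apply/funext => -[|[|i]].
Qed.

Definition Delta1 P : Prop := Sigma1 P /\ Sigma1 (fun e => ~ P e).

Lemma Delta1_comprehension (P : M -> Prop) : Delta1 (fun e => P (e 0)) ->
  exists X, forall x, @dmem Mo x X <-> P x.
Proof.
move=> [[Q /Sigma1_form[p bp Hp] PQ] [Q' /Sigma1_form[p' bp' Hp'] PQ']].
have {PQ Hp}PE x : P x <-> sat Mo (scons x (dnum Mo)) (dnumS Mo) (ExN p).
  by rewrite -Hp (PQ (scons x (fun=> dnum Mo 0))).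
have {PQ' Hp'}PE' x : ~ P x <-> sat Mo (scons x (dnum Mo)) (dnumS Mo) (ExN p').
  by rewrite -Hp' (PQ' (scons x (fun=> dnum Mo 0))).
(* The Pi-0-1 form of [P] is the universal closure of the negated matrix of its complement. *)
have bn : bounded (Not p') by constructor=> //; constructor.
have /= H := proj2_sig W _ (rca_comprehension _ _ (Sigma01_ex p bp) (Pi01_all _ bn)) (dnum Mo) (dnumS Mo).
have [|X HX] := H.
  move=> a; split; first by move=> /PE Pa b Hb; apply: (iffRL (PE' a)) Pa; exists b.
  by move=> Hb; apply/PE; apply: contrapT => /PE'[b /Hb].
exists X => x; have [H1 H2] := HX x; split.
  move=> /H1[a Ha]; apply/PE; exists a; move: Ha; rewrite sat_subst.
  by congr (sat Mo _ _ _); apply/funext => -[].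
move=> /PE[a Ha]; apply: H2; exists a; move: Ha; rewrite sat_subst.
by congr (sat Mo _ _ _); apply/funext => -[].
Qed.

Lemma Delta0_induction0 (P : M -> Prop) : Delta0 (fun e => P (e 0)) ->
  P (dzero Mo) -> (forall x, P x -> P (dadd x (dunit Mo))) -> forall x, P x.
Proof. by move=> /Delta0_Sigma1; apply: Sigma1_induction0. Qed.

End Definability.

Arguments Delta0_ext {W} P {Q}.

Ltac t0_step := first
  [ apply: TermFun_var | apply: TermFun_const | apply: TermFun_add0 | apply: TermFun_mul0
  | apply: Delta0_eq | apply: Delta0_lt0 | apply: Delta0_mem0 | apply: Delta0_false
  | apply: Delta0_not | apply: Delta0_imp | apply: Delta0_and | apply: Delta0_or
  | apply: Delta0_bex | apply: Delta0_ball ].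
Ltac d0_auto := repeat t0_step.

(** * Semiring and order of the numbers of a model *)

Section Arithmetic.
Variable W : second_order_model.
Notation Mo := (proj1_sig W).
Notation M := (num W).
Local Notation "x +! y" := (@dadd (proj1_sig W) x y) (at level 50, left associativity).
Local Notation "x *! y" := (@dmul (proj1_sig W) x y) (at level 40, left associativity).
Local Notation "x <! y" := (@dlt (proj1_sig W) x y) (at level 70).
Local Notation "0!" := (dzero (proj1_sig W)).
Local Notation "1!" := (dunit (proj1_sig W)).

Let ax p (Hp : RCA0 p) (x y : M) := proj2_sig W p Hp (scons x (fun _ => y)) (dnumS Mo).

Fact succ_ne_0 (x : M) : x +! 1! <> 0!.
Proof. exact: (ax _ rca_succ_ne_0 x x). Qed.
Fact succ_inj (x y : M) : x +! 1! = y +! 1! -> x = y.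
Proof. exact: (ax _ rca_succ_inj x y). Qed.
Fact add_0 (x : M) : x +! 0! = x.
Proof. exact: (ax _ rca_add_0 x x). Qed.
Fact add_succ (x y : M) : x +! (y +! 1!) = x +! y +! 1!.
Proof. exact: (ax _ rca_add_succ x y). Qed.
Fact mul_0 (x : M) : x *! 0! = 0!.
Proof. exact: (ax _ rca_mul_0 x x). Qed.
Fact mul_succ (x y : M) : x *! (y +! 1!) = x *! y +! x.
Proof. exact: (ax _ rca_mul_succ x y). Qed.
Fact lt_0 (x : M) : ~ x <! 0!.
Proof. exact: (ax _ rca_lt_0 x x). Qed.
Fact lt_succ (x y : M) : x <! y +! 1! <-> x <! y \/ x = y.
Proof. by case: (ax _ rca_lt_succ x y). Qed.

Fact add_0l (x : M) : 0! +! x = x.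
Proof.
move: x; apply: Delta0_induction0; first by d0_auto.
  exact: add_0.
by move=> x IH; rewrite add_succ IH.
Qed.

Fact add_succl (x y : M) : x +! 1! +! y = x +! y +! 1!.
Proof.
move: y; apply: Delta0_induction0; first by d0_auto.
  by rewrite !add_0.
by move=> y IH; rewrite !add_succ IH.
Qed.

Fact add_comm : commutative (@dadd Mo).
Proof.
move=> x; apply: Delta0_induction0; first by d0_auto.
  by rewrite add_0 add_0l.
by move=> y IH; rewrite add_succ add_succl IH.
Qed.

Fact add_assoc : associative (@dadd Mo).
Proof.
move=> x y; apply: Delta0_induction0; first by d0_auto.
  by rewrite !add_0.
by move=> z IH; rewrite !add_succ IH.
Qed.

Fact mul_0l (x : M) : 0! *! x = 0!.
Proof.
move: x; apply: Delta0_induction0; first by d0_auto.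
  exact: mul_0.
by move=> x IH; rewrite mul_succ IH add_0.
Qed.

Fact mul_succl (x y : M) : (x +! 1!) *! y = x *! y +! y.
Proof.
move: y; apply: Delta0_induction0; first by d0_auto.
  by rewrite !mul_0 add_0.
move=> y IH; rewrite !mul_succ IH !add_succ; congr dadd.
by rewrite -!add_assoc (add_comm x y).
Qed.

Fact mul_comm : commutative (@dmul Mo).
Proof.
move=> x; apply: Delta0_induction0; first by d0_auto.
  by rewrite mul_0 mul_0l.
by move=> y IH; rewrite mul_succ mul_succl IH.
Qed.

Fact mul_addl : left_distributive (@dmul Mo) (@dadd Mo).
Proof.
move=> x y; apply: Delta0_induction0; first by d0_auto.
  by rewrite !mul_0 add_0.
move=> z IH; rewrite !mul_succ IH !add_assoc; congr dadd.
by rewrite -!add_assoc (add_comm _ x).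
Qed.

Fact mul_assoc : associative (@dmul Mo).
Proof.
move=> x y; apply: Delta0_induction0; first by d0_auto.
  by rewrite !mul_0.
move=> z IH; rewrite !mul_succ -IH (mul_comm x) mul_addl.
by rewrite (mul_comm _ x) (mul_comm y x).
Qed.

Fact mul_1l : left_id 1! (@dmul Mo).
Proof. by move=> x; rewrite mul_comm -(add_0l 1!) mul_succ mul_0 add_0l. Qed.

Fact one_ne_0 : 1! <> 0!.
Proof. by rewrite -(add_0l 1!); apply: succ_ne_0. Qed.

Fact add_cancel (x y z : M) : x +! z = y +! z -> x = y.
Proof.
move: z; apply: Delta0_induction0; first by d0_auto.
  by rewrite !add_0.
by move=> z IH; rewrite !add_succ => /succ_inj.
Qed.

Fact lt_iff_add (x y : M) : x <! y <-> exists z, y = x +! (z +! 1!).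
Proof.
split; last first.
  move=> [z ->]; move: z; apply: Delta0_induction0; first by d0_auto.
    by rewrite add_0l; apply/lt_succ; right.
  by move=> z IH; rewrite add_succ; apply/lt_succ; left.
move: y; apply: Sigma1_induction0.
(* The implication to be proved has an existential conclusion; moving its premise inside the
   quantifier as a disjunct makes it Sigma1. *)
- exists (fun e => e 1 = x +! (e 0 +! 1!) \/ ~ x <! e 1); first by d0_auto.
  move=> e /=; split=> [H|[y [H|//]] _]; last by exists y.
  have [/H[z ->]|] := EM (x <! e 0); first by exists z; left.
  by exists 0!; right.
- by move=> /lt_0.
- move=> y IH /lt_succ[/IH[z ->]|->].
    by exists (z +! 1!); rewrite !add_succ.
  by exists 0!; rewrite add_0l.
Qed.

Fact zero_or_succ (x : M) : x = 0! \/ exists y, x = y +! 1!.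
Proof.
move: x; apply: Sigma1_induction0.
- exists (fun e => e 1 = 0! \/ e 1 = e 0 +! 1!); first by d0_auto.
  move=> e /=; split=> [[H|[y H]]|[y [H|H]]].
  + by exists 0!; left.
  + by exists y; right.
  + by left.
  + by right; exists y.
- by left.
- by move=> x _; right; exists x.
Qed.

(** Trichotomy with the difference made explicit. It takes the place of subtraction, which [M]
    lacks. *)
Fact difference (x y : M) :
  x = y \/ (exists z, y = x +! (z +! 1!)) \/ exists z, x = y +! (z +! 1!).
Proof.
suff : x <! y \/ x = y \/ y <! x.
  by rewrite !lt_iff_add; tauto.
move: y; apply: Delta0_induction0; first by d0_auto.
  have [->|[y ->]] := zero_or_succ x; first by right; left.
  by right; right; apply/lt_iff_add; exists y; rewrite add_0l.
move=> y [H|[->|/lt_iff_add[z ->]]].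
- by left; apply/lt_succ; left.
- by left; apply/lt_succ; right.
have [->|[w ->]] := zero_or_succ z; first by rewrite add_0l; right; left.
right; right; apply/lt_iff_add; exists w.
by rewrite !add_succ (add_succl y w).
Qed.

End Arithmetic.

HB.instance Definition _ W := gen_eqMixin (num W).
HB.instance Definition _ W := gen_choiceMixin (num W).
HB.instance Definition _ W := GRing.isNmodule.Build (num W)
  (@add_assoc W) (@add_comm W) (@add_0l W).

Local Open Scope ring_scope.

Fact num_one_neq0 W : (dunit (proj1_sig W) : num W) != 0.
Proof. by apply/eqP; apply: one_ne_0. Qed.

HB.instance Definition _ W := GRing.Nmodule_isComNzSemiRing.Build (num W)
  (@mul_assoc W) (@mul_comm W) (@mul_1l W) (@mul_addl W) (@mul_0l W) (@num_one_neq0 W).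

(** * The ordered field of fractions of a model *)

Section Fractions.
Variable W : second_order_model.
Notation M := (num W).
Implicit Types (a b c : M).

Fact num_addIr a b c : a + c = b + c -> a = b. Proof. exact: add_cancel. Qed.

Fact num_addIl a b c : c + a = c + b -> a = b.
Proof. by rewrite !(addrC c); apply: num_addIr. Qed.

Fact num_succ_neq0 a : a + 1 <> 0. Proof. exact: succ_ne_0. Qed.

Fact num_difference a b :
  [\/ a = b, exists c, b = a + (c + 1) | exists c, a = b + (c + 1)].
Proof.
have [H|[H|H]] := difference W a b; [exact: Or31|exact: Or32|exact: Or33].
Qed.

Fact num_lt_iff a b : @dlt (proj1_sig W) a b <-> exists c : M, b = a + (c + 1).
Proof. exact: lt_iff_add. Qed.

Fact num_add_eq0 a b : a + b = 0 -> a = 0.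
Proof.
have [//|[c ac]|[c ->]] := num_difference a 0.
  by case: (@num_succ_neq0 (a + c)); rewrite -addrA -ac.
by rewrite add0r addrAC => /num_succ_neq0.
Qed.

Fact num_mul_succ_eq0 a c : a * (c + 1) = 0 -> a = 0.
Proof. by rewrite mulrDr mulr1 addrC => /num_add_eq0. Qed.

Fact num_mulI a b c : a * (c + 1) = b * (c + 1) -> a = b.
Proof.
have [//|[z ->]|[z ->]] := num_difference a b.
  rewrite mulrDl -{1}[LHS]addr0 => /num_addIl/esym/num_mul_succ_eq0/num_succ_neq0 [].
rewrite mulrDl -[RHS]addr0 => /num_addIl/num_mul_succ_eq0/num_succ_neq0 [].
Qed.

(** [(a, b, c)] stands for (a - b) / (c + 1). *)
Definition triple : Type := (M * M * M)%type.
Implicit Types x y z : triple.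

Definition teq x y : Prop :=
  x.1.1 * (y.2 + 1) + y.1.2 * (x.2 + 1) = y.1.1 * (x.2 + 1) + x.1.2 * (y.2 + 1).
(** The last component is the product of the two denominators less one, as
    [(c + 1) (d + 1) = (c d + c + d) + 1]. *)
Definition tadd x y : triple :=
  (x.1.1 * (y.2 + 1) + y.1.1 * (x.2 + 1), x.1.2 * (y.2 + 1) + y.1.2 * (x.2 + 1),
   x.2 * y.2 + x.2 + y.2).
Definition topp x : triple := (x.1.2, x.1.1, x.2).
Definition tmul x y : triple :=
  (x.1.1 * y.1.1 + x.1.2 * y.1.2, x.1.1 * y.1.2 + x.1.2 * y.1.1,
   x.2 * y.2 + x.2 + y.2).
Definition tnum a : triple := (a, 0, 0).

Lemma teq_refl x : teq x x. Proof. by rewrite /teq; ring. Qed.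

Lemma teq_sym x y : teq x y -> teq y x.
Proof. by rewrite /teq => ->. Qed.

Lemma teq_trans x y z : teq x y -> teq y z -> teq x z.
Proof.
(* The denominator of [y] is multiplied in, and both parts of its numerator are added to the two
   sides; this replaces the subtraction by which [y] would be eliminated. *)
rewrite /teq => H1 H2; apply: (@num_mulI _ _ y.2).
apply: (@num_addIr _ _ (y.1.2 * (x.2 + 1) * (z.2 + 1) + y.1.1 * (x.2 + 1) * (z.2 + 1))).
transitivity ((x.1.1 * (y.2 + 1) + y.1.2 * (x.2 + 1)) * (z.2 + 1) +
              (y.1.1 * (z.2 + 1) + z.1.2 * (y.2 + 1)) * (x.2 + 1)); first by ring.
by rewrite H1 H2; ring.
Qed.

Lemma teq_add x x' y y' : teq x x' -> teq y y' -> teq (tadd x y) (tadd x' y').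
Proof.
rewrite /teq /tadd /= => H1 H2.
transitivity ((x.1.1 * (x'.2 + 1) + x'.1.2 * (x.2 + 1)) * (y.2 + 1) * (y'.2 + 1) +
              (y.1.1 * (y'.2 + 1) + y'.1.2 * (y.2 + 1)) * (x.2 + 1) * (x'.2 + 1)); first by ring.
by rewrite H1 H2; ring.
Qed.

Lemma teq_opp x x' : teq x x' -> teq (topp x) (topp x').
Proof. by rewrite /teq /topp /= => H; rewrite addrC -H addrC. Qed.

Lemma teq_mul_l x x' y : teq x x' -> teq (tmul x y) (tmul x' y).
Proof.
rewrite /teq /tmul /= => H.
(* If [L = R] then [L u + R v = R u + L v], which is the equation [(L - R) (u - v) = 0] without
   subtraction; [u] and [v] stand for the positive and the negative part of [y]. *)
have E u v : (x.1.1 * (x'.2 + 1) + x'.1.2 * (x.2 + 1)) * u +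
    (x'.1.1 * (x.2 + 1) + x.1.2 * (x'.2 + 1)) * v =
    (x'.1.1 * (x.2 + 1) + x.1.2 * (x'.2 + 1)) * u +
    (x.1.1 * (x'.2 + 1) + x'.1.2 * (x.2 + 1)) * v by rewrite H.
apply: etrans (etrans (E (y.1.1 * (y.2 + 1)) (y.1.2 * (y.2 + 1))) _); by ring.
Qed.

Lemma tmulC x y : tmul x y = tmul y x.
Proof. by rewrite /tmul; congr (_, _, _); ring. Qed.

Lemma teq_mul x x' y y' : teq x x' -> teq y y' -> teq (tmul x y) (tmul x' y').
Proof.
move=> H1 H2; apply: teq_trans _ _ _ (teq_mul_l _ _ y H1) _.
by rewrite !(tmulC x'); apply: teq_mul_l.
Qed.

(** Zero is sent to zero, as the field structure demands. Otherwise the difference [z + 1] of the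
    two parts becomes the denominator, and [c + 1] moves to the part that carries the sign. *)
Lemma tinv_ex x : exists y, (teq x (tnum 0) -> y = tnum 0) /\
  (~ teq x (tnum 0) -> teq (tmul y x) (tnum 1)).
Proof.
case: x => -[a b] c; have [->|[z ->]|[z ->]] := num_difference a b.
- exists (tnum 0); split=> //; case; by rewrite /teq /=; ring.
- exists (0, c + 1, z); split; last by rewrite /teq /=; move=> _; ring.
  rewrite /teq /= => H; case: (@num_succ_neq0 z); apply: (@num_addIl _ _ a).
  apply: (@num_mulI _ _ 0); move: H; rewrite !(mul0r, add0r, addr0, mulr1) => <-.
  by ring.
- exists (c + 1, 0, z); split; last by rewrite /teq /=; move=> _; ring.
  rewrite /teq /= => H; case: (@num_succ_neq0 z); apply: (@num_addIl _ _ b).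
  by move: H; rewrite !(mul0r, add0r, addr0, mulr1) => ->.
Qed.

Definition fraction : Type := {P : triple -> Prop | exists x, P = teq x}.

Definition fcl x : fraction := exist _ _ (ex_intro _ x erefl).

Lemma fcl_surj (k : fraction) : exists x, fcl x = k.
Proof. by case: k => P [x Px]; exists x; apply: eq_exist. Qed.

Lemma fcl_eq x y : fcl x = fcl y <-> teq x y.
Proof.
split=> [[/(congr1 (fun f => f y))]|H]; first by move=> ->; apply: teq_refl.
by apply: eq_exist; apply/funext => z; apply/propext; split; apply: teq_trans => //; apply: teq_sym.
Qed.

Definition frep (k : fraction) : triple := proj1_sig (cid (fcl_surj k)).

Lemma frepK k : fcl (frep k) = k.
Proof. by rewrite /frep; case: cid. Qed.

Lemma teq_frep x : teq (frep (fcl x)) x.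
Proof. by apply/fcl_eq; rewrite frepK. Qed.

Definition fadd (k l : fraction) := fcl (tadd (frep k) (frep l)).
Definition fopp (k : fraction) := fcl (topp (frep k)).
Definition fmul (k l : fraction) := fcl (tmul (frep k) (frep l)).
Definition finv (k : fraction) := fcl (proj1_sig (cid (tinv_ex (frep k)))).

Lemma fadd_cl x y : fadd (fcl x) (fcl y) = fcl (tadd x y).
Proof. by apply/fcl_eq; apply: teq_add; apply: teq_frep. Qed.

Lemma fopp_cl x : fopp (fcl x) = fcl (topp x).
Proof. by apply/fcl_eq; apply: teq_opp; apply: teq_frep. Qed.

Lemma fmul_cl x y : fmul (fcl x) (fcl y) = fcl (tmul x y).
Proof. by apply/fcl_eq; apply: teq_mul; apply: teq_frep. Qed.

Fact faddA : associative fadd.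
Proof.
move=> k l m; case: (fcl_surj k) (fcl_surj l) (fcl_surj m) => x <- [y <-] [z <-].
by rewrite !fadd_cl; apply/fcl_eq; rewrite /teq /=; ring.
Qed.

Fact faddC : commutative fadd.
Proof.
move=> k l; case: (fcl_surj k) (fcl_surj l) => x <- [y <-].
by rewrite !fadd_cl; apply/fcl_eq; rewrite /teq /=; ring.
Qed.

Fact fadd0 : left_id (fcl (tnum 0)) fadd.
Proof.
move=> k; case: (fcl_surj k) => x <-.
by rewrite !fadd_cl; apply/fcl_eq; rewrite /teq /=; ring.
Qed.

Fact faddN : left_inverse (fcl (tnum 0)) fopp fadd.
Proof.
move=> k; case: (fcl_surj k) => x <-.
by rewrite fopp_cl fadd_cl; apply/fcl_eq; rewrite /teq /=; ring.
Qed.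

Fact fmulA : associative fmul.
Proof.
move=> k l m; case: (fcl_surj k) (fcl_surj l) (fcl_surj m) => x <- [y <-] [z <-].
by rewrite !fmul_cl; apply/fcl_eq; rewrite /teq /=; ring.
Qed.

Fact fmulC : commutative fmul.
Proof.
move=> k l; case: (fcl_surj k) (fcl_surj l) => x <- [y <-].
by rewrite !fmul_cl tmulC.
Qed.

Fact fmul1 : left_id (fcl (tnum 1)) fmul.
Proof.
move=> k; case: (fcl_surj k) => x <-.
by rewrite !fmul_cl; apply/fcl_eq; rewrite /teq /=; ring.
Qed.

Fact fmulDl : left_distributive fmul fadd.
Proof.
move=> k l m; case: (fcl_surj k) (fcl_surj l) (fcl_surj m) => x <- [y <-] [z <-].
by rewrite !(fmul_cl, fadd_cl); apply/fcl_eq; rewrite /teq /=; ring.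
Qed.

Fact fmulV (k : fraction) : k <> fcl (tnum 0) -> fmul (finv k) k = fcl (tnum 1).
Proof.
case: (fcl_surj k) => x <- x0; rewrite /finv; case: cid => y [_ H] /=.
rewrite fmul_cl; apply/fcl_eq; apply: teq_trans _ _ _ _ (H _).
  by rewrite !(tmulC y); apply/teq_mul_l/teq_sym/teq_frep.
by move=> /(teq_trans _ _ _ (teq_sym _ _ (teq_frep x)))/fcl_eq.
Qed.

Fact finv0 : finv (fcl (tnum 0)) = fcl (tnum 0).
Proof.
by rewrite /finv; case: cid => y [H _] /=; rewrite H //; apply: teq_frep.
Qed.

End Fractions.

HB.instance Definition _ W := gen_eqMixin (fraction W).
HB.instance Definition _ W := gen_choiceMixin (fraction W).
HB.instance Definition _ W := GRing.isZmodule.Build (fraction W)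
  (@faddA W) (@faddC W) (@fadd0 W) (@faddN W).

Fact fraction_one_neq0 W : fcl W (tnum W 1) != fcl W (tnum W 0).
Proof.
apply/eqP => /fcl_eq; rewrite /teq /= !(mul0r, add0r, addr0, mulr1).
by apply/eqP/oner_neq0.
Qed.

HB.instance Definition _ W := GRing.Zmodule_isComNzRing.Build (fraction W)
  (@fmulA W) (@fmulC W) (@fmul1 W) (@fmulDl W) (@fraction_one_neq0 W).

Fact fraction_mulV W (k : fraction W) : k != 0 -> finv W k * k = 1.
Proof. by move=> /eqP; apply: fmulV. Qed.

HB.instance Definition _ W := GRing.ComNzRing_isField.Build (fraction W)
  (@fraction_mulV W) (@finv0 W).

(** * The order on fractions *)

Section FractionOrder.
Variable W : second_order_model.
Notation K := (fraction W).
Implicit Types k l : K.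

Lemma fclE_add (x y : triple W) : fcl W x + fcl W y = fcl W (tadd W x y).
Proof. exact: fadd_cl. Qed.
Lemma fclE_mul (x y : triple W) : fcl W x * fcl W y = fcl W (tmul W x y).
Proof. exact: fmul_cl. Qed.
Lemma fclE_opp (x : triple W) : - fcl W x = fcl W (topp W x).
Proof. exact: fopp_cl. Qed.

Definition nonneg k : Prop := exists a c, k = fcl W (a, 0, c).

Definition fle k l : bool := `[< nonneg (l - k) >].
Definition flt k l : bool := (l != k) && fle k l.
Definition fabs k : K := if fle 0 k then k else - k.

Lemma fle0 k : fle 0 k = `[< nonneg k >].
Proof. by rewrite /fle subr0. Qed.

Lemma fle_0 k : fle k 0 = `[< nonneg (- k) >].
Proof. by rewrite /fle sub0r. Qed.

Fact fle0_add k l : fle 0 k -> fle 0 l -> fle 0 (k + l).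
Proof.
rewrite !fle0 => /asboolP[a [c ->]] /asboolP[b [d ->]]; apply/asboolP.
rewrite fclE_add /tadd /= !mul0r addr0; eexists; eexists; reflexivity.
Qed.

Fact fle0_mul k l : fle 0 k -> fle 0 l -> fle 0 (k * l).
Proof.
rewrite !fle0 => /asboolP[a [c ->]] /asboolP[b [d ->]]; apply/asboolP.
rewrite fclE_mul /tmul /= !(mul0r, mulr0) !addr0; eexists; eexists; reflexivity.
Qed.

Fact fle0_anti k : fle 0 k -> fle k 0 -> k = 0.
Proof.
rewrite fle0 fle_0 => /asboolP[a [c ->]] /asboolP[b [d]].
rewrite fclE_opp => /fcl_eq; rewrite /teq /= !(mul0r, add0r) => /esym.
rewrite addrC => /num_add_eq0/num_mul_succ_eq0->.
by apply/fcl_eq; rewrite /teq /=; ring.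
Qed.

Fact fsub_ge0 k l : fle 0 (l - k) = fle k l.
Proof. by rewrite fle0. Qed.

Fact fle0_total k : fle 0 k || fle k 0.
Proof.
rewrite fle0 fle_0; have [[[a b] c] <-] := fcl_surj W k; rewrite fclE_opp.
have [->|[z ->]|[z ->]] := num_difference _ a b; apply/orP.
- by left; apply/asboolP; exists 0, 0; apply/fcl_eq; rewrite /teq /=; ring.
- by right; apply/asboolP; exists (z + 1), c; apply/fcl_eq; rewrite /teq /=; ring.
- by left; apply/asboolP; exists (z + 1), c; apply/fcl_eq; rewrite /teq /=; ring.
Qed.

Fact fge0_abs k : fle 0 k -> fabs k = k.
Proof. by rewrite /fabs => ->. Qed.

Fact fabsN k : fabs (- k) = fabs k.
Proof.
rewrite /fabs opprK; have := fle0_total k; rewrite fle_0 -fle0.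
case: (boolP (fle 0 k)) => [k0|] //=; last by move=> _ ->.
case: (boolP (fle 0 (- k))) => // nk0 _.
suff -> : k = 0 by rewrite oppr0.
by apply: fle0_anti => //; rewrite fle_0 -fle0.
Qed.

Fact flt_def k l : flt k l = (l != k) && fle k l.
Proof. by []. Qed.

End FractionOrder.

HB.instance Definition _ W := Num.IntegralDomain_isLeReal.Build (fraction W)
  (@fle0_add W) (@fle0_mul W) (@fle0_anti W) (@fsub_ge0 W) (@fle0_total W)
  (@fabsN W) (@fge0_abs W) (@flt_def W).

Section Embedding.
Variable W : second_order_model.
Notation M := (num W).

(** The construction is forgotten after this point: only the field, the embedding and the form of
    its elements are used, so that [lra], [nra] and [field] need not see equivalence classes. *)
Theorem field_of_fractions_ex : exists (K : realFieldType) (io : M -> K),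
  [/\ forall a b, io (a + b) = io a + io b,
      forall a b, io (a * b) = io a * io b,
      io 1 = 1,
      forall a b : M, @dlt (proj1_sig W) a b <-> io a < io b &
      (forall a, 0 <= io a) /\
      forall k, exists a b c, k = (io a - io b) / (io c + 1)].
Proof.
exists (fraction W), (fun a => fcl W (tnum W a)).
have addE a b : fcl W (tnum W (a + b)) = fcl W (tnum W a) + fcl W (tnum W b).
  by apply/esym; apply: etrans (fadd_cl W _ _) _; apply/fcl_eq; rewrite /teq /=; ring.
have mulE a b : fcl W (tnum W (a * b)) = fcl W (tnum W a) * fcl W (tnum W b).
  by apply/esym; apply: etrans (fmul_cl W _ _) _; apply/fcl_eq; rewrite /teq /=; ring.
have ge0 a : 0 <= fcl W (tnum W a).
  by change (is_true (fle W 0 (fcl W (tnum W a)))); rewrite fle0; apply/asboolP; exists a, 0.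
have oneE : fcl W (tnum W 1) = 1 by [].
have ltE a : fcl W (tnum W a) < fcl W (tnum W a) + 1 by rewrite ltrDl ltr01.
split=> //.
- move=> a b; rewrite num_lt_iff; split.
    move=> [z ->]; change (fcl W (tnum W a) < fcl W (tnum W (a + (z + 1)))).
    by rewrite !addE oneE; have := ge0 z; lra.
  have [->|[z ->]|[z ->]] := num_difference W a b; first by rewrite ltxx.
    by exists z.
  by rewrite !addE oneE => H; exfalso; have := ge0 z; lra.
- split=> // k; have [[[a b] c] <-] := fcl_surj W k; exists a, b, c.
  have c0 : fcl W (tnum W c) + 1 != 0 by apply: lt0r_neq0; have := ge0 c; lra.
  apply: (mulIf c0); rewrite mulfVK // -oneE -addE fclE_opp fclE_add fclE_mul.
  by apply/fcl_eq; rewrite /teq /=; ring.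
Qed.
End Embedding.

(** * Definable predicates and functions *)

Definition numlt {W} (a b : num W) : Prop := @dlt (proj1_sig W) a b.
Definition elem {W} (a : num W) (X : sets W) : Prop := @dmem (proj1_sig W) a X.

Reserved Notation "a <! b" (at level 70).
Notation "a <! b" := (numlt a b).

Section Sigma.
Variable W : second_order_model.
Notation M := (num W).
Implicit Types (P Q : (nat -> M) -> Prop) (f g : (nat -> M) -> M).
Implicit Types a b c x y z : M.

Lemma TermFun_add f g : TermFun W f -> TermFun W g -> TermFun W (fun e => f e + g e).
Proof. exact: TermFun_add0. Qed.

Lemma TermFun_mul f g : TermFun W f -> TermFun W g -> TermFun W (fun e => f e * g e).
Proof. exact: TermFun_mul0. Qed.

Lemma Delta0_lt f g : TermFun W f -> TermFun W g -> Delta0 W (fun e => f e <! g e).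
Proof. exact: Delta0_lt0. Qed.

Lemma Delta0_elem f X : TermFun W f -> Delta0 W (fun e => elem (f e) X).
Proof. exact: Delta0_mem0. Qed.

Lemma Delta0_all f (Q : (nat -> M) -> M -> Prop) :
  TermFun W f -> Delta0 W (fun e => Q (fun i => e i.+1) (e 0)) ->
  Delta0 W (fun e => forall x, x <! f e -> Q e x).
Proof. exact: Delta0_ball. Qed.

Lemma Delta0_ex f (Q : (nat -> M) -> M -> Prop) :
  TermFun W f -> Delta0 W (fun e => Q (fun i => e i.+1) (e 0)) ->
  Delta0 W (fun e => exists x, x <! f e /\ Q e x).
Proof. exact: Delta0_bex. Qed.

Lemma Delta0_subst P (s : nat -> (nat -> M) -> M) :
  Delta0 W P -> (forall i, TermFun W (s i)) -> Delta0 W (fun e => P (fun i => s i e)).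
Proof.
move=> [p bp Hp] /choice[t Ht].
exists (subst (fun k => if odd k then Var k else t k./2) (fun X => X) p).
  exact: bounded_subst.
move=> e; rewrite Hp sat_subst.
suff -> : mix W (fun i => s i e) =
    fun i => eval _ (mix W e) (if odd i then Var i else t i./2) by [].
apply/funext; apply: even_odd_ind => k; rewrite /= odd_double /= ?mix_odd //.
by rewrite mix_even doubleK Ht.
Qed.

Lemma TermFun_shift f : TermFun W f -> TermFun W (fun e => f (fun i => e i.+1)).
Proof.
move=> [t Ht]; exists (subst_term (fun k => if odd k then Var k else Var k.+2) t) => e.
rewrite Ht eval_subst; congr eval; apply/funext; apply: even_odd_ind => k.
  by rewrite odd_double /= -doubleS !mix_even.
by rewrite /= odd_double /= !mix_odd.
Qed.

Lemma Sigma1_ext P Q : (forall e, Q e <-> P e) -> Sigma1 W P -> Sigma1 W Q.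
Proof. by move=> H [R HR E]; exists R => // e; rewrite H. Qed.

Lemma Sigma1_subst P (s : nat -> (nat -> M) -> M) :
  Sigma1 W P -> (forall i, TermFun W (s i)) -> Sigma1 W (fun e => P (fun i => s i e)).
Proof.
move=> [Q HQ PQ] Hs.
exists (fun e => Q (scons (e 0) (fun i => s i (fun j => e j.+1)))) => //.
apply: (Delta0_ext (fun e => Q (fun i => scons (e 0) (fun i => s i (fun j => e j.+1)) i))) => //.
apply: (Delta0_subst Q (fun i e => scons (e 0) (fun i => s i (fun j => e j.+1)) i)) => // -[|i] /=.
  exact: TermFun_var.
exact: TermFun_shift.
Qed.

Lemma lt_addl x y : x <! x + y + 1.
Proof. by apply/num_lt_iff; exists y; rewrite addrA. Qed.

Lemma lt_addr x y : y <! x + y + 1.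
Proof. by apply/num_lt_iff; exists x; rewrite (addrC x) addrA. Qed.

(** Two unbounded quantifiers contract to one, which guesses a common bound; [x + y + 1] is such a
    bound. *)
Lemma Sigma1_ex (Q : (nat -> M) -> M -> Prop) :
  Sigma1 W (fun e => Q (fun i => e i.+1) (e 0)) -> Sigma1 W (fun e => exists x, Q e x).
Proof.
move=> [R HR QR].
exists (fun e => exists x, x <! e 0 /\ exists y, y <! e 0 /\
   R (scons y (scons x (fun i => e i.+1)))).
  apply: Delta0_ex; first exact: TermFun_var.
  apply: Delta0_ex; first exact: TermFun_var.
  apply: (Delta0_ext (fun e => R (fun i => scons (e 0) (scons (e 1) (fun i => e i.+3)) i))) => //.
  apply: (Delta0_subst R (fun i e => scons (e 0) (scons (e 1) (fun i => e i.+3)) i)) => //.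
  by move=> [|[|i]]; apply: TermFun_var.
move=> e; split=> [[x Hx]|[w [x [_ [y [_ H]]]]]].
  have [y Hy] := iffLR (QR (scons x e)) Hx.
  exists (x + y + 1), x; split; first exact: lt_addl.
  by exists y; split; first exact: lt_addr.
by exists x; apply/(QR (scons x e)); exists y.
Qed.

Let Delta0_1to2 P : Delta0 W P -> Delta0 W (fun e => P (scons (e 0) (fun i => e i.+2))).
Proof.
move=> HP; apply: (Delta0_ext (fun e => P (fun i => scons (e 0) (fun i => e i.+2) i))) => //.
by apply: (Delta0_subst P (fun i e => scons (e 0) (fun i => e i.+2) i)) => // -[|i]; apply: TermFun_var.
Qed.

Lemma Sigma1_and P Q : Sigma1 W P -> Sigma1 W Q -> Sigma1 W (fun e => P e /\ Q e).
Proof.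
move=> [P' HP PP] [Q' HQ QQ].
apply: (Sigma1_ext (fun e => exists x, P' (scons x e) /\ exists y, Q' (scons y e))).
  move=> e; rewrite PP QQ; split=> [[[x H] [y H']]|[x [H [y H']]]].
    by exists x; split=> //; exists y.
  by split; [exists x|exists y].
apply: Sigma1_ex.
exists (fun e => P' (scons (e 1) (fun i => e i.+2)) /\ Q' (scons (e 0) (fun i => e i.+2))).
  apply: Delta0_and; last exact: Delta0_1to2.
  by apply: (Delta0_ext (fun e => P' (fun i => e i.+1))); [move=> e; rewrite (_ : scons _ _ = (fun i => e i.+1)) //; apply/funext => -[]|exact: Delta0_scons1].
have E (e : nat -> M) : scons (e 0) (fun i => e i.+1) = e by apply/funext => -[].
move=> e /=; rewrite E; split=> [[H [y H']]|[y [H H']]].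
  by exists y.
by split=> //; exists y.
Qed.

Lemma Sigma1_or P Q : Sigma1 W P -> Sigma1 W Q -> Sigma1 W (fun e => P e \/ Q e).
Proof.
move=> [P' HP PP] [Q' HQ QQ].
exists (fun e => P' e \/ Q' e); first exact: Delta0_or.
move=> e; rewrite PP QQ; split=> [[[y H]|[y H]]|[y [H|H]]]; last by right; exists y.
- by exists y; left.
- by exists y; right.
- by left; exists y.
Qed.

(** For a total function a Sigma1 graph is already Delta1, because a number different from the value
    is recognized by computing the value. *)
Definition Delta1fun f : Prop := Sigma1 W (fun e => e 0 = f (fun i => e i.+1)).

(** The value is introduced by an existential quantifier over the graph. As the function is total,
    the same applies to the complement of [Q], whence the Delta1 version. *)
Lemma Sigma1_comp (Q : (nat -> M) -> M -> Prop) f :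
  Sigma1 W (fun e => Q (fun i => e i.+1) (e 0)) -> Delta1fun f -> Sigma1 W (fun e => Q e (f e)).
Proof.
move=> HQ Hf; apply: (Sigma1_ext (fun e => exists x, x = f e /\ Q e x)).
  by move=> e; split=> [|[x [->]]//]; exists (f e).
exact/Sigma1_ex/Sigma1_and.
Qed.

Lemma Delta1fun_TermFun f : TermFun W f -> Delta1fun f.
Proof.
by move=> /TermFun_shift Hf; apply: Delta0_Sigma1; apply: Delta0_eq => //; apply: TermFun_var.
Qed.

Lemma Delta1fun_var i : Delta1fun (fun e => e i).
Proof. exact/Delta1fun_TermFun/TermFun_var. Qed.

Lemma Delta1fun_const a : Delta1fun (fun _ => a).
Proof. exact/Delta1fun_TermFun/TermFun_const. Qed.

Lemma Delta1fun_shift f : Delta1fun f -> Delta1fun (fun e => f (fun i => e i.+1)).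
Proof.
move=> H; apply: (Sigma1_subst _ (fun i e => if i is j.+1 then e j.+2 else e 0) H).
by move=> [|i]; apply: TermFun_var.
Qed.

Lemma Delta1fun_shift2 f : Delta1fun f -> Delta1fun (fun e => f (fun i => e i.+2)).
Proof. by move=> /Delta1fun_shift/Delta1fun_shift. Qed.

Lemma Delta1fun_app2 (h : M -> M -> M) f g :
  Delta1fun (fun e => h (e 0) (e 1)) -> Delta1fun f -> Delta1fun g -> Delta1fun (fun e => h (f e) (g e)).
Proof.
move=> Hh Hf Hg.
apply: (Sigma1_comp (fun e x => e 0 = h x (g (fun i => e i.+1)))); last exact: Delta1fun_shift.
apply: (Sigma1_comp (fun e y => e 1 = h (e 0) y)); last exact: Delta1fun_shift2.
apply: (Sigma1_subst _ (fun i e => if i is 0 then e 2 else if i is 1 then e 1 else e 0) Hh).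
by move=> [|[|i]]; apply: TermFun_var.
Qed.

Lemma Delta1fun_app1 (h : M -> M) f :
  Delta1fun (fun e => h (e 0)) -> Delta1fun f -> Delta1fun (fun e => h (f e)).
Proof.
move=> Hh Hf; apply: (Delta1fun_app2 (fun x _ => h x)) (Hf); last exact: Hf.
exact: Hh.
Qed.

Lemma Delta1fun_app3 (h : M -> M -> M -> M) f g k :
  Delta1fun (fun e => h (e 0) (e 1) (e 2)) -> Delta1fun f -> Delta1fun g -> Delta1fun k ->
  Delta1fun (fun e => h (f e) (g e) (k e)).
Proof.
move=> Hh Hf Hg Hk.
apply: (Sigma1_comp (fun e x => e 0 = h x (g (fun i => e i.+1)) (k (fun i => e i.+1)))); last exact: Delta1fun_shift.
apply: (Sigma1_comp (fun e y => e 1 = h (e 0) y (k (fun i => e i.+2)))); last exact: Delta1fun_shift2.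
apply: (Sigma1_comp (fun e y => e 2 = h (e 1) (e 0) y)); last exact: (Delta1fun_shift2 _ (Delta1fun_shift _ Hk)).
apply: (Sigma1_subst _ (fun i e => if i is 0 then e 3 else if i is 1 then e 2 else if i is 2 then e 1 else e 0) Hh).
by move=> [|[|[|i]]]; apply: TermFun_var.
Qed.

Lemma Delta1fun_add f g : Delta1fun f -> Delta1fun g -> Delta1fun (fun e => f e + g e).
Proof.
by apply: Delta1fun_app2; apply: Delta1fun_TermFun; apply: TermFun_add; apply: TermFun_var.
Qed.

Lemma Delta1fun_mul f g : Delta1fun f -> Delta1fun g -> Delta1fun (fun e => f e * g e).
Proof.
by apply: Delta1fun_app2; apply: Delta1fun_TermFun; apply: TermFun_mul; apply: TermFun_var.
Qed.

Lemma Delta1_ext P Q : (forall e, Q e <-> P e) -> Delta1 W P -> Delta1 W Q.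
Proof. by move=> H [H1 H2]; split; [apply: Sigma1_ext H1|apply: Sigma1_ext H2 => e; rewrite H]. Qed.

Lemma Delta1_Delta0 P : Delta0 W P -> Delta1 W P.
Proof. by move=> HP; split; apply: Delta0_Sigma1 => //; apply: Delta0_not. Qed.

Lemma Delta1_not P : Delta1 W P -> Delta1 W (fun e => ~ P e).
Proof.
by move=> [H1 H2]; split=> //; apply: Sigma1_ext H1 => e; have := EM (P e); tauto.
Qed.

Lemma Delta1_and P Q : Delta1 W P -> Delta1 W Q -> Delta1 W (fun e => P e /\ Q e).
Proof.
move=> [P1 P2] [Q1 Q2]; split; first exact: Sigma1_and.
by apply: Sigma1_ext (Sigma1_or _ _ P2 Q2) => e; have := EM (P e); tauto.
Qed.

Lemma Delta1_or P Q : Delta1 W P -> Delta1 W Q -> Delta1 W (fun e => P e \/ Q e).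
Proof.
move=> [P1 P2] [Q1 Q2]; split; first exact: Sigma1_or.
by apply: Sigma1_ext (Sigma1_and _ _ P2 Q2) => e; tauto.
Qed.

Lemma Delta1_imp P Q : Delta1 W P -> Delta1 W Q -> Delta1 W (fun e => P e -> Q e).
Proof.
move=> HP HQ; apply: (Delta1_ext _ _ _ (Delta1_or _ _ (Delta1_not _ HP) HQ)) => e.
by have [Pe|nPe] := EM (P e); intuition.
Qed.

Lemma Delta1_iff P Q : Delta1 W P -> Delta1 W Q -> Delta1 W (fun e => P e <-> Q e).
Proof. by move=> HP HQ; apply: Delta1_and; apply: Delta1_imp. Qed.

Lemma Delta1_comp (Q : (nat -> M) -> M -> Prop) f :
  Delta1 W (fun e => Q (fun i => e i.+1) (e 0)) -> Delta1fun f -> Delta1 W (fun e => Q e (f e)).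
Proof.
by move=> [H1 H2] Hf; split; [apply: Sigma1_comp|apply: (Sigma1_comp (fun e x => ~ Q e x))].
Qed.

Lemma Delta1_comp2 (R : M -> M -> Prop) f g :
  Delta0 W (fun e => R (e 1) (e 0)) -> Delta1fun f -> Delta1fun g -> Delta1 W (fun e => R (f e) (g e)).
Proof.
move=> HR Hf Hg; apply: (Delta1_comp (fun e x => R x (g e))) => //.
apply: (Delta1_comp (fun e y => R (e 0) y)); last exact: Delta1fun_shift.
exact: Delta1_Delta0.
Qed.

Lemma Delta1_eq f g : Delta1fun f -> Delta1fun g -> Delta1 W (fun e => f e = g e).
Proof. by apply: Delta1_comp2; apply: Delta0_eq; apply: TermFun_var. Qed.

Lemma Delta1_lt f g : Delta1fun f -> Delta1fun g -> Delta1 W (fun e => f e <! g e).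
Proof. by apply: Delta1_comp2; apply: Delta0_lt; apply: TermFun_var. Qed.

Lemma Delta1_elem f X : Delta1fun f -> Delta1 W (fun e => elem (f e) X).
Proof.
move=> Hf; apply: (Delta1_comp (fun e x => elem x X)) Hf.
by apply: Delta1_Delta0; apply: Delta0_elem; apply: TermFun_var.
Qed.

Lemma Delta1fun_if P f g : Delta1 W P -> Delta1fun f -> Delta1fun g ->
  Delta1fun (fun e => if `[< P e >] then f e else g e).
Proof.
move=> [P1 P2] Hf Hg.
apply: (Sigma1_ext (fun e => P (fun i => e i.+1) /\ e 0 = f (fun i => e i.+1) \/
                  ~ P (fun i => e i.+1) /\ e 0 = g (fun i => e i.+1))).
  by move=> e; case: asboolP => H; split=> //; intuition.
have shift Q : Sigma1 W Q -> Sigma1 W (fun e => Q (fun i => e i.+1)).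
  by move=> HQ; apply: (Sigma1_subst Q (fun i e => e i.+1) HQ) => i; apply: TermFun_var.
apply: Sigma1_or; apply: Sigma1_and; [exact: (shift P)|exact: Hf|exact: (shift (fun e => ~ P e))|exact: Hg].
Qed.

Lemma comprehension1 (P : M -> Prop) : Delta1 W (fun e => P (e 0)) ->
  exists X : sets W, forall x, elem x X <-> P x.
Proof. exact: Delta1_comprehension. Qed.

Lemma induction1 (P : M -> Prop) : Sigma1 W (fun e => P (e 0)) ->
  P 0 -> (forall x, P x -> P (x + 1)) -> forall x, P x.
Proof. exact: Sigma1_induction0. Qed.

Lemma numlt_0 x : ~ x <! 0. Proof. exact: lt_0. Qed.

Lemma numlt_succ x y : x <! y + 1 <-> x <! y \/ x = y.
Proof. exact: lt_succ. Qed.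

Lemma numlt_trans y x z : x <! y -> y <! z -> x <! z.
Proof.
move=> /num_lt_iff[c ->] /num_lt_iff[d ->]; apply/num_lt_iff; exists (c + 1 + d).
by rewrite !addrA.
Qed.

Lemma numlt_total x y : [\/ x <! y, x = y | y <! x].
Proof.
have [->|H|H] := num_difference _ x y; first exact: Or32.
  by apply: Or31; apply/num_lt_iff.
by apply: Or33; apply/num_lt_iff.
Qed.

(** Comprehension first turns [P] into membership in a set; then the induction on the bound concerns
    a Delta0 predicate. *)
Lemma least_number (P : M -> Prop) : Delta1 W (fun e => P (e 0)) ->
  (exists x, P x) -> exists x, P x /\ forall y, y <! x -> ~ P y.
Proof.
move=> /comprehension1[X XP] [x Px]; apply: contrapT => no.
suff key : forall n y, y <! n -> ~ elem y X.
  by apply: (key (x + 1) x); [apply/numlt_succ; right|apply/XP].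
apply: induction1.
- by apply: Delta0_Sigma1; apply: Delta0_all; [apply: TermFun_var|apply: Delta0_not; apply: Delta0_elem; apply: TermFun_var].
- by move=> y /numlt_0.
- move=> n IH y /numlt_succ[/IH//|->] /XP Pn.
  by apply: no; exists n; split=> // z /IH nz Pz; apply/nz/XP.
Qed.

End Sigma.

(** * Coding and recursion *)

Record field_embedding (W : second_order_model) (K : realFieldType) := FieldEmbedding {
  embed :> num W -> K;
  embed_add : forall a b, embed (a + b) = embed a + embed b;
  embed_mul : forall a b, embed (a * b) = embed a * embed b;
  embed_1 : embed 1 = 1;
  embed_lt : forall a b, a <! b <-> embed a < embed b;
  embed_ge0 : forall a, 0 <= embed a;
  embed_quotient : forall k, exists a b c, k = (embed a - embed b) / (embed c + 1) }.

Lemma field_embedding_ex W : exists K, inhabited (field_embedding W K).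
Proof.
by have [K [io [D M1 o l [g q]]]] := field_of_fractions_ex W; exists K; split; exists io.
Qed.

Section Coding.
Variable W : second_order_model.
Notation M := (num W).
Variables (K : realFieldType) (io : field_embedding W K).

Let ioD := embed_add _ _ io.
Let ioM := embed_mul _ _ io.
Let io1 := embed_1 _ _ io.
Let io_lt := embed_lt _ _ io.
Let io_ge0 := embed_ge0 _ _ io.
Implicit Types (a b c d m n x y z : M).

Lemma io0 : io 0 = 0.
Proof. by have := ioD 0 0; rewrite addr0; lra. Qed.

Lemma io_inj a b : io a = io b -> a = b.
Proof.
by case: (numlt_total _ a b) => [/io_lt|//|/io_lt] + ab; rewrite ab ltxx.
Qed.

Lemma io_le_succ a b : a <! b -> io a + 1 <= io b.
Proof. by move=> /num_lt_iff[c ->]; rewrite !ioD io1; have := io_ge0 c; lra. Qed.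

Lemma lt_succ_le a b : a <! b + 1 <-> io a <= io b.
Proof.
split=> [/io_le_succ|]; rewrite ?io_lt ioD io1; lra.
Qed.

Definition mpair {W} (a b : num W) : num W := (a + b) * (a + b) + a.

(** The code of [(a, b)] lies between the squares of [a + b] and of [a + b + 1], so the sum is
    determined first. *)
Lemma mpair_inj a b c d : mpair a b = mpair c d -> a = c /\ b = d.
Proof.
have lem u v w t : io (u + v) + 1 <= io (w + t) -> mpair u v <> mpair w t.
  rewrite /mpair => H /(congr1 io); rewrite !(ioD, ioM) in H *.
  have := io_ge0 u; have := io_ge0 v; have := io_ge0 w; have := io_ge0 t.
  move: H; set U := io u; set V := io v; set X := io w; set T := io t.
  move=> *; nra.
case: (numlt_total _ (a + b) (c + d)) => [/io_le_succ/lem//|E|/io_le_succ/lem H /esym//].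
rewrite /mpair E => /num_addIl ac; split=> //; move: E; rewrite ac; exact: num_addIl.
Qed.

Lemma le_sqr a : io a <= io a * io a.
Proof.
have [->|H|H] := num_difference _ a 0; first by rewrite io0 mulr0.
  by case: H => c; rewrite addrA => /esym/num_succ_neq0.
by case: H => c ->; rewrite !ioD io0 io1; have := io_ge0 c; nra.
Qed.

Lemma mpair_gel a b : a <! mpair a b + 1.
Proof.
by apply/lt_succ_le; rewrite /mpair !(ioD, ioM); have := io_ge0 a; have := io_ge0 b; nra.
Qed.

Lemma mpair_ger a b : b <! mpair a b + 1.
Proof.
apply/lt_succ_le; rewrite /mpair !(ioD, ioM); have := io_ge0 a; have := io_ge0 b.
have := le_sqr (a + b); rewrite !ioD; lra.
Qed.

(** The pairing is not onto; the default 0 makes the projections total and keeps their graphs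
    Delta0. *)
Lemma unpair_ex x : exists ab, (forall a b, x = mpair a b -> ab = (a, b)) /\
  ((~ exists a b, x = mpair a b) -> ab = (0, 0)).
Proof.
have [[a [b ->]]|no] := EM (exists a b, x = mpair a b).
  exists (a, b); split=> [c d /mpair_inj[-> ->]//|[]]; by exists a, b.
by exists (0, 0); split=> // a b E; case: no; exists a, b.
Qed.

Definition unpair1 x : M := (proj1_sig (cid (unpair_ex x))).1.
Definition unpair2 x : M := (proj1_sig (cid (unpair_ex x))).2.

Lemma unpair1_mpair a b : unpair1 (mpair a b) = a.
Proof. by rewrite /unpair1; case: cid => ab [/= H _]; rewrite (H _ _ erefl). Qed.

Lemma unpair2_mpair a b : unpair2 (mpair a b) = b.
Proof. by rewrite /unpair2; case: cid => ab [/= H _]; rewrite (H _ _ erefl). Qed.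

Lemma unpair1_junk x : (~ exists a b, x = mpair a b) -> unpair1 x = 0.
Proof. by rewrite /unpair1; case: cid => ab [/= _ H] /H->. Qed.

Lemma unpair2_junk x : (~ exists a b, x = mpair a b) -> unpair2 x = 0.
Proof. by rewrite /unpair2; case: cid => ab [/= _ H] /H->. Qed.

Lemma TermFun_mpair f g : TermFun W f -> TermFun W g -> TermFun W (fun e => mpair (f e) (g e)).
Proof.
by move=> Hf Hg; apply: TermFun_add => //; apply: TermFun_mul; apply: TermFun_add.
Qed.

Lemma Delta1fun_mpair f g : Delta1fun W f -> Delta1fun W g -> Delta1fun W (fun e => mpair (f e) (g e)).
Proof.
by move=> Hf Hg; apply: Delta1fun_add => //; apply: Delta1fun_mul; apply: Delta1fun_add.
Qed.

Lemma mpair_bex x (Q : M -> M -> Prop) :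
  (exists a b, x = mpair a b /\ Q a b) <->
  (exists a, a <! x + 1 /\ exists b, b <! x + 1 /\ (x = mpair a b /\ Q a b)).
Proof.
split=> [[a [b [-> H]]]|[a [_ [b [_ H]]]]]; last by exists a, b.
by exists a; split; [exact: mpair_gel|exists b; split; first exact: mpair_ger].
Qed.

Lemma Delta0_true : Delta0 W (fun _ => True).
Proof. by apply: (Delta0_ext (fun _ => 0 = 0 :> M)) => //; apply: Delta0_eq; apply: TermFun_const. Qed.

Ltac t0 := repeat first
  [ apply: TermFun_var | apply: TermFun_const | apply: TermFun_mpair | apply: TermFun_add | apply: TermFun_mul ].
Ltac d0 := repeat first
  [ apply: TermFun_var | apply: TermFun_const | apply: TermFun_mpair | apply: TermFun_add | apply: TermFun_mul
  | apply: Delta0_eq | apply: Delta0_lt | apply: Delta0_elem | apply: Delta0_false | apply: Delta0_true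
  | apply: Delta0_not | apply: Delta0_and | apply: Delta0_or
  | apply: Delta0_ex | apply: Delta0_all | apply: Delta0_imp ].

Lemma Delta1fun_p (p : M -> M) (pr : M -> M -> M) :
  (forall a b, p (mpair a b) = pr a b) ->
  (forall x, (~ exists a b, x = mpair a b) -> p x = 0) ->
  TermFun W (fun e => pr (e 1) (e 0)) ->
  Delta1fun W (fun e => p (e 0)).
Proof.
move=> pE pJ Hpr.
apply: (Sigma1_ext _ (fun e => (exists a b, e 1 = mpair a b /\ e 0 = pr a b) \/
   (e 0 = 0 /\ ~ exists a b, e 1 = mpair a b /\ True))).
  move=> e; split=> [->|[[a [b [-> ->]]]|[-> H]]].
  - have [[a [b E]]|no] := EM (exists a b, e 1 = mpair a b).
      by left; exists a, b; rewrite E pE.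
    right; split; first exact: pJ.
    by move=> [a [b [E _]]]; apply: no; exists a, b.
  - by rewrite pE.
  - by rewrite pJ // => -[a [b E]]; apply: H; exists a, b.
apply: Delta0_Sigma1; apply: Delta0_or.
  apply: (Delta0_ext (fun e => exists a, a <! e 1 + 1 /\ exists b, b <! e 1 + 1 /\ (e 1 = mpair a b /\ e 0 = pr a b))).
    by move=> e; apply: mpair_bex.
  by d0; exact: Hpr.
apply: Delta0_and; first by d0.
apply: Delta0_not.
apply: (Delta0_ext (fun e => exists a, a <! e 1 + 1 /\ exists b, b <! e 1 + 1 /\ (e 1 = mpair a b /\ True))).
  by move=> e; apply: (mpair_bex _ (fun _ _ => True)).
by d0.
Qed.

Lemma Delta1fun_unpair1 f : Delta1fun W f -> Delta1fun W (fun e => unpair1 (f e)).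
Proof.
apply: Delta1fun_app1; apply: (Delta1fun_p _ (fun a b => a) unpair1_mpair unpair1_junk); by d0.
Qed.

Lemma Delta1fun_unpair2 f : Delta1fun W f -> Delta1fun W (fun e => unpair2 (f e)).
Proof.
apply: Delta1fun_app1; apply: (Delta1fun_p _ (fun a b => b) unpair2_mpair unpair2_junk); by d0.
Qed.

Lemma Sigma1_subst' (P : (nat -> M) -> Prop) (s : nat -> nat) :
  Sigma1 W P -> Sigma1 W (fun e => P (fun i => e (s i))).
Proof. by move=> H; apply: (Sigma1_subst _ P (fun i e => e (s i)) H) => i; apply: TermFun_var. Qed.

Lemma Delta1_ren (P : (nat -> M) -> Prop) (s : nat -> nat) :
  Delta1 W P -> Delta1 W (fun e => P (fun i => e (s i))).
Proof. by move=> [H1 H2]; split; [apply: (Sigma1_subst' P)|apply: (Sigma1_subst' (fun e => ~ P e))]. Qed.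

Lemma Delta1_app2 (R : M -> M -> Prop) f g :
  Delta1 W (fun e => R (e 0) (e 1)) -> Delta1fun W f -> Delta1fun W g -> Delta1 W (fun e => R (f e) (g e)).
Proof.
move=> HR Hf Hg; apply: (Delta1_comp _ (fun e x => R x (g e))) Hf.
apply: (Delta1_comp _ (fun e y => R (e 0) y)) (Delta1fun_shift _ _ Hg).
by apply: (Delta1_ren _ (fun i => if i is 0 then 1%N else 0%N) HR).
Qed.

Lemma function_set_ex (h : M -> M) : Delta1fun W (fun e => h (e 0)) ->
  exists F : sets W, forall a b, elem (mpair a b) F <-> b = h a.
Proof.
move=> Hh; have [|F HF] := @comprehension1 W (fun z => unpair2 z = h (unpair1 z)).
  apply: Delta1_eq; first exact/Delta1fun_unpair2/Delta1fun_var.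
  exact/Delta1fun_app1/Delta1fun_unpair1/Delta1fun_var.
by exists F => a b; rewrite HF unpair1_mpair unpair2_mpair.
Qed.

(** Minimization replaces choice: the least witness is definable, while an arbitrary choice of
    witnesses would not be. *)
Lemma search_ex (R : M -> M -> Prop) : Delta1 W (fun e => R (e 0) (e 1)) ->
  (forall x, exists y, R x y) ->
  exists f : M -> M, Delta1fun W (fun e => f (e 0)) /\ forall x, R x (f x).
Proof.
move=> HR Rex; have [|X HX] := @comprehension1 W (fun z => R (unpair1 z) (unpair2 z)).
  by apply: Delta1_app2 => //; [apply/Delta1fun_unpair1/Delta1fun_var|apply/Delta1fun_unpair2/Delta1fun_var].
have {}HX x y : elem (mpair x y) X <-> R x y by rewrite HX unpair1_mpair unpair2_mpair.
have H x : exists y, elem (mpair x y) X /\ forall z, z <! y -> ~ elem (mpair x z) X.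
  apply: least_number; first by apply/Delta1_Delta0; d0.
  by have [y /HX] := Rex x; exists y.
have [f fP] := choice H; exists f; split; last by move=> x; apply/HX; case: (fP x).
apply: (Sigma1_ext _ (fun e => elem (mpair (e 1) (e 0)) X /\ forall z, z <! e 0 -> ~ elem (mpair (e 1) z) X)).
  move=> e; split=> [->|[H1 H2]]; first exact: fP.
  have [H3 H4] := fP (e 1).
  by case: (numlt_total _ (e 0) (f (e 1))) => [/H4|//|/H2].
by apply: Delta0_Sigma1; d0.
Qed.

(** The finite set coded by [(m, d)], following Goedel's beta function, consists
    of the [x] for which [1 + (x + 1) d] divides [m]. *)
Definition incode m d x : Prop := exists z, z <! m + 1 /\ z * (1 + (x + 1) * d) = m.

Lemma Delta0_incode f g h : TermFun W f -> TermFun W g -> TermFun W h ->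
  Delta0 W (fun e => incode (f e) (g e) (h e)).
Proof.
move=> Hf Hg Hh; apply: Delta0_ex; first by apply: TermFun_add => //; apply: TermFun_const.
apply: Delta0_eq; last exact: TermFun_shift.
apply: TermFun_mul; first exact: TermFun_var.
apply: TermFun_add; first exact: TermFun_const.
apply: TermFun_mul; last exact: TermFun_shift.
by apply: TermFun_add; [exact: TermFun_shift|apply: TermFun_const].
Qed.

Lemma incodeP m d x : incode m d x <-> exists z, z * (1 + (x + 1) * d) = m.
Proof.
split=> [[z [_ H]]|[z H]]; exists z => //; split=> //.
apply/lt_succ_le; rewrite -H !(ioM, ioD) io1.
have : 0 <= io z * ((io x + 1) * io d) by rewrite !mulr_ge0 // addr_ge0.
by lra.
Qed.

(** This is divisibility of [b (A - B)] by [b], with the subtraction moved to the other side. *)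
Lemma dvd_of_eq m b A B : b <> 0 -> m + b * B = b * A -> exists z, z * b = m.
Proof.
move=> b0; have [->|[z ->]|[z ->]] := num_difference _ A B.
- by rewrite -[RHS]add0r => /num_addIr->; exists 0; rewrite mul0r.
- rewrite mulrDr addrCA -[RHS]addr0 => /num_addIl; rewrite addrC => /num_add_eq0.
  rewrite mulrDr mulr1 addrC => /num_add_eq0 //.
- by rewrite addrC mulrDr => /num_addIl ->; exists (z + 1); rewrite mulrC.
Qed.

Lemma modulus_neq0 d x : 1 + (x + 1) * d <> 0.
Proof. by rewrite addrC; apply: num_succ_neq0. Qed.

(** The moduli are pairwise coprime when [d] is a multiple of the differences. *)
Lemma moduli_coprime d k (e : M) x m : d = k * e ->
  (incode (m * (1 + (x + 1) * d)) d (x + k) -> incode m d (x + k)) /\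
  (incode (m * (1 + (x + k + 1) * d)) d x -> incode m d x).
Proof.
move=> ->; rewrite !incodeP; split=> -[w E].
  (* With [u = x + 1], [v = x + k + 1], [a = 1 + u k e] and [b = 1 + v k e], the coefficients come
     from the Bezout identity [a + u u e b = 1 + u v e a], multiplied by [m]. The second half uses
     the same identity with the roles of [a] and [b] exchanged. *)
  apply: (@dvd_of_eq _ _ (w + (x + 1) * (x + 1) * e * m) (w * (x + 1) * (x + k + 1) * e)).
    exact: modulus_neq0.
  transitivity (m + w * (1 + (x + k + 1) * (k * e)) * ((x + 1) * (x + k + 1) * e)); first by ring.
  transitivity (w * (1 + (x + k + 1) * (k * e)) + (x + 1) * (x + 1) * e * m * (1 + (x + k + 1) * (k * e))); last by ring.
  by rewrite E; ring.
apply: (@dvd_of_eq _ _ (m + (x + 1) * (x + 1) * e * w) (m * (x + 1) * (x + k + 1) * e)).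
  exact: modulus_neq0.
transitivity ((1 + (x + 1) * (k * e)) * m + (x + 1) * (x + 1) * e * (m * (1 + (x + k + 1) * (k * e)))); first by ring.
by rewrite -E; ring.
Qed.

(** The witness is in effect a factorial, which cannot be defined before primitive recursion is
    available. The bound on the quotient makes the induction statement Sigma1. *)
Lemma common_multiple_ex n : exists d, d <> 0 /\
  forall k, k <! n -> exists e, e <! d + 1 /\ d = (k + 1) * e.
Proof.
move: n; apply: induction1.
- exists (fun e => e 0 <> 0 /\ forall k, k <! e 1 -> exists a, a <! e 0 + 1 /\ e 0 = (k + 1) * a).
    by d0.
  by [].
- by exists 1; split=> [|k /numlt_0//]; apply/eqP/oner_neq0.
- move=> n [d [d0 H]]; exists (d * (n + 1)); split.
    by move/num_mul_succ_eq0.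
  have bd k (e : M) : d * (n + 1) = (k + 1) * e -> e <! d * (n + 1) + 1.
    move=> ->; apply/lt_succ_le; rewrite !(ioM, ioD) io1.
    by have := io_ge0 k; have := io_ge0 e; nra.
  move=> k /numlt_succ[/H[e [_ E]]|->].
    have E' : d * (n + 1) = (k + 1) * (e * (n + 1)) by rewrite {1}E mulrA.
    by exists (e * (n + 1)); split=> //; apply: bd E'.
  have E : d * (n + 1) = (n + 1) * d by rewrite mulrC.
  by exists d; split=> //; apply: bd E.
Qed.

(** The code is the product of the moduli of the elements below [n], built up by induction on [i].
    Coprimality guarantees that a new factor does not change the membership of other numbers. *)
Lemma code_ex (P : M -> Prop) n : Delta0 W (fun e => P (e 0)) ->
  exists m d, forall x, x <! n -> (incode m d x <-> P x).
Proof.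
move=> HP; have [d [d0 dn]] := common_multiple_ex n.
suff [m Hm] : exists m, forall x, x <! n -> (incode m d x <-> (x <! n /\ P x)).
  by exists m, d => x xn; rewrite Hm //; tauto.
suff key : forall i, exists m, forall x, x <! n -> (incode m d x <-> (x <! i /\ P x)).
  exact: key.
apply: induction1.
- exists (fun e => forall x, x <! n -> (incode (e 0) d x <-> (x <! e 1 /\ P x))).
    apply: Delta0_all; first exact: TermFun_const.
    apply: Delta0_iff; first by apply: Delta0_incode; t0.
    by apply: Delta0_and; first by d0.
  by [].
(* The empty product codes the empty set: as [d] is not zero, every modulus exceeds 1 and does not
   divide 1. *)
- exists 1 => x _; split=> [|[/numlt_0//]].
  move=> /incodeP[z Hz]; exfalso; apply: d0; apply: (@num_mul_succ_eq0 _ _ x).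
  rewrite mulrC; apply: io_inj; move/(congr1 io): Hz; rewrite !(ioM, ioD) io0 io1.
  have := io_ge0 z; have := io_ge0 x; have := io_ge0 d => d1 x1 z1.
  have t0 : 0 <= (io x + 1) * io d by rewrite mulr_ge0 // addr_ge0.
  have [z0|[c z0]|[c z0]] := num_difference _ z 0.
  + by rewrite z0 io0 mul0r; lra.
  + by rewrite addrA in z0; case: (num_succ_neq0 _ _ (esym z0)).
  + rewrite z0 !ioD io0 io1; have := mulr_ge0 (io_ge0 c) t0; have := io_ge0 c; lra.
- move=> i [m Hm]; have [[Pi lin]|no] := EM (P i /\ i <! n); last first.
    exists m => x xn; rewrite Hm // numlt_succ; split=> [[xi Px]|[[xi|xi] Px]] //.
      by split=> //; left.
    by case: no; rewrite -xi.
  exists (m * (1 + (i + 1) * d)) => x xn.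
  have [->|xi] := EM (x = i).
    split=> _; first by split=> //; apply/numlt_succ; right.
    by apply/incodeP; exists m.
  have E : incode (m * (1 + (i + 1) * d)) d x <-> incode m d x.
    split; last first.
      move=> /incodeP[z <-]; apply/incodeP; exists (z * (1 + (i + 1) * d)); ring.
    (* The two indices differ by [k + 1] with [k] below [n], and such a number divides [d]; this is
       the case covered by [moduli_coprime]. *)
    case: (numlt_total _ x i) => [/num_lt_iff[k xE]|//|/num_lt_iff[k xE]].
      have ki : k <! i by apply/num_lt_iff; exists x; rewrite xE; ring.
      have [f [_ Hf]] := dn _ (numlt_trans _ _ _ _ ki lin).
      by have [_] := moduli_coprime _ _ _ x m Hf; rewrite xE.
    have kx : k <! x by apply/num_lt_iff; exists i; rewrite xE; ring.
    have [f [_ Hf]] := dn _ (numlt_trans _ _ _ _ kx xn).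
    by have [] := moduli_coprime _ _ _ i m Hf; rewrite xE.
  rewrite E Hm // numlt_succ; tauto.
Qed.

(** [(n, m, d)] codes a set of pairs [(i, v)], each of which is the initial pair or is
    justified by a pair with first component [i - 1]; such a set is part of the
    graph of the function defined by recursion. *)
Definition trace (a : M) (G : sets W) p n m d : Prop :=
  forall x, x <! n -> incode m d x ->
    x = mpair 0 a \/
    exists j, j <! x + 1 /\ exists v, v <! n /\ exists w, w <! x + 1 /\
      ((x = mpair (j + 1) w /\ elem (mpair (mpair p (mpair j v)) w) G) /\
       (mpair j v <! n /\ incode m d (mpair j v))).

(** A value is one that occurs in some trace, which is a Sigma1 condition. Existence follows by
    extending a trace by one pair, uniqueness by comparing two traces along the recursion. *)
Lemma primitive_recursion (a : M) (g : M -> M -> M -> M) :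
  Delta1fun W (fun e => g (e 0) (e 1) (e 2)) ->
  exists h : M -> M -> M, Delta1fun W (fun e => h (e 0) (e 1)) /\
    forall p, h p 0 = a /\ forall i, h p (i + 1) = g p i (h p i).
Proof.
move=> Hg; have [|G HG] := @function_set_ex (fun x => g (unpair1 x) (unpair1 (unpair2 x)) (unpair2 (unpair2 x))).
  by apply: Delta1fun_app3 => //; repeat first [apply: Delta1fun_unpair1|apply: Delta1fun_unpair2|apply: Delta1fun_var].
have {}HG p j v w : elem (mpair (mpair p (mpair j v)) w) G <-> w = g p j v.
  by rewrite HG !(unpair1_mpair, unpair2_mpair).
pose val p i v := exists n m d, trace a G p n m d /\ mpair i v <! n /\ incode m d (mpair i v).
have D0tr : Delta0 W (fun e => trace a G (e 4) (e 2) (e 1) (e 0) /\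
    mpair (e 5) (e 3) <! e 2 /\ incode (e 1) (e 0) (mpair (e 5) (e 3))).
  by rewrite /trace; repeat first [apply: Delta0_incode|progress d0].
have ltSt x y z : x <! y + 1 -> y <! z -> x <! z.
  by move=> /numlt_succ[|->//]; apply: numlt_trans.
have uniq p i v v' : val p i v -> val p i v' -> v = v'.
  move=> [n [m [d [T [vn vc]]]]] [n' [m' [d' [T' [vn' vc']]]]].
  (* Bounding the values by the two traces, which are fixed here, makes the induction statement
     Delta0. *)
  suff key : forall i v, v <! n -> forall v', v' <! n' ->
      mpair i v <! n /\ incode m d (mpair i v) ->
      mpair i v' <! n' /\ incode m' d' (mpair i v') -> v = v'.
    by apply: (key i) => //; [apply: ltSt vn|apply: ltSt vn']; apply: mpair_ger.
  have inv n0 m0 d0 j w : trace a G p n0 m0 d0 -> mpair j w <! n0 -> incode m0 d0 (mpair j w) ->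
      (j = 0 /\ w = a) \/ exists k u, [/\ j = k + 1, w = g p k u, u <! n0, mpair k u <! n0 & incode m0 d0 (mpair k u)].
    move=> tr /tr H /H[/mpair_inj|]; first by left.
    move=> [k [_ [u [un [z [_ [[/mpair_inj[-> ->] /HG ->] [H1 H2]]]]]]]].
    by right; exists k, u.
  apply: induction1.
  - apply: Delta0_Sigma1; apply: Delta0_all; first exact: TermFun_const.
    apply: Delta0_all; first exact: TermFun_const.
    by repeat first [apply: Delta0_incode|progress d0].
  - move=> w _ w' _ [H1 H2] [H1' H2'].
    have [[_ ->]|[k [u [E _ _ _ _]]]] := inv _ _ _ _ _ T H1 H2; last by case: (num_succ_neq0 _ _ (esym E)).
    by have [[_ ->]|[k [u [E _ _ _ _]]]] := inv _ _ _ _ _ T' H1' H2'; last by case: (num_succ_neq0 _ _ (esym E)).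
  - move=> j IH w _ w' _ [H1 H2] [H1' H2'].
    have [[/num_succ_neq0//]|[k [u [/num_addIr<- -> un H3 H4]]]] := inv _ _ _ _ _ T H1 H2.
    have [[/num_succ_neq0//]|[k' [u' [/num_addIr<- -> un' H3' H4']]]] := inv _ _ _ _ _ T' H1' H2'.
    by rewrite (IH u un u' un').
have S1val : Sigma1 W (fun e => val (e 1) (e 2) (e 0)).
  apply: Sigma1_ex; apply: Sigma1_ex; apply: Sigma1_ex; exact: Delta0_Sigma1.
have val0 p : val p 0 a.
  have [|m [d Hc]] := @code_ex (fun x => x = mpair 0 a) (mpair 0 a + 1); first by d0.
  have ya : mpair 0 a <! mpair 0 a + 1 by apply/numlt_succ; right.
  exists (mpair 0 a + 1), m, d; split; first by move=> x /Hc E /E; left.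
  by split=> //; apply/Hc.
have valS p i v : val p i v -> val p (i + 1) (g p i v).
  move=> [n [m [d [T [vn vc]]]]].
  (* The new bound [N] exceeds both the old bound and the pair to be added. *)
  set y := mpair (i + 1) (g p i v); pose N := n + y + 1.
  have [|m' [d' Hc]] := @code_ex (fun x => x <! n /\ incode m d x \/ x = y) N.
    by repeat first [apply: Delta0_incode|progress d0].
  have nN x : x <! n -> x <! N by move=> /numlt_trans; apply; apply: lt_addl.
  have yN : y <! N by apply: lt_addr.
  exists N, m', d'; split; last by split=> //; apply/Hc => //; right.
  move=> x xN /Hc-/(_ xN)[[xn xc]|->].
    have [->|[j [jx [u [un [w [wx [H1 [H2 H3]]]]]]]]] := T x xn xc; first by left.
    right; exists j; split=> //; exists u; split; first exact: nN.
    exists w; split=> //; split=> //; split; first exact: nN.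
    by apply/Hc; [exact: nN|left].
  right; exists i; split.
    by apply: (numlt_trans _ (i + 1)); [apply/numlt_succ; right|apply: mpair_gel].
  exists v; split; first by apply/nN/(ltSt _ _ _ (mpair_ger _ _) vn).
  exists (g p i v); split; first exact: mpair_ger.
  split; first by split=> //; apply/HG.
  by split; [exact: nN|apply/Hc; [exact: nN|left]].
have ex p i : exists v, val p i v.
  move: i; apply: induction1.
  - apply: Sigma1_ex; apply: (Sigma1_subst _ _ (fun i e => if i is 0 then e 0 else if i is 1 then p else e 1) S1val).
    by move=> [|[|i]]; [apply: TermFun_var|apply: TermFun_const|apply: TermFun_var].
  - by exists a; apply: val0.
  - by move=> i [v Hv]; exists (g p i v); apply: valS.
have [h' Hh] := choice (fun pi => ex pi.1 pi.2).
pose h p i := h' (p, i).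
have hE p i : val p i (h p i) by apply: (Hh (p, i)).
exists h; split.
  by apply: Sigma1_ext S1val => e; split=> [->|H]; [exact: hE|apply: uniq H (hE _ _)].
move=> p; split; first exact: uniq (hE _ _) (val0 _).
by move=> i; apply: uniq (hE _ _) (valS _ _ _ (hE _ _)).
Qed.
End Coding.

(** * Rational numbers *)

Section Rationals.
Variable W : second_order_model.
Notation M := (num W).
Variables (K : realFieldType) (io : field_embedding W K).
Implicit Types (a b c d m n x y z q r : M) (k l : K).

Let ioD := embed_add _ _ io.
Let ioM := embed_mul _ _ io.
Let io1 := embed_1 _ _ io.
Let io_lt := embed_lt _ _ io.
Let io_ge0 := embed_ge0 _ _ io.
Let io_inj := io_inj _ _ io.
Notation unpair1 := (unpair1 W K io).
Notation unpair2 := (unpair2 W K io).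
Let p1E := unpair1_mpair W K io.
Let p2E := unpair2_mpair W K io.
Let Delta1fun_unpair1 := Delta1fun_unpair1 W K io.
Let Delta1fun_unpair2 := Delta1fun_unpair2 W K io.

Let mpair_gel := mpair_gel W K io.
Let mpair_ger := mpair_ger W K io.

Definition ratio a b c : K := (io a - io b) / (io c + 1).

Lemma den_gt0 c : 0 < io c + 1.
Proof. by have := io_ge0 c; lra. Qed.

Lemma den_neq0 c : io c + 1 != 0.
Proof. exact: lt0r_neq0 (den_gt0 c). Qed.

Lemma ratio_eq a b c a' b' c' : ratio a b c = ratio a' b' c' <->
  a * (c' + 1) + b' * (c + 1) = a' * (c + 1) + b * (c' + 1).
Proof.
rewrite /ratio; split=> [/eqP|/(congr1 io)].
  rewrite eqr_div ?den_neq0 // => /eqP E; apply: io_inj.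
  by rewrite !(ioD, ioM) io1; lra.
rewrite !(ioD, ioM) io1 => E; apply/eqP; rewrite eqr_div ?den_neq0 //; apply/eqP; lra.
Qed.

Lemma ratio_lt a b c a' b' c' : ratio a b c < ratio a' b' c' <->
  a * (c' + 1) + b' * (c + 1) <! a' * (c + 1) + b * (c' + 1).
Proof.
rewrite io_lt /ratio ltr_pdivrMr ?den_gt0 // mulrAC ltr_pdivlMr ?den_gt0 //.
by rewrite !(ioD, ioM) io1; split=> H; lra.
Qed.

Definition israt q : Prop := exists a b c, q = mpair (mpair a b) c /\
  forall r, r <! q -> ~ exists a' b' c', r = mpair (mpair a' b') c' /\
     a * (c' + 1) + b' * (c + 1) = a' * (c + 1) + b * (c' + 1).

Lemma code_bex q (R : M -> M -> M -> Prop) :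
  (exists a b c, q = mpair (mpair a b) c /\ R a b c) <->
  (exists a, a <! q + 1 /\ exists b, b <! q + 1 /\ exists c, c <! q + 1 /\
     (q = mpair (mpair a b) c /\ R a b c)).
Proof.
have ltSt x y z : x <! y + 1 -> y <! z -> x <! z.
  by move=> /numlt_succ[|->//]; apply: numlt_trans.
split=> [[a [b [c [E H]]]]|[a [_ [b [_ [c [_ H]]]]]]]; last by exists a, b, c.
have h : mpair a b <! q + 1 by rewrite E; apply: mpair_gel.
exists a; split; first by apply: ltSt h; apply: mpair_gel.
exists b; split; first by apply: ltSt h; apply: mpair_ger.
by exists c; split=> //; rewrite E; apply: mpair_ger.
Qed.

Ltac d0 := repeat first
  [ apply: TermFun_var | apply: TermFun_const | apply: TermFun_mpair | apply: TermFun_add | apply: TermFun_mul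
  | apply: Delta0_eq | apply: Delta0_lt | apply: Delta0_elem | apply: Delta0_false | apply: Delta0_true
  | apply: Delta0_not | apply: Delta0_and | apply: Delta0_or
  | apply: Delta0_ex | apply: Delta0_all | apply: Delta0_imp ].

Let israt_bounded q := exists a, a <! q + 1 /\ exists b, b <! q + 1 /\
  exists c, c <! q + 1 /\ (q = mpair (mpair a b) c /\
    forall r, r <! q -> ~ exists a', a' <! r + 1 /\ exists b', b' <! r + 1 /\
      exists c', c' <! r + 1 /\ (r = mpair (mpair a' b') c' /\
        a * (c' + 1) + b' * (c + 1) = a' * (c + 1) + b * (c' + 1))).

Lemma Delta0_israt0 : Delta0 W (fun e => israt (e 0)).
Proof.
apply: (Delta0_ext (fun e => israt_bounded (e 0))); last by rewrite /israt_bounded; d0.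
move=> e; rewrite /israt code_bex /israt_bounded.
have E a b c r := code_bex r (fun a' b' c' => a * (c' + 1) + b' * (c + 1) = a' * (c + 1) + b * (c' + 1)).
split=> -[a [ha [b [hb [c [hc [hq H]]]]]]]; exists a; split=> //; exists b; split=> //;
  exists c; split=> //; split=> // r /H H1 /E; exact.
Qed.

Lemma rat_code_ex k : exists q, israt q /\ exists a b c, q = mpair (mpair a b) c /\ k = ratio a b c.
Proof.
have [a0 [b0 [c0 E0]]] := embed_quotient _ _ io k.
have -> : k = ratio a0 b0 c0 by [].
have [||q [[a [b [c [qE H]]]] Hmin]] := @least_number W (fun q => exists a b c, q = mpair (mpair a b) c /\
   a0 * (c + 1) + b * (c0 + 1) = a * (c0 + 1) + b0 * (c + 1)).
- apply: Delta1_Delta0; apply: (Delta0_ext (fun e => exists a, a <! e 0 + 1 /\ exists b, b <! e 0 + 1 /\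
    exists c, c <! e 0 + 1 /\ (e 0 = mpair (mpair a b) c /\
      a0 * (c + 1) + b * (c0 + 1) = a * (c0 + 1) + b0 * (c + 1)))).
    by move=> e; apply: code_bex.
  by d0.
- by exists (mpair (mpair a0 b0) c0), a0, b0, c0.
exists q; split; last by exists a, b, c; split=> //; apply/ratio_eq.
exists a, b, c; split=> // r rq [a' [b' [c' [rE H']]]]; apply: (Hmin r rq).
exists a', b', c'; split=> //; apply/ratio_eq; transitivity (ratio a b c); exact/ratio_eq.
Qed.

(** Canonical codes and elements of [K] correspond bijectively through [rat_code] and [rat_val].
    Hence sequences of rationals in the model can be treated as functions into [K]. *)
Definition rat_code k : M := proj1_sig (cid (rat_code_ex k)).
Definition rat_val q : K := ratio (unpair1 (unpair1 q)) (unpair2 (unpair1 q)) (unpair2 q).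

Lemma rat_val_code a b c : rat_val (mpair (mpair a b) c) = ratio a b c.
Proof. by rewrite /rat_val !(p1E, p2E). Qed.

Lemma israt_rat_code k : israt (rat_code k).
Proof. by rewrite /rat_code; case: cid => q []. Qed.

Lemma rat_codeK k : rat_val (rat_code k) = k.
Proof.
by rewrite /rat_code; case: cid => q /= [_ [a [b [c [qE kE]]]]]; rewrite qE kE; apply: rat_val_code.
Qed.

Lemma rat_valK q : israt q -> rat_code (rat_val q) = q.
Proof.
move=> Hq; have [a [b [c [qE Hqm]]]] := Hq.
have [a' [b' [c' [rE Hrm]]]] := israt_rat_code (rat_val q).
have E : ratio a b c = ratio a' b' c'.
  by rewrite -[RHS]rat_val_code -rE rat_codeK qE rat_val_code.
case: (numlt_total _ (rat_code (rat_val q)) q) => [/Hqm|//|/Hrm] [].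
  by exists a', b', c'; split=> //; apply/ratio_eq.
by exists a, b, c; split=> //; apply/ratio_eq.
Qed.

(** The right-hand side does not mention [K], so the complexity of the graph can be read off from
    it. *)
Lemma rat_code_ratio y a b c : y = rat_code (ratio a b c) <-> israt y /\
  unpair1 (unpair1 y) * (c + 1) + b * (unpair2 y + 1) = a * (unpair2 y + 1) + unpair2 (unpair1 y) * (c + 1).
Proof.
rewrite -ratio_eq; split=> [->|[Hy E]]; last by rewrite -{1}(rat_valK y Hy) /rat_val E.
by split; [exact: israt_rat_code|exact: rat_codeK].
Qed.

Definition Delta1rat (f : (nat -> M) -> K) : Prop := Delta1fun W (fun e => rat_code (f e)).

Lemma Delta1_israt f : Delta1fun W f -> Delta1 W (fun e => israt (f e)).
Proof.
move=> Hf; apply: (Delta1_comp _ (fun e x => israt x)) Hf; apply: Delta1_Delta0.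
exact: Delta0_israt0.
Qed.

Ltac fd := repeat first
  [ apply: Delta1fun_var | apply: Delta1fun_const | apply: Delta1fun_unpair1 | apply: Delta1fun_unpair2 | apply: Delta1fun_mpair
  | apply: Delta1fun_add | apply: Delta1fun_mul | apply: Delta1fun_shift ].

Lemma Delta1rat_ext f g : (forall e, f e = g e) -> Delta1rat g -> Delta1rat f.
Proof. by move=> /funext->. Qed.

Lemma Delta1rat_ratio f g h : Delta1fun W f -> Delta1fun W g -> Delta1fun W h ->
  Delta1rat (fun e => ratio (f e) (g e) (h e)).
Proof.
move=> Hf Hg Hh.
apply: (Delta1fun_app3 _ (fun a b c => rat_code (ratio a b c))) => //.
apply: (Sigma1_ext _ _ _ (fun e => rat_code_ratio (e 0) (e 1) (e 2) (e 3))).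
suff [] : Delta1 W (fun e => israt (e 0) /\
  unpair1 (unpair1 (e 0)) * (e 3 + 1) + e 2 * (unpair2 (e 0) + 1) = e 1 * (unpair2 (e 0) + 1) + unpair2 (unpair1 (e 0)) * (e 3 + 1)) by [].
apply: Delta1_and; first by apply: Delta1_israt; fd.
by apply: Delta1_eq; fd.
Qed.

Lemma Delta1rat_rat_val f : Delta1fun W f -> Delta1rat (fun e => rat_val (f e)).
Proof. by move=> Hf; apply: Delta1rat_ratio; fd. Qed.

Lemma Delta1rat_const k : Delta1rat (fun _ => k).
Proof. exact: Delta1fun_const. Qed.

Lemma Delta1rat_embed f : Delta1fun W f -> Delta1rat (fun e => io (f e)).
Proof.
move=> Hf; apply: (Delta1rat_ext _ (fun e => ratio (f e) 0 0)); last by apply: Delta1rat_ratio; fd.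
by move=> e; rewrite /ratio (io0 W K io); field.
Qed.

Let den_mul_neq0 c d : io c * io d + io c + io d + 1 != 0.
Proof.
have -> : io c * io d + io c + io d + 1 = (io c + 1) * (io d + 1) by ring.
by rewrite mulf_neq0 ?den_neq0.
Qed.

Lemma ratio_add a b c a' b' c' : ratio a b c + ratio a' b' c' =
  ratio (a * (c' + 1) + a' * (c + 1)) (b * (c' + 1) + b' * (c + 1)) (c * c' + c + c').
Proof.
rewrite /ratio !(ioD, ioM) io1; field.
by rewrite ?den_mul_neq0 ?den_neq0.
Qed.

Lemma ratio_mul a b c a' b' c' : ratio a b c * ratio a' b' c' =
  ratio (a * a' + b * b') (a * b' + b * a') (c * c' + c + c').
Proof.
rewrite /ratio !(ioD, ioM); field.
by rewrite ?den_mul_neq0 ?den_neq0.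
Qed.

Lemma ratio_opp a b c : - ratio a b c = ratio b a c.
Proof. by rewrite /ratio; field; rewrite den_neq0. Qed.

Lemma Delta1rat_add f g : Delta1rat f -> Delta1rat g -> Delta1rat (fun e => f e + g e).
Proof.
move=> Hf Hg; apply: (Delta1rat_ext _ (fun e => rat_val (rat_code (f e)) + rat_val (rat_code (g e)))).
  by move=> e; rewrite !rat_codeK.
apply: (Delta1rat_ext _ _ (fun e => ratio_add _ _ _ _ _ _)).
by apply: Delta1rat_ratio; fd.
Qed.

Lemma Delta1rat_mul f g : Delta1rat f -> Delta1rat g -> Delta1rat (fun e => f e * g e).
Proof.
move=> Hf Hg; apply: (Delta1rat_ext _ (fun e => rat_val (rat_code (f e)) * rat_val (rat_code (g e)))).
  by move=> e; rewrite !rat_codeK.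
apply: (Delta1rat_ext _ _ (fun e => ratio_mul _ _ _ _ _ _)).
by apply: Delta1rat_ratio; fd.
Qed.

Lemma Delta1rat_opp f : Delta1rat f -> Delta1rat (fun e => - f e).
Proof.
move=> Hf; apply: (Delta1rat_ext _ (fun e => - rat_val (rat_code (f e)))).
  by move=> e; rewrite rat_codeK.
apply: (Delta1rat_ext _ _ (fun e => ratio_opp _ _ _)).
by apply: Delta1rat_ratio; fd.
Qed.

Lemma Delta1_ltK f g : Delta1rat f -> Delta1rat g -> Delta1 W (fun e => f e < g e).
Proof.
move=> Hf Hg; apply: (Delta1_ext _ (fun e => rat_val (rat_code (f e)) < rat_val (rat_code (g e)))).
  by move=> e; rewrite !rat_codeK.
apply: (Delta1_ext _ _ _ (fun e => ratio_lt _ _ _ _ _ _)).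
by apply: Delta1_lt; fd.
Qed.

Lemma Delta1_leK f g : Delta1rat f -> Delta1rat g -> Delta1 W (fun e => f e <= g e).
Proof.
move=> Hf Hg; apply: (Delta1_ext _ (fun e => ~ g e < f e)).
  by move=> e; rewrite leNgt; split=> /negP.
exact/Delta1_not/Delta1_ltK.
Qed.

Lemma Delta1rat_if P f g : Delta1 W P -> Delta1rat f -> Delta1rat g -> Delta1rat (fun e => if `[< P e >] then f e else g e).
Proof.
move=> HP Hf Hg.
apply: (Sigma1_ext _ _ _ _ (Delta1fun_if _ _ _ _ HP Hf Hg)) => e.
by case: asboolP.
Qed.

Lemma Delta1rat_abs f : Delta1rat f -> Delta1rat (fun e => `|f e|).
Proof.
move=> Hf; apply: (Delta1rat_ext _ (fun e => if `[< 0 <= f e >] then f e else - f e)).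
  by move=> e; case: asboolP => [/ger0_norm//|/negP]; rewrite -ltNge => /ltr0_norm.
by apply: Delta1rat_if; [apply: Delta1_leK; [apply: Delta1rat_const|]| |apply: Delta1rat_opp].
Qed.

(** The bound is a number of the model, possibly nonstandard: [(a - b) / (c + 1)] is less than
    [a + 1]. *)
Lemma archimedean k : exists n, k < io n.
Proof.
have [a [b [c ->]]] := embed_quotient _ _ io k; exists (a + 1).
rewrite ltr_pdivrMr ?den_gt0 // ioD io1.
have := io_ge0 a; have := io_ge0 b; have := io_ge0 c => ? ? ?.
have : 0 <= io a * io c by rewrite mulr_ge0.
by lra.
Qed.

Lemma inverse_lt k : 0 < k -> exists n, 0 < io n /\ (io n)^-1 < k.
Proof.
move=> k0; have [n kn] := archimedean k^-1.
have ik0 : 0 < k^-1 by rewrite invr_gt0.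
have n0 := lt_trans ik0 kn.
by exists n; split=> //; rewrite -[k]invrK ltf_pV2 ?posrE.
Qed.

(** The least [n] with [k < n + 1] is the integral part, by minimality applied to its
    predecessor. *)
Lemma floor_ex k : 0 <= k -> exists n, io n <= k < io n + 1.
Proof.
move=> k0; have [||n [kn Hmin]] := @least_number W (fun n => k < io n + 1).
- apply: Delta1_ltK; first exact: Delta1rat_const.
  apply: Delta1rat_add; last exact: Delta1rat_const.
  by apply: Delta1rat_embed; fd.
- by have [n kn] := archimedean k; exists n; lra.
exists n; rewrite kn andbT.
have [->|[c E]|[c E]] := num_difference _ n 0; first by rewrite (io0 W K io).
  by rewrite addrA in E; case: (num_succ_neq0 _ _ (esym E)).
rewrite add0r in E; rewrite E ioD io1 leNgt; apply/negP; apply: Hmin.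
by rewrite E; apply/numlt_succ; right.
Qed.

End Rationals.

(** * Satisfaction of the statement *)

(** Each definition mirrors the one of the same name in [Defs]: satisfaction of that formula
    in [W] reduces to it by computation. *)
Module Sem.
Section Sem.
Variable W : second_order_model.
Notation M := (num W).
Notation S := (sets W).

Definition expr (A : Type) : Type := (A -> Prop) -> Prop.
Definition ret {A} (a : A) : expr A := fun k => k a.
Definition bind {A B} (e : expr A) (f : A -> expr B) : expr B :=
  fun k => e (fun a => f a k).
Definition top : Prop := False -> False.
Definition le (t u : M) : Prop := t <! u \/ t = u.
Definition app (F : S) (a : M) : expr M := fun k => exists b, elem (mpair a b) F /\ k b.
Definition is_fun (dom cod : M -> Prop) (F : S) : Prop :=
  (forall p, elem p F -> exists a b, p = mpair a b /\ (dom a /\ cod b)) /\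
  (forall a, dom a -> exists b, elem (mpair a b) F /\ forall c, elem (mpair a c) F -> b = c).
Record frac : Type := Frac { pos : M; neg : M; den : M }.
Definition frac_add (x y : frac) : frac :=
  Frac (pos x * den y + pos y * den x) (neg x * den y + neg y * den x) (den x * den y).
Definition frac_opp (x : frac) : frac := Frac (neg x) (pos x) (den x).
Definition frac_eq (x y : frac) : Prop :=
  pos x * den y + neg y * den x = pos y * den x + neg x * den y.
Definition frac_lt (x y : frac) : Prop :=
  pos x * den y + neg y * den x <! pos y * den x + neg x * den y.
Definition frac_le (x y : frac) : Prop := frac_lt x y \/ frac_eq x y.
Definition code_frac (q : M) : expr frac :=
  fun k => exists a b c, q = mpair (mpair a b) c /\ k (Frac a b (c + 1)).
Definition is_rat (q : M) : Prop :=
  code_frac q (fun x => forall r, r <! q -> code_frac r (fun y => frac_eq x y) -> False).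
Definition rat : Type := expr frac.
Definition rat_of_nat (n : M) : rat := ret (Frac n 0 1).
Definition rat_inv (n : M) : rat := ret (Frac 1 0 n).
Definition rat_add (x y : rat) : rat :=
  bind x (fun u => bind y (fun v => ret (frac_add u v))).
Definition rat_opp (x : rat) : rat := bind x (fun u => ret (frac_opp u)).
Definition rat_sub (x y : rat) : rat := rat_add x (rat_opp y).
Definition rat_abs (x : rat) : rat := fun k =>
  x (fun u => (frac_le (Frac 0 0 1) u /\ k u) \/
              (frac_lt u (Frac 0 0 1) /\ k (frac_opp u))).
Definition rat_lt (x y : rat) : Prop := x (fun u => y (fun v => frac_lt u v)).
Definition rat_le (x y : rat) : Prop := x (fun u => y (fun v => frac_le u v)).
Definition all_eps (P : rat -> Prop) : Prop :=
  forall e, is_rat e -> rat_lt (rat_of_nat 0) (code_frac e) -> P (code_frac e).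
Definition ex_eps (P : rat -> Prop) : Prop :=
  exists e, is_rat e /\ (rat_lt (rat_of_nat 0) (code_frac e) /\ P (code_frac e)).
Definition is_real (X : S) : Prop :=
  is_fun (fun _ => top) is_rat X /\
  all_eps (fun e => exists N, forall m n, le N m -> le N n ->
    rat_lt (rat_abs (rat_sub (bind (app X m) code_frac) (bind (app X n) code_frac))) e).
Definition real : Type := M -> rat.
Definition real_of_set (X : S) : real := fun n => bind (app X n) code_frac.
Definition real_of_rat (q : rat) : real := fun _ => q.
Definition real_sub (x y : real) : real := fun n => rat_sub (x n) (y n).
Definition real_abs (x : real) : real := fun n => rat_abs (x n).
Definition real_le (x y : real) : Prop :=
  all_eps (fun e => exists N, forall n, le N n -> rat_le (x n) (rat_add (y n) e)).
Definition real_eq (x y : real) : Prop := real_le x y /\ real_le y x.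
Definition real_lt (x y : real) : Prop := real_le x y /\ (real_eq x y -> False).
Definition all_real (P : S -> Prop) : Prop := forall X, is_real X -> P X.
Definition ball (d : rat) (y z : real) : Prop :=
  real_lt (real_abs (real_sub y z)) (real_of_rat d).
Definition interval (a b : rat) (x : real) : Prop :=
  real_le (real_of_rat a) x /\ real_le x (real_of_rat b).
Definition repr : Type := M -> M -> rat.
Definition in_dom (f : repr) (x : real) : Prop :=
  all_eps (fun e => exists N, 0 <! N /\
    forall q r, is_rat q -> is_rat r ->
      ball (rat_inv N) x (real_of_rat (code_frac q)) ->
      ball (rat_inv N) x (real_of_rat (code_frac r)) ->
      forall i j, le N i -> le N j ->
        rat_lt (rat_abs (rat_sub (f q i) (f r j))) e).
Definition value (f : repr) (X : S) : real := fun i => bind (app X i) (fun q => f q i).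
Definition continuous_on (D : real -> Prop) (f : repr) : Prop :=
  all_real (fun x => D (real_of_set x) -> in_dom f (real_of_set x)).
Definition maps_to (D E : real -> Prop) (f : repr) : Prop :=
  all_real (fun x => D (real_of_set x) -> E (value f x)).
Definition is_repr (F : S) : Prop :=
  is_fun (fun a => exists q i, a = mpair q i /\ is_rat q) is_rat F.
Definition repr_of_set (F : S) : repr := fun q i => bind (app F (mpair q i)) code_frac.
Definition is_repr_family (F : S) : Prop :=
  is_fun (fun a => exists n q i, a = mpair n (mpair q i) /\ is_rat q) is_rat F.
Definition family_of_set (F : S) : M -> repr :=
  fun n q i => bind (app F (mpair n (mpair q i))) code_frac.
Definition sequence_of_functions (D : real -> Prop) (f : M -> repr) : Prop :=
  (forall n, continuous_on D (f n)) /\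
  all_real (fun x => D (real_of_set x) ->
    all_eps (fun e => exists N, 0 <! N /\
      forall q, is_rat q ->
        ball (rat_inv N) (real_of_set x) (real_of_rat (code_frac q)) ->
        forall n i j, le N i -> le N j ->
          rat_lt (rat_abs (rat_sub (f n q i) (f n q j))) e)).
Definition uniformly_equicontinuous (D : real -> Prop) (f : M -> repr) : Prop :=
  all_eps (fun e => ex_eps (fun d => forall n,
    all_real (fun x => all_real (fun y => D (real_of_set x) -> D (real_of_set y) ->
      real_lt (real_abs (real_sub (real_of_set x) (real_of_set y))) (real_of_rat d) ->
      real_lt (real_abs (real_sub (value (f n) x) (value (f n) y))) (real_of_rat e))))).
Definition converges_uniformly (D : real -> Prop) (f : M -> repr) (g : repr) : Prop :=
  all_eps (fun e => exists N, all_real (fun x => D (real_of_set x) ->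
    forall n, le N n ->
      real_lt (real_abs (real_sub (value (f n) x) (value g x))) (real_of_rat e))).
Definition strictly_increasing (G : S) : Prop :=
  is_fun (fun _ => top) (fun _ => top) G /\
  forall i j, i <! j -> app G i (fun a => app G j (fun b => a <! b)).
Definition subsequence (f : M -> repr) (G : S) : M -> repr :=
  fun i q j => bind (app G i) (fun n => f n q j).
Definition finite (P : M -> Prop) : Prop := exists k, forall m, P m -> m <! k.
Definition infinite (P : M -> Prop) : Prop := finite P -> False.
Definition IPP : Prop :=
  forall N c, is_fun (fun _ => top) (fun n => le n N) c ->
    exists n, le n N /\ infinite (fun i => app c i (fun v => v = n)).
Definition COH : Prop :=
  forall R : S, exists C : S,
    infinite (fun m => elem m C) /\
    forall i,
      finite (fun m => elem m C /\ (elem (mpair i m) R -> False)) \/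
      finite (fun m => elem m C /\ ((elem (mpair i m) R -> False) -> False)).
Definition ArzelaAscoli : Prop :=
  let D := interval (rat_of_nat 0) (rat_of_nat 1) in
  forall F, is_repr_family F ->
    let f := family_of_set F in
    sequence_of_functions D f ->
    forall B,
      (forall n, maps_to D (interval (rat_opp (rat_of_nat B)) (rat_of_nat B)) (f n)) ->
      uniformly_equicontinuous D f ->
      exists G, strictly_increasing G /\
        exists H, is_repr H /\ (continuous_on D (repr_of_set H) /\
          converges_uniformly D (subsequence f G) (repr_of_set H)).
End Sem.
End Sem.

Theorem reduction :
  (forall W, (Sem.COH W /\ Sem.IPP W) <-> Sem.ArzelaAscoli W) ->
  provable RCA0 (sentence (f_iff StCOH ArzelaAscoli)).
Proof.
move=> H; apply: completeness; first exact: RCA0_subst.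
move=> Mo HMo e E; pose W : second_order_model := exist _ Mo HMo.
have [H1 H2] := H W; split.
  by rewrite -[sat _ _ _ _]/(Sem.COH W /\ Sem.IPP W -> Sem.ArzelaAscoli W).
by rewrite -[sat _ _ _ _]/(Sem.ArzelaAscoli W -> Sem.COH W /\ Sem.IPP W).
Qed.

(** * Values of rational and real expressions *)

Section Evaluation.
Variable W : second_order_model.
Notation M := (num W).
Variables (K : realFieldType) (io : field_embedding W K).
Implicit Types (a b c d m n q r : M) (k l : K) (s t : Sem.rat W).

Let ioD := embed_add _ _ io.
Let ioM := embed_mul _ _ io.
Let io1 := embed_1 _ _ io.
Let io_lt := embed_lt _ _ io.
Let io_inj := io_inj _ _ io.
Let io0 := io0 W K io.
Notation rat_code := (rat_code W K io).
Notation rat_val := (rat_val W K io).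
Notation ratio := (ratio W K io).
Notation Delta1rat := (Delta1rat W K io).
Let mpair_inj := mpair_inj W K io.

Definition fval (x : Sem.frac W) : K :=
  (io (Sem.pos _ x) - io (Sem.neg _ x)) / io (Sem.den _ x).

(** A description [s] has a value when it amounts to evaluation at a single fraction. Positivity of
    the denominator is recorded because fractions are compared by cross-multiplication. *)
Definition denotes s v : Prop := exists x, [/\ fval x = v, 0 < io (Sem.den _ x) &
  forall P : Sem.frac W -> Prop, s P <-> P x].

Lemma denotes_ret x : 0 < io (Sem.den _ x) -> denotes (Sem.ret x) (fval x).
Proof. by exists x. Qed.

Lemma denotes_code q : israt W q -> denotes (Sem.code_frac W q) (rat_val q).
Proof.
move=> [a [b [c [-> _]]]]; exists (Sem.Frac W a b (c + 1)); split.
- by rewrite /fval /= (rat_val_code W K io) /ratio ioD io1.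
- by rewrite ioD io1; apply: den_gt0.
- move=> k; split=> [[a' [b' [c' [/mpair_inj[/mpair_inj[-> ->] ->]]]]]|] //.
  by exists a, b, c.
Qed.

Lemma denotes_rat_code k : denotes (Sem.code_frac W (rat_code k)) k.
Proof. by rewrite -{2}(rat_codeK W K io k); apply: denotes_code; apply: israt_rat_code. Qed.

Lemma denotes_nat n : denotes (Sem.rat_of_nat W n) (io n).
Proof.
rewrite (_ : io n = fval (Sem.Frac W n 0 1)); first by apply: denotes_ret; rewrite io1.
by rewrite /fval /= io0 io1 subr0 divr1.
Qed.

Lemma denotes_inv n : 0 < io n -> denotes (Sem.rat_inv W n) (io n)^-1.
Proof.
move=> n0; rewrite (_ : (io n)^-1 = fval (Sem.Frac W 1 0 n)); first exact: denotes_ret.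
by rewrite /fval /= io0 io1 subr0 div1r.
Qed.

Lemma denotes_opp s v : denotes s v -> denotes (Sem.rat_opp W s) (- v).
Proof.
move=> [x [<- x0 H]]; exists (Sem.frac_opp W x); split=> //.
  by rewrite /fval /= -mulNr opprB.
by move=> k; rewrite /Sem.rat_opp /Sem.bind H.
Qed.

Lemma denotes_add s t v u : denotes s v -> denotes t u -> denotes (Sem.rat_add W s t) (v + u).
Proof.
move=> [x [<- x0 H]] [y [<- y0 H']]; exists (Sem.frac_add W x y); split.
- by rewrite /fval /= !(ioD, ioM); field; rewrite !lt0r_neq0.
- by rewrite /= ioM mulr_gt0.
- by move=> k; rewrite /Sem.rat_add /Sem.bind H H'.
Qed.

Lemma denotes_sub s t v u : denotes s v -> denotes t u -> denotes (Sem.rat_sub W s t) (v - u).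
Proof. by move=> Hs Ht; apply: denotes_add => //; apply: denotes_opp. Qed.

Lemma frac_ltE x y : 0 < io (Sem.den W x) -> 0 < io (Sem.den W y) ->
  (Sem.frac_lt W x y <-> fval x < fval y).
Proof.
move=> x0 y0; rewrite /Sem.frac_lt io_lt /fval ltr_pdivrMr // mulrAC ltr_pdivlMr //.
by rewrite !(ioD, ioM); split=> H; lra.
Qed.

Lemma frac_leE x y : 0 < io (Sem.den W x) -> 0 < io (Sem.den W y) ->
  (Sem.frac_le W x y <-> fval x <= fval y).
Proof.
move=> x0 y0; rewrite /Sem.frac_le frac_ltE // le_eqVlt.
have -> : Sem.frac_eq W x y <-> fval x = fval y.
  rewrite /fval /Sem.frac_eq; split=> [/(congr1 io)|/eqP].
    by rewrite !(ioD, ioM) => E; apply/eqP; rewrite eqr_div ?lt0r_neq0 //; apply/eqP; lra.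
  by rewrite eqr_div ?lt0r_neq0 // => /eqP E; apply: io_inj; rewrite !(ioD, ioM); lra.
by split=> [[->|->]|/orP[/eqP|]]; rewrite ?eqxx ?orbT //; tauto.
Qed.

Lemma denotes_abs s v : denotes s v -> denotes (Sem.rat_abs W s) `|v|.
Proof.
move=> [x [<- x0 H]].
have z0 : 0 < io (Sem.den W (Sem.Frac W 0 0 1)) by rewrite /= io1.
have fz : fval (Sem.Frac W 0 0 1) = 0 by rewrite /fval /= io0 subrr mul0r.
have [h|h] := leP 0 (fval x).
  exists x; split; rewrite ?ger0_norm // => k; rewrite /Sem.rat_abs H frac_leE // frac_ltE // fz.
  by rewrite h ltNge h /=; intuition.
exists (Sem.frac_opp W x); split=> //.
  by rewrite ltr0_norm // /fval /= -mulNr opprB.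
move=> k; rewrite /Sem.rat_abs H frac_leE // frac_ltE // fz.
by rewrite h leNgt h /=; intuition.
Qed.

Lemma rat_ltE s t v u : denotes s v -> denotes t u -> (Sem.rat_lt W s t <-> v < u).
Proof.
move=> [x [<- x0 H]] [y [<- y0 H']].
by rewrite /Sem.rat_lt H H' frac_ltE.
Qed.

Lemma rat_leE s t v u : denotes s v -> denotes t u -> (Sem.rat_le W s t <-> v <= u).
Proof.
move=> [x [<- x0 H]] [y [<- y0 H']].
by rewrite /Sem.rat_le H H' frac_leE.
Qed.

Lemma leE a b : Sem.le W a b <-> io a <= io b.
Proof. by rewrite -lt_succ_le numlt_succ. Qed.

Lemma all_epsE P (P' : K -> Prop) : (forall s k, denotes s k -> (P s <-> P' k)) ->
  (Sem.all_eps W P <-> forall k, 0 < k -> P' k).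
Proof.
move=> H; split=> HP.
  move=> k k0; apply/(H _ _ (denotes_rat_code k))/HP; first exact: israt_rat_code.
  by apply/(rat_ltE _ _ _ _ (denotes_nat _) (denotes_rat_code _)); rewrite io0.
move=> q Hq; have dq := denotes_code _ Hq.
move=> /(rat_ltE _ _ _ _ (denotes_nat _) dq); rewrite io0 => q0.
exact/(H _ _ dq)/HP.
Qed.

Lemma ex_epsE P (P' : K -> Prop) : (forall s k, denotes s k -> (P s <-> P' k)) ->
  (Sem.ex_eps W P <-> exists k, 0 < k /\ P' k).
Proof.
move=> H; split=> [[q [Hq [q0 Pq]]]|[k [k0 Pk]]].
  have dq := denotes_code _ Hq; exists (rat_val q); split.
    by move/(rat_ltE _ _ _ _ (denotes_nat _) dq): q0; rewrite io0.
  exact/(H _ _ dq).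
exists (rat_code k); split; first exact: israt_rat_code; split.
  by apply/(rat_ltE _ _ _ _ (denotes_nat _) (denotes_rat_code _)); rewrite io0.
exact/(H _ _ (denotes_rat_code k)).
Qed.

Implicit Types (u v : M -> K) (x y : Sem.real W).

Definition Denotes (x : Sem.real W) (u : M -> K) : Prop := forall n, denotes (x n) (u n).

Definition eventually (P : M -> Prop) : Prop := exists N, forall n, io N <= io n -> P n.
Definition Rle (u v : M -> K) : Prop := forall e : K, 0 < e -> eventually (fun n => u n <= v n + e).
Definition Rlt (u v : M -> K) : Prop := Rle u v /\ ~ Rle v u.
Definition cauchy (u : M -> K) : Prop := forall e : K, 0 < e ->
  exists N, forall m n, io N <= io m -> io N <= io n -> `|u m - u n| < e.
Definition cst (k : K) : M -> K := fun _ => k.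
Definition dist (u v : M -> K) : M -> K := fun n => `|u n - v n|.

Lemma Denotes_cst s k : denotes s k -> Denotes (Sem.real_of_rat W s) (cst k).
Proof. by move=> H n. Qed.

Lemma Denotes_dist x y u v : Denotes x u -> Denotes y v ->
  Denotes (Sem.real_abs W (Sem.real_sub W x y)) (dist u v).
Proof. by move=> Hx Hy n; apply: denotes_abs; apply: denotes_sub. Qed.

Lemma real_leE x y u v : Denotes x u -> Denotes y v -> (Sem.real_le W x y <-> Rle u v).
Proof.
move=> Hx Hy; apply: all_epsE => s k Hs.
split=> -[N H]; exists N => n; move: (H n); rewrite leE => {}H /H;
  by move/(rat_leE _ _ _ _ (Hx n) (denotes_add _ _ _ _ (Hy n) Hs)).
Qed.

Lemma real_ltE x y u v : Denotes x u -> Denotes y v -> (Sem.real_lt W x y <-> Rlt u v).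
Proof.
move=> Hx Hy; rewrite /Sem.real_lt /Sem.real_eq /Rlt.
by rewrite (real_leE _ _ _ _ Hx Hy) (real_leE _ _ _ _ Hy Hx); tauto.
Qed.

Definition codes (X : sets W) (u : M -> K) : Prop :=
  forall a b, elem (mpair a b) X <-> b = rat_code (u a).
(** These are exactly the sequences coded by reals of the model: a coding set gives a Delta0 graph,
    and comprehension gives a coding set. Quantifiers over reals thereby become quantifiers over
    such functions. *)
Definition isreal (u : M -> K) : Prop := cauchy u /\ Delta1rat (fun e => u (e 0)).

Lemma codes_Delta1rat X u : codes X u -> Delta1rat (fun e => u (e 0)).
Proof.
move=> H; apply: (Sigma1_ext _ (fun e => elem (mpair (e 1) (e 0)) X)).
  by move=> e; rewrite H.
by apply: Delta0_Sigma1; apply: Delta0_elem; apply: TermFun_mpair; apply: TermFun_var.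
Qed.

Lemma Denotes_set X u : codes X u -> Denotes (Sem.real_of_set W X) u.
Proof.
move=> H n; have [x [E x0 Hx]] := denotes_rat_code (u n); exists x; split=> // k.
rewrite -Hx /Sem.real_of_set /Sem.bind /Sem.app.
by split=> [[b [/H->]]|Hk] //; exists (rat_code (u n)); split=> //; apply/H.
Qed.

Lemma is_real_codes X : Sem.is_real W X -> exists u, codes X u /\ isreal u.
Proof.
move=> [[H1 H2] HC].
have ex a : exists k, forall b, elem (mpair a b) X <-> b = rat_code k.
  have [|b [Xb Hb]] := H2 a; first by [].
  have [a' [b' [/mpair_inj[_ E] [_]]]] := H1 _ Xb; rewrite -E => rb.
  by exists (rat_val b) => c; rewrite (rat_valK W K io) //; split=> [/Hb|->].
have [u Hu] := choice ex; have Xu : codes X u by move=> a b; apply: Hu.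
exists u; split=> //; split; last exact: codes_Delta1rat Xu.
have D := Denotes_set _ _ Xu.
apply: (iffLR (all_epsE _ _ _) HC) => s k Hs.
split=> -[N H]; exists N => m n; move: (H m n); rewrite !leE => {}H /H{}H /H;
  by move/(rat_ltE _ _ _ _ (denotes_abs _ _ (denotes_sub _ _ _ _ (D m) (D n))) Hs).
Qed.
End Evaluation.

Lemma and_iff (A B C D : Prop) : (A <-> B) -> (C <-> D) -> (A /\ C <-> B /\ D).
Proof. by move=> -> ->. Qed.

Lemma imp_iff (A B C : Prop) : (B <-> C) -> ((A -> B) <-> (A -> C)).
Proof. by move=> ->. Qed.

Lemma forall_iff (A : Type) (P Q : A -> Prop) :
  (forall a, P a <-> Q a) -> ((forall a, P a) <-> (forall a, Q a)).
Proof. by move=> H; split=> HP a; apply/H. Qed.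

Lemma exists_iff (A : Type) (P Q : A -> Prop) :
  (forall a, P a <-> Q a) -> ((exists a, P a) <-> (exists a, Q a)).
Proof. by move=> H; split=> -[a /H Ha]; exists a. Qed.

(** * The two principles in terms of functions into the field *)

Section Translation.
Variable W : second_order_model.
Notation M := (num W).
Variables (K : realFieldType) (io : field_embedding W K).
Implicit Types (a b c d m n i j : M) (k l : K) (u v : M -> K).

Let io0 := io0 W K io.
Let io1 := embed_1 _ _ io.
Notation unpair1 := (unpair1 W K io).
Notation unpair2 := (unpair2 W K io).
Let p1E := unpair1_mpair W K io.
Let p2E := unpair2_mpair W K io.
Let Delta1fun_unpair1 := Delta1fun_unpair1 W K io.
Let Delta1fun_unpair2 := Delta1fun_unpair2 W K io.
Notation rat_code := (rat_code W K io).
Notation rat_val := (rat_val W K io).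
Notation Delta1rat := (Delta1rat W K io).
Let mpair_inj := mpair_inj W K io.
Let leE := leE W K io.
Notation denotes := (denotes W K io).
Notation Denotes := (Denotes W K io).
Notation codes := (codes W K io).
Notation isreal := (isreal W K io).
Notation Rle := (Rle W K io).
Notation Rlt := (Rlt W K io).
Notation cst := (cst W K).
Notation dist := (dist W K).
Let den_sub := denotes_sub W K io.
Let den_abs := denotes_abs W K io.
Let ltQ := rat_ltE W K io.

Let Delta1_israt := Delta1_israt W K io.
Let Delta1fun_rat_val : forall f, Delta1fun W f -> Delta1fun W (fun e => rat_code (rat_val (f e))) := Delta1rat_rat_val W K io.

Ltac fd := repeat first
  [ apply: Delta1fun_rat_val | apply: Delta1fun_var | apply: Delta1fun_const | apply: Delta1fun_unpair1 | apply: Delta1fun_unpair2 | apply: Delta1fun_mpair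
  | apply: Delta1fun_add | apply: Delta1fun_mul | apply: Delta1fun_shift ].

Lemma function_set (dom cod : M -> Prop) (h : M -> M) :
  Delta1 W (fun e => dom (e 0)) -> Delta1fun W (fun e => h (e 0)) ->
  (forall a, dom a -> cod (h a)) ->
  exists F, Sem.is_fun W dom cod F /\ forall a b, elem (mpair a b) F <-> dom a /\ b = h a.
Proof.
move=> Hd Hh Hc.
have [|F HF] := @comprehension1 W (fun z => z = mpair (unpair1 z) (unpair2 z) /\ (dom (unpair1 z) /\ unpair2 z = h (unpair1 z))).
  apply: Delta1_and; first by apply: Delta1_eq; fd.
  apply: Delta1_and.
    by apply: (Delta1_comp _ (fun e x => dom x)); [exact: Hd|fd].
  by apply: Delta1_eq; [fd|apply: Delta1fun_app1 => //; fd].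
have FE a b : elem (mpair a b) F <-> dom a /\ b = h a.
  by rewrite HF !(p1E, p2E); tauto.
exists F; split=> //; split.
  move=> p /HF[E [Hp1 Hp2]]; exists (unpair1 p), (unpair2 p); split=> //; split=> //.
  by rewrite Hp2; apply: Hc.
by move=> a da; exists (h a); split; [apply/FE|move=> c /FE[]].
Qed.

Lemma function_of_set (dom cod : M -> Prop) F : Sem.is_fun W dom cod F ->
  exists h : M -> M, forall a, dom a -> cod (h a) /\ forall b, elem (mpair a b) F <-> b = h a.
Proof.
move=> [H1 H2].
have ex a : exists b, dom a -> cod b /\ forall c, elem (mpair a c) F <-> c = b.
  have [da|nda] := EM (dom a); last by exists 0.
  have [b [Hb bu]] := H2 a da; exists b => _.
  have [a' [b' [/mpair_inj[_ E] [_]]]] := H1 _ Hb; rewrite -E => cb; split=> // c.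
  by split=> [/bu->|->].
by have [h Hh] := choice ex; exists h => a; apply: Hh.
Qed.

Lemma set_of_real u : isreal u -> exists X, codes X u /\ Sem.is_real W X.
Proof.
move=> [Cu FKu].
have [||X [HX XE]] := function_set (fun _ => Sem.top) (Sem.is_rat W) (fun a => rat_code (u a)) _ FKu.
- by apply: Delta1_Delta0; apply: Delta0_imp; apply: Delta0_false.
- by move=> a _; apply: israt_rat_code.
have Xu : codes X u by move=> a b; rewrite XE; intuition.
exists X; split=> //; split=> //; have D := Denotes_set W K io _ _ Xu.
apply: (iffRL (all_epsE W K io _ _ _) Cu) => s k Hs.
split=> -[N H]; exists N => m n; move: (H m n); rewrite !leE => {}H /H{}H /H;
  by move/(ltQ _ _ _ _ (den_abs _ _ (den_sub _ _ _ _ (D m) (D n))) Hs).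
Qed.

Lemma all_realE (P : sets W -> Prop) (P' : (M -> K) -> Prop) :
  (forall X u, codes X u -> isreal u -> (P X <-> P' u)) ->
  (Sem.all_real W P <-> forall u, isreal u -> P' u).
Proof.
move=> H; split=> HP.
  move=> u Hu; have [X [Xu rX]] := set_of_real _ Hu.
  exact/(H X u Xu Hu)/HP.
by move=> X /(is_real_codes W K io)[u [Xu ru]]; apply/(H X u Xu ru)/HP.
Qed.

Definition I01 u : Prop := Rle (cst 0) u /\ Rle u (cst 1).

Definition Dom (f : K -> M -> K) u : Prop := forall e : K, 0 < e -> exists N, 0 < io N /\
  forall q r, Rlt (dist u (cst q)) (cst (io N)^-1) -> Rlt (dist u (cst r)) (cst (io N)^-1) ->
  forall i j, io N <= io i -> io N <= io j -> `|f q i - f r j| < e.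

(** Nothing is required at noncanonical codes, where a coded function has no value. *)
Definition represents (phi : Sem.repr W) (f : K -> M -> K) : Prop :=
  forall q i, israt W q -> denotes (phi q i) (f (rat_val q) i).

Lemma represents_rat_code phi f q i : represents phi f -> denotes (phi (rat_code q) i) (f q i).
Proof.
by move=> H; have := H (rat_code q) i (israt_rat_code W K io q); rewrite rat_codeK.
Qed.

Lemma ballE s x k u q : Denotes x u -> denotes s k -> israt W q ->
  (Sem.ball W s x (Sem.real_of_rat W (Sem.code_frac W q)) <->
   Rlt (dist u (cst (rat_val q))) (cst k)).
Proof.
move=> Hx Hs Hq; apply: real_ltE; last exact: Denotes_cst.
by apply: Denotes_dist => //; apply: Denotes_cst; apply: denotes_code.
Qed.

Lemma lt0E N : 0 <! N <-> 0 < io N.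
Proof. by rewrite (embed_lt _ _ io) io0. Qed.

Lemma in_domE phi f x u : represents phi f -> Denotes x u ->
  (Sem.in_dom W phi x <-> Dom f u).
Proof.
move=> Hf Hx; apply: (all_epsE W K io) => s e Hs.
split=> -[N [N0 H]]; exists N.
  move/lt0E: N0 => N0; split=> // q r Hq Hr i j Ni Nj.
  have iN := denotes_inv W K io _ N0.
  have rq := israt_rat_code W K io q; have rr := israt_rat_code W K io r.
  apply/(ltQ _ _ _ _ (den_abs _ _ (den_sub _ _ _ _ (represents_rat_code _ _ q i Hf) (represents_rat_code _ _ r j Hf))) Hs).
  by apply: H => //; [apply/(ballE _ _ _ _ _ Hx iN rq)|apply/(ballE _ _ _ _ _ Hx iN rr)|exact/leE|exact/leE]; rewrite rat_codeK.
have iN := denotes_inv W K io _ N0; split; first exact/lt0E.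
move=> q r rq rr /(ballE _ _ _ _ _ Hx iN rq) Bq /(ballE _ _ _ _ _ Hx iN rr) Br i j /leE Ni /leE Nj.
apply/(ltQ _ _ _ _ (den_abs _ _ (den_sub _ _ _ _ (Hf q i rq) (Hf r j rr))) Hs).
exact: H.
Qed.

Lemma Denotes_value phi f X u : represents phi f -> codes X u ->
  Denotes (Sem.value W phi X) (fun i => f (u i) i).
Proof.
move=> Hf Xu i; have [x [E x0 Hx]] := represents_rat_code _ _ (u i) i Hf; exists x; split=> // k.
rewrite -Hx /Sem.value /Sem.bind /Sem.app.
by split=> [[b [/Xu->]]|Hk] //; exists (rat_code (u i)); split=> //; apply/Xu.
Qed.

Lemma intervalE s t k l x u : denotes s k -> denotes t l -> Denotes x u ->
  (Sem.interval W s t x <-> Rle (cst k) u /\ Rle u (cst l)).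
Proof.
move=> Hs Ht Hx; rewrite /Sem.interval.
rewrite (real_leE W K io _ _ _ _ (Denotes_cst W K io _ _ Hs) Hx).
by rewrite (real_leE W K io _ _ _ _ Hx (Denotes_cst W K io _ _ Ht)).
Qed.

Notation unit_interval := (Sem.interval W (Sem.rat_of_nat W 0) (Sem.rat_of_nat W 1)).

Lemma unit_intervalE x u : Denotes x u -> (unit_interval x <-> I01 u).
Proof.
move=> Hx; rewrite (intervalE _ _ _ _ _ _ (denotes_nat W K io 0) (denotes_nat W K io 1) Hx).
by rewrite io0 io1.
Qed.

Lemma continuousE phi f : represents phi f ->
  (Sem.continuous_on W unit_interval phi <-> forall u, isreal u -> I01 u -> Dom f u).
Proof.
move=> Hf; apply: all_realE => X u Xu _; have Hx := Denotes_set W K io _ _ Xu.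
by rewrite (unit_intervalE _ _ Hx) (in_domE _ _ _ _ Hf Hx).
Qed.

Definition family_continuous (f : M -> K -> M -> K) : Prop :=
  (forall n u, isreal u -> I01 u -> Dom (f n) u) /\
  forall u, isreal u -> I01 u -> forall e : K, 0 < e -> exists N, 0 < io N /\
    forall q, Rlt (dist u (cst q)) (cst (io N)^-1) ->
    forall n i j, io N <= io i -> io N <= io j -> `|f n q i - f n q j| < e.

Lemma sequence_of_functionsE phi f : (forall n, represents (phi n) (f n)) ->
  (Sem.sequence_of_functions W unit_interval phi <-> family_continuous f).
Proof.
move=> Hf; apply: and_iff.
  by apply: forall_iff => n; apply: continuousE.
apply: all_realE => X u Xu _; have Hx := Denotes_set W K io _ _ Xu.
rewrite (unit_intervalE _ _ Hx).
apply: imp_iff; apply: (all_epsE W K io) => s e Hs.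
split=> -[N [N0 H]]; exists N.
  move/lt0E: N0 => N0; split=> // q Hq n i j Ni Nj.
  have iN := denotes_inv W K io _ N0; have rq := israt_rat_code W K io q.
  apply/(ltQ _ _ _ _ (den_abs _ _ (den_sub _ _ _ _ (represents_rat_code _ _ q i (Hf n)) (represents_rat_code _ _ q j (Hf n)))) Hs).
  by apply: H => //; [apply/(ballE _ _ _ _ _ Hx iN rq); rewrite rat_codeK|exact/leE|exact/leE].
have iN := denotes_inv W K io _ N0; split; first exact/lt0E.
move=> q rq /(ballE _ _ _ _ _ Hx iN rq) Bq n i j /leE Ni /leE Nj.
apply/(ltQ _ _ _ _ (den_abs _ _ (den_sub _ _ _ _ (Hf n q i rq) (Hf n q j rq))) Hs).
exact: H.
Qed.

Definition family_bounded (f : M -> K -> M -> K) B : Prop := forall n u, isreal u -> I01 u ->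
  Rle (cst (- io B)) (fun i => f n (u i) i) /\ Rle (fun i => f n (u i) i) (cst (io B)).

Lemma maps_toE phi f B : (forall n, represents (phi n) (f n)) ->
  ((forall n, Sem.maps_to W unit_interval (Sem.interval W (Sem.rat_opp W (Sem.rat_of_nat W B))
     (Sem.rat_of_nat W B)) (phi n)) <-> family_bounded f B).
Proof.
move=> Hf.
have E n : Sem.maps_to W unit_interval (Sem.interval W (Sem.rat_opp W (Sem.rat_of_nat W B))
     (Sem.rat_of_nat W B)) (phi n) <-> forall u, isreal u -> I01 u ->
       Rle (cst (- io B)) (fun i => f n (u i) i) /\ Rle (fun i => f n (u i) i) (cst (io B)).
  apply: all_realE => X u Xu _; have Hx := Denotes_set W K io _ _ Xu.
  rewrite (unit_intervalE _ _ Hx).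
  have dB := denotes_nat W K io B.
  by rewrite (intervalE _ _ _ _ _ _ (denotes_opp W K io _ _ dB) dB (Denotes_value _ _ _ _ (Hf n) Xu)).
exact: forall_iff.
Qed.

Definition family_equicontinuous (f : M -> K -> M -> K) : Prop := forall e : K, 0 < e ->
  exists d : K, 0 < d /\ forall n u, isreal u -> forall v, isreal v -> I01 u -> I01 v ->
    Rlt (dist u v) (cst d) ->
    Rlt (dist (fun i => f n (u i) i) (fun i => f n (v i) i)) (cst e).

Lemma equicontinuousE phi f : (forall n, represents (phi n) (f n)) ->
  (Sem.uniformly_equicontinuous W unit_interval phi <-> family_equicontinuous f).
Proof.
move=> Hf; apply: (all_epsE W K io) => s e Hs; apply: (ex_epsE W K io) => t d Ht.
apply: forall_iff => n; apply: all_realE => X u Xu _; apply: all_realE => Y v Yv _.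
have Hx := Denotes_set W K io _ _ Xu; have Hy := Denotes_set W K io _ _ Yv.
rewrite (unit_intervalE _ _ Hx) (unit_intervalE _ _ Hy).
rewrite (real_ltE W K io _ _ _ _ (Denotes_dist W K io _ _ _ _ Hx Hy) (Denotes_cst W K io _ _ Ht)).
have Vx := Denotes_value _ _ _ _ (Hf n) Xu; have Vy := Denotes_value _ _ _ _ (Hf n) Yv.
by rewrite (real_ltE W K io _ _ _ _ (Denotes_dist W K io _ _ _ _ Vx Vy) (Denotes_cst W K io _ _ Hs)).
Qed.

Definition family_converges (f : M -> K -> M -> K) (h : K -> M -> K) : Prop := forall e : K, 0 < e ->
  exists N, forall u, isreal u -> I01 u -> forall n, io N <= io n ->
    Rlt (dist (fun i => f n (u i) i) (fun i => h (u i) i)) (cst e).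

Lemma convergesE phi psi f h : (forall n, represents (phi n) (f n)) -> represents psi h ->
  (Sem.converges_uniformly W unit_interval phi psi <-> family_converges f h).
Proof.
move=> Hf Hh; apply: (all_epsE W K io) => s e Hs; apply: exists_iff => N.
apply: all_realE => X u Xu _; have Hx := Denotes_set W K io _ _ Xu.
rewrite (unit_intervalE _ _ Hx); apply: imp_iff; apply: forall_iff => n.
rewrite leE; apply: imp_iff.
apply: real_ltE; last exact: Denotes_cst.
by apply: Denotes_dist; apply: Denotes_value.
Qed.

Definition family_definable (f : M -> K -> M -> K) : Prop :=
  Delta1rat (fun e => f (e 0) (rat_val (e 1)) (e 2)).
Definition repr_definable (h : K -> M -> K) : Prop := Delta1rat (fun e => h (rat_val (e 0)) (e 1)).

Lemma family_of_setE F : Sem.is_repr_family W F -> exists f, family_definable f /\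
  forall n, represents (Sem.family_of_set W F n) (f n).
Proof.
move=> /function_of_set[h Hh]; exists (fun n q i => rat_val (h (mpair n (mpair (rat_code q) i)))).
have Hd n q i : israt W q -> exists n' q' i', mpair n (mpair q i) = mpair n' (mpair q' i') /\ Sem.is_rat W q'.
  by move=> rq; exists n, q, i.
split.
  apply: (Sigma1_ext _ (fun e => elem (mpair (mpair (e 1) (mpair (rat_code (rat_val (e 2))) (e 3))) (e 0)) F)).
    move=> e; have [rh ->] := Hh _ (Hd (e 1) _ (e 3) (israt_rat_code W K io (rat_val (e 2)))).
    by rewrite rat_valK.
  suff [] : Delta1 W (fun e => elem (mpair (mpair (e 1) (mpair (rat_code (rat_val (e 2))) (e 3))) (e 0)) F) by [].
  by apply: Delta1_elem; fd.
move=> n q i rq; have [rh hE] := Hh _ (Hd n q i rq); rewrite rat_valK //.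
have [x [E x0 Hx]] := denotes_code W K io _ rh; exists x; split=> // k.
rewrite -Hx /Sem.family_of_set /Sem.bind /Sem.app.
by split=> [[b [/hE->]]|Hk] //; exists (h (mpair n (mpair q i))); split=> //; apply/hE.
Qed.

Lemma set_of_family f : family_definable f -> exists F, Sem.is_repr_family W F /\
  forall n, represents (Sem.family_of_set W F n) (f n).
Proof.
move=> Hf.
have [|||F [HF FE]] := function_set (fun a => exists n q i, a = mpair n (mpair q i) /\ Sem.is_rat W q)
  (Sem.is_rat W) (fun a => rat_code (f (unpair1 a) (rat_val (unpair1 (unpair2 a))) (unpair2 (unpair2 a)))).
- apply: (Delta1_ext _ (fun e => e 0 = mpair (unpair1 (e 0)) (mpair (unpair1 (unpair2 (e 0))) (unpair2 (unpair2 (e 0)))) /\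
      israt W (unpair1 (unpair2 (e 0))))).
    move=> e; split=> [[n [q [i [-> rq]]]]|[E rq]]; first by rewrite !(p1E, p2E).
    by exists (unpair1 (e 0)), (unpair1 (unpair2 (e 0))), (unpair2 (unpair2 (e 0))).
  by apply: Delta1_and; [apply: Delta1_eq; fd|apply: Delta1_israt; fd].
- apply: (Delta1fun_app3 W (fun n q i => rat_code (f n (rat_val q) i))); fd; exact: Hf.
- by move=> a _; apply: israt_rat_code.
exists F; split=> // n q i rq.
have [x [E x0 Hx]] := denotes_rat_code W K io (f n (rat_val q) i); exists x; split=> // k.
rewrite -Hx /Sem.family_of_set /Sem.bind /Sem.app.
split=> [[b [/FE[_ ->]]]|Hk]; first by rewrite !(p1E, p2E).
exists (rat_code (f n (rat_val q) i)); split=> //; apply/FE.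
by rewrite !(p1E, p2E); split=> //; exists n, q, i.
Qed.

Lemma repr_of_setE H : Sem.is_repr W H -> exists h, repr_definable h /\
  represents (Sem.repr_of_set W H) h.
Proof.
move=> /function_of_set[g Hg]; exists (fun q i => rat_val (g (mpair (rat_code q) i))).
have Hd q i : israt W q -> exists q' i', mpair q i = mpair q' i' /\ Sem.is_rat W q'.
  by move=> rq; exists q, i.
split.
  apply: (Sigma1_ext _ (fun e => elem (mpair (mpair (rat_code (rat_val (e 1))) (e 2)) (e 0)) H)).
    move=> e; have [rh ->] := Hg _ (Hd _ (e 2) (israt_rat_code W K io (rat_val (e 1)))).
    by rewrite rat_valK.
  suff [] : Delta1 W (fun e => elem (mpair (mpair (rat_code (rat_val (e 1))) (e 2)) (e 0)) H) by [].
  by apply: Delta1_elem; fd.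
move=> q i rq; have [rh hE] := Hg _ (Hd q i rq); rewrite rat_valK //.
have [x [E x0 Hx]] := denotes_code W K io _ rh; exists x; split=> // k.
rewrite -Hx /Sem.repr_of_set /Sem.bind /Sem.app.
by split=> [[b [/hE->]]|Hk] //; exists (g (mpair q i)); split=> //; apply/hE.
Qed.

Lemma set_of_repr h : repr_definable h -> exists H, Sem.is_repr W H /\
  represents (Sem.repr_of_set W H) h.
Proof.
move=> Hh.
have [|||H [HH HE]] := function_set (fun a => exists q i, a = mpair q i /\ Sem.is_rat W q)
  (Sem.is_rat W) (fun a => rat_code (h (rat_val (unpair1 a)) (unpair2 a))).
- apply: (Delta1_ext _ (fun e => e 0 = mpair (unpair1 (e 0)) (unpair2 (e 0)) /\ israt W (unpair1 (e 0)))).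
    move=> e; split=> [[q [i [-> rq]]]|[E rq]]; first by rewrite !(p1E, p2E).
    by exists (unpair1 (e 0)), (unpair2 (e 0)).
  by apply: Delta1_and; [apply: Delta1_eq; fd|apply: Delta1_israt; fd].
- apply: (Delta1fun_app2 W (fun q i => rat_code (h (rat_val q) i))); fd; exact: Hh.
- by move=> a _; apply: israt_rat_code.
exists H; split=> // q i rq.
have [x [E x0 Hx]] := denotes_rat_code W K io (h (rat_val q) i); exists x; split=> // k.
rewrite -Hx /Sem.repr_of_set /Sem.bind /Sem.app.
split=> [[b [/HE[_ ->]]]|Hk]; first by rewrite !(p1E, p2E).
exists (rat_code (h (rat_val q) i)); split=> //; apply/HE.
by rewrite !(p1E, p2E); split=> //; exists q, i.
Qed.

Definition increasing (g : M -> M) : Prop :=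
  Delta1fun W (fun e => g (e 0)) /\ forall i j, i <! j -> g i <! g j.

Lemma represents_subsequence phi f G (g : M -> M) : (forall n, represents (phi n) (f n)) ->
  (forall a b, elem (mpair a b) G <-> b = g a) ->
  forall n, represents (Sem.subsequence W phi G n) (f (g n)).
Proof.
move=> Hf GE n q i rq; have [x [E x0 Hx]] := Hf (g n) q i rq; exists x; split=> // k.
rewrite -Hx /Sem.subsequence /Sem.bind /Sem.app.
by split=> [[b [/GE->]]|Hk] //; exists (g n); split=> //; apply/GE.
Qed.

Lemma increasing_of_set G : Sem.strictly_increasing W G ->
  exists g, increasing g /\ forall a b, elem (mpair a b) G <-> b = g a.
Proof.
move=> [/function_of_set[g Hg] HG].
have GE a b : elem (mpair a b) G <-> b = g a by case: (Hg a) => // _; apply.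
exists g; split=> //; split.
  apply: (Sigma1_ext _ (fun e => elem (mpair (e 1) (e 0)) G)); first by move=> e; rewrite GE.
  by suff [] : Delta1 W (fun e => elem (mpair (e 1) (e 0)) G) by []; apply: Delta1_elem; fd.
by move=> i j /HG[a [/GE-> [b [/GE->]]]].
Qed.

Lemma set_of_increasing g : increasing g ->
  exists G, Sem.strictly_increasing W G /\ forall a b, elem (mpair a b) G <-> b = g a.
Proof.
move=> [Dg Ig]; have [||G [HG GE]] := function_set (fun _ => Sem.top) (fun _ => Sem.top) g _ Dg.
- by apply: Delta1_Delta0; apply: Delta0_imp; apply: Delta0_false.
- by [].
have {}GE a b : elem (mpair a b) G <-> b = g a by rewrite GE; intuition.
exists G; split=> //; split=> // i j /Ig H; exists (g i); split; first exact/GE.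
by exists (g j); split; first exact/GE.
Qed.

Definition ArzelaAscoliK : Prop := forall f, family_definable f -> family_continuous f ->
  forall B, family_bounded f B -> family_equicontinuous f ->
  exists g, increasing g /\ exists h, repr_definable h /\
    ((forall u, isreal u -> I01 u -> Dom h u) /\ family_converges (fun n => f (g n)) h).

Theorem ArzelaAscoliE : Sem.ArzelaAscoli W <-> ArzelaAscoliK.
Proof.
split=> AA.
  move=> f Df Cf B Bf Ef; have [F [HF Ff]] := set_of_family _ Df.
  have sF := iffRL (sequence_of_functionsE _ _ Ff) Cf.
  have [G [SG [H [RH [CH UH]]]]] := AA F HF sF B (iffRL (maps_toE _ _ B Ff) Bf)
    (iffRL (equicontinuousE _ _ Ff) Ef).
  have [g [Ig GE]] := increasing_of_set _ SG; have [h [Dh Hh]] := repr_of_setE _ RH.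
  exists g; split=> //; exists h; split=> //; split; first exact/(continuousE _ _ Hh).
  exact/(convergesE _ _ _ _ (represents_subsequence _ _ _ _ Ff GE) Hh).
rewrite /Sem.ArzelaAscoli /= => F /family_of_setE[f [Df Ff]].
move=> /(sequence_of_functionsE _ _ Ff) Cf B /(maps_toE _ _ _ Ff) Bf /(equicontinuousE _ _ Ff) Ef.
have [g [Ig [h [Dh [Ch Uh]]]]] := AA f Df Cf B Bf Ef.
have [G [SG GE]] := set_of_increasing _ Ig; have [H [RH Hh]] := set_of_repr _ Dh.
exists G; split=> //; exists H; split=> //; split; first exact/(continuousE _ _ Hh).
exact/(convergesE _ _ _ _ (represents_subsequence _ _ _ _ Ff GE) Hh).
Qed.

Definition finite_below (P : M -> Prop) : Prop := exists n, forall m, P m -> m <! n.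

Definition IPPK : Prop := forall N (c : M -> M), Delta1fun W (fun e => c (e 0)) ->
  (forall i, io (c i) <= io N) -> exists n, ~ finite_below (fun i => c i = n).

Theorem IPPE : Sem.IPP W <-> IPPK.
Proof.
split=> H N.
  move=> c Dc cN; have [||C [HC CE]] := function_set (fun _ => Sem.top) (fun n => Sem.le W n N) c _ Dc.
  - by apply: Delta1_Delta0; apply: Delta0_imp; apply: Delta0_false.
  - by move=> a _; apply/leE.
  have [n [_ Hn]] := H N C HC; exists n => -[k Hk]; apply: Hn; exists k => m [b [/CE[_ ->] cn]].
  exact: Hk.
move=> C /function_of_set[c Hc].
have CE a b : elem (mpair a b) C <-> b = c a by case: (Hc a) => // _; apply.
have [||n Hn] := H N c.
- apply: (Sigma1_ext _ (fun e => elem (mpair (e 1) (e 0)) C)); first by move=> e; rewrite CE.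
  by suff [] : Delta1 W (fun e => elem (mpair (e 1) (e 0)) C) by []; apply: Delta1_elem; fd.
- by move=> i; apply/leE; case: (Hc i).
(* [IPPK] does not bound the colour; a colour used infinitely often is used at all, hence at most
   [N]. *)
have [[i cin]|no] := EM (exists i, c i = n); last first.
  by case: Hn; exists 0 => m cm; case: no; exists m.
exists n; split; first by rewrite -cin; case: (Hc i).
move=> [k Hk]; apply: Hn; exists k => m cm; apply: Hk; exists (c m); split=> //.
exact/CE.
Qed.

End Translation.

(** * The Arzela-Ascoli theorem in a model *)

Section Analysis.
Variable W : second_order_model.
Notation M := (num W).
Variables (K : realFieldType) (io : field_embedding W K).
Let ioD := embed_add _ _ io.
Let ioM := embed_mul _ _ io.
Let io1 := embed_1 _ _ io.
Let io_lt := embed_lt _ _ io.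
Let io_ge0 := embed_ge0 _ _ io.
Let io0 := io0 W K io.
Let io_le_succ := io_le_succ W K io.
Notation unpair1 := (unpair1 W K io).
Notation unpair2 := (unpair2 W K io).
Let p1E := unpair1_mpair W K io.
Let p2E := unpair2_mpair W K io.
Let Delta1fun_unpair1 := Delta1fun_unpair1 W K io.
Let Delta1fun_unpair2 := Delta1fun_unpair2 W K io.
Notation rat_code := (rat_code W K io).
Notation rat_val := (rat_val W K io).
Notation Delta1rat := (Delta1rat W K io).
Let rat_codeK := rat_codeK W K io.
Notation isreal := (isreal W K io).
Notation eventually := (eventually W K io).
Notation Rlt := (Rlt W K io).
Notation cst := (cst W K).
Notation dist := (dist W K).
Notation I01 := (I01 W K io).
Notation Dom := (Dom W K io).
Let Delta1fun_rat_val : forall f, Delta1fun W f -> Delta1fun W (fun e => rat_code (rat_val (f e))) := Delta1rat_rat_val W K io.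
Let Delta1rat_rat_val := Delta1rat_rat_val W K io.
Let Delta1rat_const := Delta1rat_const W K io.
Let Delta1rat_embed := Delta1rat_embed W K io.
Let Delta1rat_add := Delta1rat_add W K io.
Let Delta1rat_mul := Delta1rat_mul W K io.
Let Delta1rat_opp := Delta1rat_opp W K io.
Let Delta1rat_abs := Delta1rat_abs W K io.
Let Delta1rat_if := Delta1rat_if W K io.
Let Delta1_ltK := Delta1_ltK W K io.
Let Delta1_leK := Delta1_leK W K io.

Ltac fd := repeat first
  [ apply: Delta1fun_rat_val | apply: Delta1fun_var | apply: Delta1fun_const | apply: Delta1fun_unpair1 | apply: Delta1fun_unpair2
  | apply: Delta1fun_mpair | apply: Delta1fun_add | apply: Delta1fun_mul | apply: Delta1fun_shift
  | apply: Delta1rat_const | apply: Delta1rat_add | apply: Delta1rat_mul | apply: Delta1rat_opp | apply: Delta1rat_abs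
  | apply: Delta1rat_rat_val | apply: Delta1rat_embed ].

(** * Eventual inequalities and constant functions *)

Section Limits.
Implicit Types (a b c d m n i j : M) (k l : K) (u v : M -> K).

Lemma eventually_and (P Q : M -> Prop) :
  eventually P -> eventually Q -> eventually (fun n => P n /\ Q n).
Proof.
move=> [N1 H1] [N2 H2]; exists (N1 + N2) => n; rewrite ioD => Hn.
have := io_ge0 N1; have := io_ge0 N2 => h1 h2.
by split; [apply: H1|apply: H2]; lra.
Qed.

Lemma eventually_mono (P Q : M -> Prop) :
  (forall n, P n -> Q n) -> eventually P -> eventually Q.
Proof. by move=> H [N HN]; exists N => n /HN/H. Qed.

Lemma eventually_ge N : eventually (fun n => io N <= io n).
Proof. by exists N. Qed.

Lemma eventually_ex (P : M -> Prop) : eventually P -> exists n, P n.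
Proof. by move=> [N H]; exists N; apply: H. Qed.

(** A fixed gap [e] is asked for because termwise strict inequality would still allow convergence to
    [c]. *)
Lemma Rlt_intro u (c e : K) : 0 < e -> eventually (fun n => u n <= c - e) -> Rlt u (cst c).
Proof.
move=> e0 [N H]; split.
  by move=> d d0; exists N => n /H; rewrite /cst; lra.
move=> /(_ (e / 2))[|N' H']; first by lra.
have h := io_ge0 N; have h' := io_ge0 N'.
have := H (N + N'); have := H' (N + N'); rewrite ioD /cst => H1 H2.
have {}H1 := H1 ltac:(lra); have {}H2 := H2 ltac:(lra).
by lra.
Qed.

Lemma Rlt_elim u (c e : K) : Rlt u (cst c) -> 0 < e -> eventually (fun n => u n <= c + e).
Proof. by move=> [H _] /H. Qed.

Lemma isreal_cst k : isreal (cst k).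
Proof.
split; last exact: Delta1rat_const.
by move=> e e0; exists 0 => m n _ _; rewrite /cst subrr normr0.
Qed.

Lemma I01_cst k : 0 <= k <= 1 -> I01 (cst k).
Proof. by move=> /andP[k0 k1]; split=> e e0; exists 0 => n _; rewrite /cst; lra. Qed.

Lemma increasing_ge (g : M -> M) : increasing W g -> forall n, io n <= io (g n).
Proof.
move=> [Dg Ig] n; apply/(lt_succ_le W K io); move: n; apply: induction1.
- suff [] : Delta1 W (fun e => e 0 <! g (e 0) + 1) by [].
  by apply: Delta1_lt; fd.
- by apply/(lt_succ_le W K io); rewrite io0.
- move=> n; rewrite !(lt_succ_le W K io) ioD io1 => H.
  have : n <! n + 1 by apply/numlt_succ; right.
  by move=> /Ig/io_le_succ; lra.
Qed.

(** Arzela-Ascoli for constant functions. *)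
Definition BolzanoWeierstrass : Prop := forall (x : M -> K) B, Delta1rat (fun e => x (e 0)) ->
  (forall n, `|x n| <= io B) -> exists g, increasing W g /\
  forall e : K, 0 < e -> exists N, forall m n, io N <= io m -> io N <= io n ->
    `|x (g m) - x (g n)| < e.

Lemma ArzelaAscoli_BolzanoWeierstrass : ArzelaAscoliK W K io -> BolzanoWeierstrass.
Proof.
move=> AA x B Dx xB.
have zero (e : K) : 0 < e -> forall y : K, `|y - y| < e by move=> e0 y; rewrite subrr normr0.
have [||||g [Ig [h [Dh [_ UC]]]]] := AA (fun n _ _ => x n) _ _ B.
- by apply: (Delta1fun_app1 _ (fun n => rat_code (x n))) => //; fd.
- split=> [n u _ _ e e0|u _ _ e e0].
    by exists 1; split; [rewrite io1|move=> *; apply: zero].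
  by exists 1; split; [rewrite io1|move=> *; apply: zero].
- move=> n u _ _; have := xB n; rewrite ler_norml => /andP[h1 h2].
  by split=> e e0; exists 0 => i _; rewrite /cst; lra.
- move=> e e0; exists 1; split; first exact: ltr01.
  move=> n u _ v _ _ _ _; apply: (Rlt_intro _ e (e / 2)); first by lra.
  by exists 0 => i _; rewrite /dist subrr normr0; lra.
exists g; split=> // e e0; have [|N HN] := UC (e / 4).
  by lra.
exists N => m n Nm Nn.
have I0 : I01 (cst 0) by apply: I01_cst; rewrite lexx ler01.
have Hm := HN _ (isreal_cst 0) I0 m Nm; have Hn := HN _ (isreal_cst 0) I0 n Nn.
(* At a common index both distances to the limit are at most [e / 4 + e / 8], so together they stay
   below [e]. *)
have e8 : 0 < e / 8 by lra.
have [i []] := eventually_ex _ (eventually_and _ _ (Rlt_elim _ _ _ Hm e8) (Rlt_elim _ _ _ Hn e8)).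
by rewrite /dist !ler_norml ltr_norml; lra.
Qed.

Lemma BolzanoWeierstrass_IPP : BolzanoWeierstrass -> IPPK W K io.
Proof.
move=> BW N c Dc cN.
have [||g [Ig Hg]] := BW (fun n => io (c n)) N.
- exact: Delta1rat_embed.
- by move=> n; rewrite ger0_norm.
(* Distinct numbers have distance at least 1 even in a nonstandard model, so this tolerance already
   forces equal colours. *)
have [|N0 H] := Hg 1; first exact: ltr01.
exists (c (g N0)) => -[n Hn].
have h1 := io_ge0 N0; have h2 := io_ge0 n.
have /Hn/io_lt : c (g (N0 + n)) = c (g N0).
  have {H} := H (N0 + n) N0; rewrite ioD lexx => H.
  have {}H := H ltac:(lra) isT.
  case: (numlt_total _ (c (g (N0 + n))) (c (g N0))) => [/io_le_succ ?|//|/io_le_succ ?]; exfalso;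
    move: H; rewrite ltr_norml; lra.
have := increasing_ge _ Ig (N0 + n); rewrite ioD; lra.
Qed.

End Limits.

(** * Cohesive sets from expansions in base 3 *)

Section CohesiveSets.
Implicit Types (a b c d m n i j k p q : M) (u v : M -> K).

(** In base 3 all weights after position [j] add up to at most half of [w j]. In base 2 they would
    approach [w j], and a differing digit could not be recognized from an approximation. *)
Lemma geometric_weights_ex : exists w : M -> K,
  [/\ forall f, Delta1fun W f -> Delta1rat (fun e => w (f e)), w 0 = 1, forall i, 0 < w i,
      forall i, w (i + 1) = w i / 3 & forall i j, io i <= io j -> w j <= w i].
Proof.
have [|h [Dh Hh]] := primitive_recursion W K io (rat_code 1) (fun _ _ (v : M) => rat_code (rat_val v * 3^-1)).
  by change (Delta1rat (fun e => rat_val (e 2) * 3^-1)); fd.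
pose w i := rat_val (h 0 i).
have w0 : w 0 = 1 by rewrite /w (Hh 0).1 rat_codeK.
have wS i : w (i + 1) = w i / 3 by rewrite /w (Hh 0).2 rat_codeK.
have Dw f : Delta1fun W f -> Delta1rat (fun e => w (f e)).
  by move=> Df; apply: Delta1rat_rat_val; apply: (Delta1fun_app2 _ h); fd.
have wpos : forall i, 0 < w i.
  apply: induction1.
  - by suff [] : Delta1 W (fun e => 0 < w (e 0)) by []; apply: Delta1_ltK; [fd|apply: Dw; fd].
  - by rewrite w0 ltr01.
  - by move=> i; rewrite wS; lra.
exists w; split=> // i j ij.
have [->//|[c ->]|[c E]] := num_difference _ i j; last first.
  by move: ij; rewrite E !ioD io1; have := io_ge0 c; lra.
move: c; apply: induction1.
- suff [] : Delta1 W (fun e => w (i + (e 0 + 1)) <= w i) by [].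
  by apply: Delta1_leK; apply: Dw; fd.
- by rewrite add0r wS; have := wpos i; lra.
- by move=> c IH; rewrite addrA wS; have := wpos (i + (c + 1)); lra.
Qed.

Section Expansion.
Variables (w : M -> K) (R : sets W).
Hypothesis Dw : forall f, Delta1fun W f -> Delta1rat (fun e => w (f e)).
Hypothesis w0 : w 0 = 1.
Hypothesis wpos : forall i, 0 < w i.
Hypothesis wS : forall i, w (i + 1) = w i / 3.
Hypothesis w_anti : forall i j, io i <= io j -> w j <= w i.

Definition digit p j : K := if `[< elem (mpair j p) R >] then w j else 0.

Lemma expansion_ex : exists s : M -> M -> K,
  [/\ forall f g, Delta1fun W f -> Delta1fun W g -> Delta1rat (fun e => s (f e) (g e)),
      forall p, s p 0 = 0 & forall p (k : M), s p (k + 1) = s p k + digit p k].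
Proof.
have [|h [Dh Hh]] := primitive_recursion W K io (rat_code 0) (fun p j (v : M) => rat_code (rat_val v + digit p j)).
  change (Delta1rat (fun e => rat_val (e 2) + digit (e 0) (e 1))); fd.
  by apply: Delta1rat_if; [apply: Delta1_elem; fd|apply: Dw; fd|fd].
exists (fun p k => rat_val (h p k)); split.
- by move=> f g Df Dg; apply: Delta1rat_rat_val; apply: (Delta1fun_app2 _ h).
- by move=> p; rewrite (Hh p).1 rat_codeK.
- by move=> p k; rewrite (Hh p).2 rat_codeK.
Qed.

Variable s : M -> M -> K.
Hypothesis Ds : forall f g, Delta1fun W f -> Delta1fun W g -> Delta1rat (fun e => s (f e) (g e)).
Hypothesis s0 : forall p, s p 0 = 0.
Hypothesis sS : forall p (k : M), s p (k + 1) = s p k + digit p k.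

Lemma digit_bounds p j : 0 <= digit p j <= w j.
Proof. by rewrite /digit; case: asboolP => _; have := wpos j; lra. Qed.

(** The sum of all weights from position [k] on is [3 / 2] times [w k]; adding it to a partial sum
    gives an upper bound that decreases with [k]. *)
Lemma expansion_tail p j (k : M) : io j <= io k ->
  s p j <= s p k /\ s p k + w k * (3 / 2) <= s p j + w j * (3 / 2).
Proof.
move=> jk; have [->//|[c ->]|[c E]] := num_difference _ j k; last first.
  by move: jk; rewrite E !ioD io1; have := io_ge0 c; lra.
suff H : forall t, s p j <= s p (j + t) /\ s p (j + t) + w (j + t) * (3 / 2) <= s p j + w j * (3 / 2) by [].
apply: induction1.
- suff [] : Delta1 W (fun e => s p j <= s p (j + e 0) /\
    s p (j + e 0) + w (j + e 0) * (3 / 2) <= s p j + w j * (3 / 2)) by [].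
  apply: Delta1_and; apply: Delta1_leK; fd; first by apply: Ds; fd.
    by apply: Ds; fd.
  by apply: Dw; fd.
- by rewrite addr0.
- move=> t; rewrite addrA sS wS; have := digit_bounds p (j + t); lra.
Qed.

Lemma expansion_bound p (k : M) : 0 <= s p k <= 3 / 2.
Proof.
have [] := expansion_tail p 0 k; first by rewrite io0.
by rewrite s0 w0; have := wpos k; lra.
Qed.

(** The distance is decided at the first position where the two expansions differ. *)
Lemma expansion_agree i p q : io i + 1 <= io p -> io i + 1 <= io q ->
  `|s p p - s q q| < w i / 2 -> (elem (mpair i p) R <-> elem (mpair i q) R).
Proof.
move=> ip iq pq; apply: contrapT => dis.
have [||j [Hj jmin]] := @least_number W (fun j => ~ (elem (mpair j p) R <-> elem (mpair j q) R)).
- by apply: Delta1_not; apply: Delta1_iff; apply: Delta1_elem; fd.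
- by exists i.
have ji : io j <= io i by rewrite leNgt; apply/negP => /io_lt/jmin.
have E : forall k : M, k <! j + 1 -> s p k = s q k.
  have H : forall k : M, k <! j + 1 -> rat_code (s p k) = rat_code (s q k).
    apply: induction1.
    - suff [] : Delta1 W (fun e => e 0 <! j + 1 -> rat_code (s p (e 0)) = rat_code (s q (e 0))) by [].
      have Ds1 r : Delta1rat (fun e => s r (e 0)) by apply: Ds; fd.
      by apply: Delta1_imp; [apply: Delta1_lt; fd|apply: Delta1_eq; apply: Ds1].
    - by rewrite !s0.
    - move=> k IH kj; have kj' : k <! j.
        by apply/io_lt; move/io_le_succ: kj; rewrite !ioD io1; lra.
      have /IH/(congr1 rat_val) : k <! j + 1 by apply/numlt_succ; left.
      rewrite !rat_codeK !sS => ->; congr (rat_code (_ + _)).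
      rewrite /digit; have := jmin _ kj'.
      by case: asboolP => h1; case: asboolP => h2 //; tauto.
  by move=> k /H/(congr1 rat_val); rewrite !rat_codeK.
have {}E := E j ltac:(by apply/numlt_succ; right).
have wij := w_anti _ _ ji.
have jp : io (j + 1) <= io p by rewrite ioD io1; lra.
have jq : io (j + 1) <= io q by rewrite ioD io1; lra.
have [p1' p2'] := expansion_tail p _ _ jp; have [q1' q2'] := expansion_tail q _ _ jq.
(* At position [j] exactly one of the sums gains [w j], while the other gains less than [w j / 2] in
   all later positions. So they differ by more than [w j / 2], which is at least [w i / 2]. *)
move: pq p1' p2' q1' q2' Hj; rewrite !sS !wS E /digit ltr_norml.
have := wpos p; have := wpos q; have := wpos j.
case: asboolP => h1; case: asboolP => h2 wj wq wp pq p1' p2' q1' q2' Hj; try tauto; lra.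
Qed.

End Expansion.

Lemma BolzanoWeierstrass_COH : BolzanoWeierstrass -> Sem.COH W.
Proof.
move=> BW R.
have [w [Dw w0 wpos wS wanti]] := geometric_weights_ex.
have [s [Ds s0 sS]] := expansion_ex w R Dw.
have [||g [Ig Hg]] := BW (fun n => s n n) (1 + 1).
- by apply: Ds; fd.
- move=> n; have := expansion_bound w R Dw w0 wpos wS s Ds s0 sS n n.
  by rewrite ioD io1 ler_norml; lra.
have Dg := Ig.1.
(* The range of [g] is Delta1 because [i <= g i] allows the index to be bounded by the value. *)
have [|C HC] := @comprehension1 W (fun y => exists i, i <! y + 1 /\ y = g i).
  have [F HF] := function_set_ex W K io g Dg.
  apply: (Delta1_ext _ (fun e => exists i, i <! e 0 + 1 /\ elem (mpair i (e 0)) F)).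
    by move=> e; split=> -[i [h1 h2]]; exists i; split=> //; apply/HF.
  apply: Delta1_Delta0; apply: Delta0_ex; first by apply: TermFun_add; [apply: TermFun_var|apply: TermFun_const].
  by apply: Delta0_elem; apply: TermFun_mpair; apply: TermFun_var.
have gC n : elem (g n) C.
  by apply/HC; exists n; split=> //; apply/(lt_succ_le W K io); apply: increasing_ge.
exists C; split.
  move=> [n /(_ _ (gC n))/io_lt]; have := increasing_ge _ Ig n; lra.
move=> i; have [|N HN] := Hg (w i / 2); first by have := wpos i; lra.
(* The summand [N] puts the terms in the Cauchy range, and [i + 1] ensures that their expansions
   reach beyond digit [i]. *)
pose n1 := N + i + 1.
have n1N : io N <= io n1 by rewrite !ioD io1; have := io_ge0 i; lra.
have agree y : elem y C -> ~ y <! g n1 -> (elem (mpair i y) R <-> elem (mpair i (g n1)) R).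
  move=> /HC[n [_ ->]] nlt.
  have nn : io n1 <= io n by rewrite leNgt; apply/negP => /io_lt/Ig.2.
  apply: (expansion_agree w R Dw wpos wS wanti s Ds s0 sS).
  - by have := increasing_ge _ Ig n; move: nn; rewrite !ioD io1; have := io_ge0 N; lra.
  - by have := increasing_ge _ Ig n1; rewrite !ioD io1; have := io_ge0 N; lra.
  - by apply: HN => //; lra.
have [yes|no] := EM (elem (mpair i (g n1)) R).
  left; exists (g n1) => m [mC mR]; apply: contrapT => h.
  by apply: mR; apply/(agree _ mC h).
right; exists (g n1) => m [mC mR]; apply: contrapT => h.
by apply: mR => /(agree _ mC h).
Qed.

End CohesiveSets.

(** * Collection, enumeration of a set and retraction to the unit interval *)

Section Forward.
Implicit Types (m n i j k z : M) (u v : M -> K).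
Notation family_definable := (family_definable W K io).
Notation family_continuous := (family_continuous W K io).
Notation family_bounded := (family_bounded W K io).
Notation family_equicontinuous := (family_equicontinuous W K io).

Lemma Delta1_app3 (R : M -> M -> M -> Prop) f g h :
  Delta1 W (fun e => R (e 0) (e 1) (e 2)) -> Delta1fun W f -> Delta1fun W g -> Delta1fun W h ->
  Delta1 W (fun e => R (f e) (g e) (h e)).
Proof.
move=> HR Hf Hg Hh; apply: (Delta1_comp _ (fun e x => R x (g e) (h e))) Hf.
apply: (Delta1_comp W (fun e y => R (e 0) y (h (fun i : nat => e i.+1))) (fun e => g (fun i : nat => e i.+1))); last exact: Delta1fun_shift.
apply: (Delta1_comp W (fun e y => R (e 1) (e 0) y) (fun e => h (fun i : nat => e i.+2))); last exact: Delta1fun_shift2.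
by apply: (Delta1_ren W _ (fun i : nat => if i is 0 then 2%N else if i is 1 then 1%N else 0%N) HR).
Qed.

(** Collection for Pi-0-1 formulas. *)
Lemma uniform_bound (psi : M -> M -> M -> Prop) n : IPPK W K io ->
  Delta1 W (fun e => psi (e 0) (e 1) (e 2)) ->
  (forall j k k' z, io k <= io k' -> psi j k z -> psi j k' z) ->
  (forall j, j <! n -> exists k, forall z, psi j k z) ->
  exists k, forall j, j <! n -> forall z, psi j k z.
Proof.
move=> ipp Dpsi mono H; apply: contrapT => no.
(* If no [k] works for all [j], each [k] has a counterexample [(j, z)], found by search. Colouring
   [k] by this [j], some colour recurs for unboundedly many [k], and by monotonicity it then fails
   for every [k]. *)
have ex k : exists y, unpair1 y <! n /\ ~ psi (unpair1 y) k (unpair2 y).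
  apply: contrapT => no'; apply: no; exists k => j jn z; apply: contrapT => npsi.
  by apply: no'; exists (mpair j z); rewrite !(p1E, p2E).
have [|y [Dy Hy]] := search_ex W K io (fun k y => unpair1 y <! n /\ ~ psi (unpair1 y) k (unpair2 y)) _ ex.
  apply: Delta1_and; first by apply: Delta1_lt; fd.
  by apply: Delta1_not; apply: Delta1_app3 => //; fd.
have [||j inf] := ipp n (fun k => unpair1 (y k)).
- by apply: Delta1fun_unpair1.
- by move=> k; have [/io_lt/ltW] := Hy k.
have [[k0 k0j]|nk] := EM (exists k, unpair1 (y k) = j); last first.
  by apply: inf; exists 0 => m Hm; case: nk; exists m.
have [|k Hk] := H j; first by rewrite -k0j; case: (Hy k0).
apply: inf; exists k => m Hm; apply: contrapT => mk.
have [_ nm] := Hy m; apply: nm; rewrite Hm; apply: (mono _ k) => //.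
by rewrite leNgt; apply/negP => /io_lt.
Qed.

Lemma enumeration_ex (C : sets W) : (forall n, exists m, elem m C /\ n <! m) ->
  exists g, increasing W g /\ forall i, elem (g i) C.
Proof.
move=> inf.
have [|nx [Dn Hn]] := search_ex W K io (fun x y => elem y C /\ x <! y) _ inf.
  by apply: Delta1_and; [apply: Delta1_elem; fd|apply: Delta1_lt; fd].
have [|h [Dh Hh]] := primitive_recursion W K io (nx 0) (fun _ _ x => nx x).
  by apply: (Delta1fun_app1 _ nx); fd.
pose g i := h 0 i.
have Dg : Delta1fun W (fun e => g (e 0)) by apply: (Delta1fun_app2 _ h); fd.
have gS i : g (i + 1) = nx (g i) by rewrite /g (Hh 0).2.
exists g; split.
  split=> // i j /num_lt_iff[t ->]; move: t; apply: induction1.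
  - suff [] : Delta1 W (fun e => g i <! g (i + (e 0 + 1))) by [].
    by apply: Delta1_lt; fd; apply: (Delta1fun_app1 _ g); fd.
  - by rewrite add0r gS; case: (Hn (g i)).
  - move=> t IH; rewrite addrA gS; apply: numlt_trans IH _.
    by case: (Hn (g (i + (t + 1)))).
apply: induction1.
- suff [] : Delta1 W (fun e => elem (g (e 0)) C) by [].
  by apply: Delta1_elem.
- by rewrite /g (Hh 0).1; case: (Hn 0).
- by move=> i _; rewrite gS; case: (Hn (g i)).
Qed.

Definition clamp (q : K) : K :=
  if `[< 0 <= q >] then if `[< q <= 1 >] then q else 1 else 0.

Lemma clamp_bounds q : 0 <= clamp q <= 1.
Proof. by rewrite /clamp; case: asboolP => h1; [case: asboolP => h2|]; lra. Qed.

Lemma clamp_lip q r : `|clamp q - clamp r| <= `|q - r|.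
Proof.
rewrite ler_norml /clamp; have := ler_norm (q - r); have := ler_norm (r - q).
rewrite (distrC r).
by case: asboolP => [h1|/negP h1]; case: asboolP => [h2|/negP h2]; rewrite -?ltNge in h1 h2 *;
  do ?case: asboolP => [?|/negP]; rewrite -?ltNge; lra.
Qed.

(** The terms of a real in the unit interval may lie slightly outside of it, which accounts for the
    slack [e]. *)
Lemma clamp_close q x e : 0 <= e -> - e <= x <= 1 + e -> `|clamp q - x| <= `|q - x| + e.
Proof.
move=> e0 xb; rewrite ler_norml /clamp; have := ler_norm (q - x); have := ler_norm (x - q).
rewrite (distrC x).
by case: asboolP => [h1|/negP h1]; rewrite -?ltNge in h1;
  do ?case: asboolP => [?|/negP]; rewrite -?ltNge; lra.
Qed.

Lemma Delta1rat_clamp f : Delta1rat f -> Delta1rat (fun e => clamp (f e)).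
Proof. by move=> Hf; apply: Delta1rat_if; [apply: Delta1_leK; fd|apply: Delta1rat_if; [apply: Delta1_leK; fd| |]|]; fd. Qed.

Lemma ball_mono u q (c d : K) : c < d -> Rlt (dist u (cst q)) (cst c) -> Rlt (dist u (cst q)) (cst d).
Proof.
move=> cd /Rlt_elim H; apply: (Rlt_intro _ _ ((d - c) / 2)); first by lra.
by apply: eventually_mono (H ((d - c) / 2) _); [move=> n|]; lra.
Qed.

Lemma I01_bounds u (e : K) : I01 u -> 0 < e -> eventually (fun n => - e <= u n <= 1 + e).
Proof.
move=> [H0 H1] e0; apply: eventually_mono (eventually_and _ _ (H0 e e0) (H1 e e0)) => n.
by rewrite /cst; lra.
Qed.

(** Retraction does not lead away from a real in the unit interval, but termwise this holds only up
    to an arbitrarily small error; halving the radius absorbs it. *)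
Lemma ball_clamp u q (c : K) : I01 u -> 0 < c ->
  Rlt (dist u (cst q)) (cst (c / 2)) -> Rlt (dist u (cst (clamp q))) (cst c).
Proof.
move=> Iu c0 /Rlt_elim H; apply: (Rlt_intro _ _ (c / 4)); first by lra.
have c8 : 0 < c / 8 by lra.
apply: eventually_mono (eventually_and _ _ (H _ c8) (I01_bounds _ _ Iu c8)) => n [h1 h2].
move: h1; rewrite /dist /cst -(distrC q) -(distrC (clamp q)) => h1.
have := clamp_close q (u n) (c / 8) (ltW c8) h2; lra.
Qed.

Lemma ball_self (q c : K) : 0 < c -> Rlt (dist (cst q) (cst q)) (cst c).
Proof.
move=> c0; apply: (Rlt_intro _ _ (c / 2)); first by lra.
by exists 0 => n _; rewrite /dist /cst subrr normr0; lra.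
Qed.

End Forward.

(** * Construction of the uniformly convergent subsequence *)

Section AscoliProof.
Implicit Types (m n i j k z : M) (u v : M -> K).
Variable f : M -> K -> M -> K.
Hypothesis Df : family_definable W K io f.
Hypothesis Cf : family_continuous W K io f.
Variable B : M.
Hypothesis Bf : family_bounded W K io f B.
Hypothesis Ef : family_equicontinuous W K io f.
Hypothesis coh : Sem.COH W.
Hypothesis ipp : IPPK W K io.

Let ev_and := eventually_and.
Let ev_ge := eventually_ge.
Let ev_ex := eventually_ex.

Lemma Delta1rat_family a q b : Delta1fun W a -> Delta1rat q -> Delta1fun W b -> Delta1rat (fun e => f (a e) (q e) (b e)).
Proof.
move=> Ha Hq Hb.
have H := Delta1fun_app3 W (fun n c i => rat_code (f n (rat_val c) i)) _ _ _ Df Ha Hq Hb.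
by apply: (Delta1rat_ext W K io _ _ _ H) => e; rewrite rat_codeK.
Qed.

Lemma cohesive_ex : exists C : sets W, (forall n, exists m, elem m C /\ n <! m) /\
  forall q r : K, exists k, forall m n, elem m C -> elem n C -> io k <= io m -> io k <= io n ->
    (f m q m < r <-> f n q n < r).
Proof.
have [|R HR] := @comprehension1 W (fun z => f (unpair2 z) (rat_val (unpair1 (unpair1 z))) (unpair2 z) < rat_val (unpair2 (unpair1 z))).
  by apply: Delta1_ltK; [apply: Delta1rat_family; fd|fd].
have RE q r n : elem (mpair (mpair (rat_code q) (rat_code r)) n) R <-> f n q n < r.
  by rewrite HR !(p1E, p2E) !rat_codeK.
have [C [inf H]] := coh R; exists C; split.
  move=> n; apply: contrapT => no; apply: inf; exists (n + 1) => m mC.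
  apply: contrapT => h; apply: no; exists m; split=> //.
  by case: (numlt_total _ n m) => // [nm|mn]; case: h; apply/numlt_succ; [right|left].
move=> q r; have [[k Hk]|[k Hk]] := H (mpair (rat_code q) (rat_code r)); exists k => m n mC nC km kn.
  have key x : elem x C -> io k <= io x -> f x q x < r.
    move=> xC kx; apply/RE; apply: contrapT => h.
    by have /io_lt := Hk _ (conj xC h); rewrite ltNge kx.
  by split=> _; apply: key.
have key x : elem x C -> io k <= io x -> ~ f x q x < r.
  move=> xC kx /RE h; have /io_lt := Hk x (conj xC (fun nh => nh h)).
  by rewrite ltNge kx.
by split=> /(key _ _); tauto.
Qed.

Section Cohesive.
Variable C : sets W.
Hypothesis C_stable : forall q r : K, exists k, forall m n, elem m C -> elem n C ->
  io k <= io m -> io k <= io n -> (f m q m < r <-> f n q n < r).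

(** The grid may have a nonstandard number of points, so even its pointwise properties need
    collection to become uniform: once for the convergence of the representations, once for the
    comparisons with thresholds. *)
Lemma grid_cauchy (q : M -> K) n (e : K) : 0 < e -> (forall c, Delta1fun W c -> Delta1rat (fun x => q (c x))) ->
  (forall p, p <! n -> 0 <= q p <= 1) ->
  exists k, (forall p m i j, p <! n -> io k <= io i -> io k <= io j ->
               `|f m (q p) i - f m (q p) j| < e) /\
    forall p m m', p <! n -> elem m C -> elem m' C -> io k <= io m -> io k <= io m' ->
               `|f m (q p) m - f m' (q p) m'| <= e.
Proof.
move=> e0 Dq q01.
have [|||k1 Hk1] := uniform_bound (fun p k z => k <! unpair1 (unpair2 z) + 1 -> k <! unpair2 (unpair2 z) + 1 ->
     `|f (unpair1 z) (q p) (unpair1 (unpair2 z)) - f (unpair1 z) (q p) (unpair2 (unpair2 z))| < e) n ipp.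
- apply: Delta1_imp; first by apply: Delta1_lt; fd.
  apply: Delta1_imp; first by apply: Delta1_lt; fd.
  by apply: Delta1_ltK; fd; apply: Delta1rat_family; fd; apply: Dq; fd.
- move=> p k k' z kk H; rewrite !(lt_succ_le W K io) => h1 h2.
  by apply: H; rewrite !(lt_succ_le W K io); lra.
- move=> p /q01 qp; have I := I01_cst _ qp.
  have [N [N0 HN]] := Cf.2 _ (isreal_cst (q p)) I _ e0.
  exists N => z; rewrite !(lt_succ_le W K io) => h1 h2.
  by apply: HN => //; apply: ball_self; rewrite invr_gt0.
have {}Hk1 p m i j : p <! n -> io k1 <= io i -> io k1 <= io j -> `|f m (q p) i - f m (q p) j| < e.
  by move=> pn h1 h2; have := Hk1 p pn (mpair m (mpair i j)); rewrite !(p1E, p2E) !(lt_succ_le W K io); apply.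
(* The thresholds [r t] cover the range with mesh at most [e], so values that lie on the
   same side of each of them differ by at most [e]. *)
have [B2 HB2] := archimedean W K io (io B + e + e).
have [E [E0 Ee]] := inverse_lt W K io _ e0.
(* Steps of length [1 / E] lead from [- B2] to [B2] in [2 B2 E] steps. *)
have [T TE] : exists T, T = (B2 + B2) * E by exists ((B2 + B2) * E).
pose r t := io t * (io E)^-1 - io B2.
have Dr c : Delta1fun W c -> Delta1rat (fun x => r (c x)) by move=> Dc; rewrite /r; fd.
(* All pairs [(p, t)] with [p < n] and [t <= T] have codes at most [mpair n T], so one use of
   collection treats grid points and thresholds together. *)
have [|||k2 Hk2] := uniform_bound (fun j k z => k <! unpair1 z + 1 -> k <! unpair2 z + 1 ->
     elem (unpair1 z) C -> elem (unpair2 z) C ->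
     (f (unpair1 z) (q (unpair1 j)) (unpair1 z) < r (unpair2 j) <-> f (unpair2 z) (q (unpair1 j)) (unpair2 z) < r (unpair2 j)))
     (mpair n T + 1) ipp.
- apply: Delta1_imp; first by apply: Delta1_lt; fd.
  apply: Delta1_imp; first by apply: Delta1_lt; fd.
  apply: Delta1_imp; first by apply: Delta1_elem; fd.
  apply: Delta1_imp; first by apply: Delta1_elem; fd.
  by apply: Delta1_iff; apply: Delta1_ltK; [apply: Delta1rat_family; fd; apply: Dq; fd|apply: Dr; fd|apply: Delta1rat_family; fd; apply: Dq; fd|apply: Dr; fd].
- move=> j k k' z kk H; rewrite !(lt_succ_le W K io) => h1 h2.
  by apply: H; rewrite !(lt_succ_le W K io); lra.
- move=> j _; have [k Hk] := C_stable (q (unpair1 j)) (r (unpair2 j)).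
  by exists k => z; rewrite !(lt_succ_le W K io) => h1 h2 c1 c2; apply: Hk.
have {}Hk2 p t m m' : p <! n -> io t <= io T -> elem m C -> elem m' C ->
    io k2 <= io m -> io k2 <= io m' -> (f m (q p) m < r t <-> f m' (q p) m' < r t).
  move=> pn tT mC m'C h1 h2; have := Hk2 (mpair p t) _ (mpair m m').
  rewrite !(p1E, p2E) !(lt_succ_le W K io); apply=> //.
  rewrite /mpair !(ioD, ioM); move/io_lt: pn => pn.
  have := io_ge0 p; have := io_ge0 t => t0 p0.
  have : (io p + io t) * (io p + io t) <= (io n + io T) * (io n + io T) by apply: ler_pM; lra.
  by lra.
(* The bound [B] concerns the limit in [i]: the terms are eventually within [B + e], and the
   diagonal term differs from them by less than [e]. *)
have bound p m : p <! n -> io k1 <= io m -> - io B2 <= f m (q p) m <= io B2.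
  move=> pn km; have I := I01_cst _ (q01 _ pn).
  have [b1 b2] := Bf m _ (isreal_cst (q p)) I.
  have [i [[]]] := ev_ex _ (ev_and _ _ (ev_and _ _ (b1 e e0) (b2 e e0)) (ev_ge k1)).
  rewrite /cst => h1 h2 ki; have := Hk1 p m _ _ pn km ki; rewrite ltr_norml; lra.
have half p m m' : p <! n -> elem m C -> elem m' C -> io k1 + io k2 <= io m -> io k1 + io k2 <= io m' ->
    f m' (q p) m' <= f m (q p) m + e.
  move=> pn mC m'C km km'; rewrite leNgt; apply/negP => lt.
  have k10 := io_ge0 k1; have k20 := io_ge0 k2.
  have /andP[bm1 bm2] := bound p m pn ltac:(lra).
  have /andP[bm'1 bm'2] := bound p m' pn ltac:(lra).
  set x := f m (q p) m in lt bm1 bm2; set y := f m' (q p) m' in lt bm'1 bm'2.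
  (* The last threshold not above [y] lies above [x], because [y - x] exceeds [e] and hence the
     mesh. *)
  have [|t /andP[t1 t2]] := floor_ex W K io ((y + io B2) * io E).
    by rewrite mulr_ge0 //; lra.
  have tT : io t <= io T.
    apply: le_trans t1 _; rewrite TE !(ioM, ioD) ler_wpM2r //; lra.
  have ry : r t <= y by rewrite /r lerBlDr ler_pdivrMr.
  have xr : x < r t.
    have : y + io B2 < (io t + 1) * (io E)^-1 by rewrite ltr_pdivlMr.
    by rewrite mulrDl mul1r /r; lra.
  have /(Hk2 p t m m' pn tT mC m'C) : x < r t by [].
  by move=> /(_ ltac:(lra) ltac:(lra)); rewrite -/y ltNge ry.
exists (k1 + k2); split=> [p m i j pn|p m m' pn mC m'C]; rewrite ioD => h1 h2.
  by have := io_ge0 k2 => ?; apply: Hk1 => //; lra.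
rewrite ler_norml; have := half p m m' pn mC m'C h1 h2; have := half p m' m pn m'C mC h2 h1; lra.
Qed.

Lemma uniform_cauchy (e : K) : 0 < e -> exists k, forall m n, elem m C -> elem n C ->
  io k <= io m -> io k <= io n -> forall q : K, 0 <= q <= 1 ->
  eventually (fun i => `|f m q i - f n q i| <= e).
Proof.
(* The comparison at [x] passes through the grid point below it and through the two diagonal terms;
   the errors are [2 + 1 + 1 + 1 + 2] times [e']. *)
move=> e0; pose e' := e / 8; have e'0 : 0 < e' by rewrite /e'; lra.
have [d [d0 Hd]] := Ef _ e'0.
have [D [Dpos Dd]] := inverse_lt W K io _ d0.
pose q p := io p * (io D)^-1.
have Dq c : Delta1fun W c -> Delta1rat (fun x => q (c x)) by move=> Dc; rewrite /q; fd.
have q01 p : p <! D + 1 -> 0 <= q p <= 1.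
  move/(lt_succ_le W K io) => pD; rewrite /q mulr_ge0 ?invr_ge0 //=.
  by rewrite ler_pdivrMr // mul1r.
have [k [Hk1 Hk2]] := grid_cauchy q (D + 1) _ e'0 Dq q01.
exists k => m n mC nC km kn x x01.
have [|p /andP[pl pu]] := floor_ex W K io (x * io D).
  by rewrite mulr_ge0 //; lra.
have pD : p <! D + 1.
  apply/(lt_succ_le W K io); apply: le_trans pl _; rewrite ler_piMl //; lra.
have px : `|x - q p| <= (io D)^-1.
  have h1 : q p <= x by rewrite /q ler_pdivrMr.
  have : x < (io p + 1) * (io D)^-1 by rewrite ltr_pdivlMr.
  rewrite mulrDl mul1r -/(q p) => h2; rewrite ler_norml; lra.
have close y : eventually (fun i => `|f y x i - f y (q p) i| <= e' + e').
  apply: (Rlt_elim (dist (fun i => f y x i) (fun i => f y (q p) i)) e' e') => //.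
  apply: (Hd y (cst x) (isreal_cst x) (cst (q p)) (isreal_cst (q p))).
  - exact: I01_cst.
  - exact/I01_cst/q01.
  - apply: (Rlt_intro _ _ (d - (io D)^-1)); first by lra.
    by exists 0 => i _; rewrite /dist /cst; lra.
apply: eventually_mono (ev_and _ _ (ev_and _ _ (close m) (close n)) (ev_ge k)) => i [[h1 h2] ki].
have h3 := Hk1 p m i m pD ki km; have h4 := Hk1 p n i n pD ki kn.
have h5 := Hk2 p m n pD mC nC km kn.
move: h1 h2 h3 h4 h5; rewrite !ler_norml !ltr_norml /e'; lra.
Qed.

Variable g : M -> M.
Hypothesis Ig : increasing W g.
Hypothesis gC : forall i, elem (g i) C.

(** Equicontinuity gives no control of [f] at rationals outside [[0, 1]], hence [clamp]. *)
Definition limit (q : K) i : K := f (g i) (clamp q) (g i).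

Let g_ge i : io i <= io (g i). Proof. exact: increasing_ge. Qed.

Lemma limit_definable : repr_definable W K io limit.
Proof.
have Dg c : Delta1fun W c -> Delta1fun W (fun x => g (c x)) by move=> Dc; apply: Delta1fun_app1 => //; exact: Ig.1.
by apply: Delta1rat_family; [apply: Dg; fd|apply: Delta1rat_clamp; fd|apply: Dg; fd].
Qed.

Lemma limit_continuous u : isreal u -> I01 u -> Dom limit u.
Proof.
move=> Ru Iu e e0; pose e' := e / 8; have e'0 : 0 < e' by rewrite /e'; lra.
have [k Hk] := uniform_cauchy _ e'0.
have [d [d0 Hd]] := Ef _ e'0.
have [N1 [N10 HN1]] := Cf.2 _ Ru Iu _ e'0.
have d4 : 0 < d / 4 by lra.
have [D [Dpos Dd]] := inverse_lt W K io _ d4.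
(* [N1] is counted twice because clamping costs half of the radius. [D] brings [q] and [r] within
   [d] of each other, and [k] puts [g i] and [g j] in the Cauchy range. *)
have [N NE] : exists N, N = N1 + N1 + D + k + 1 by exists (N1 + N1 + D + k + 1).
have NK : io N = io N1 + io N1 + io D + io k + 1 by rewrite NE !ioD io1.
have k0 := io_ge0 k.
have N0 : 0 < io N by lra.
have iN1 : (io N)^-1 < (io N1)^-1 / 2.
  rewrite -invfM ltf_pV2 ?posrE //; lra.
have iND : (io N)^-1 < (io D)^-1 by rewrite ltf_pV2 ?posrE //; lra.
exists N; split=> // q r Bq Br i j Ni Nj.
have iN10 : 0 < (io N1)^-1 by rewrite invr_gt0.
have Bq' := HN1 _ (ball_clamp _ _ _ Iu iN10 (ball_mono _ _ _ _ iN1 Bq)).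
have Br' := HN1 _ (ball_clamp _ _ _ Iu iN10 (ball_mono _ _ _ _ iN1 Br)).
have q01 := clamp_bounds q; have r01 := clamp_bounds r.
have qr : `|clamp q - clamp r| < d.
  apply: le_lt_trans (clamp_lip q r) _.
  have d8 : 0 < d / 8 by lra.
  have [l []] := ev_ex _ (ev_and _ _ (Rlt_elim _ _ _ Bq d8) (Rlt_elim _ _ _ Br d8)).
  by rewrite /dist /cst !ler_norml ltr_norml; lra.
have close : eventually (fun l => `|f (g i) (clamp q) l - f (g i) (clamp r) l| <= e' + e').
  apply: (Rlt_elim (dist (fun l => f (g i) (clamp q) l) (fun l => f (g i) (clamp r) l)) e' e') => //.
  apply: (Hd (g i) (cst (clamp q)) (isreal_cst _) (cst (clamp r)) (isreal_cst _)).
  - exact: I01_cst.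
  - exact: I01_cst.
  - apply: (Rlt_intro _ _ (d - `|clamp q - clamp r|)); first by lra.
    by exists 0 => l _; rewrite /dist /cst; lra.
have gi := g_ge i; have gj := g_ge j.
(* The estimate goes from [limit q i] to index [l], then to the argument [clamp r], then from [g i]
   to [g j], and back to the diagonal; the errors add up to [5 e']. *)
have [||l [[h1 h2] Nl]] := ev_ex _ (ev_and _ _ (ev_and _ _ close
  (Hk (g i) (g j) (gC i) (gC j) _ _ (clamp r) r01)) (ev_ge N1)); try lra.
have h3 := Bq' (g i) (g i) l ltac:(lra) Nl.
have h4 := Br' (g j) l (g j) Nl ltac:(lra).
by move: h1 h2 h3 h4; rewrite /limit /e' !ler_norml !ltr_norml; lra.
Qed.

Lemma limit_uniform : family_converges W K io (fun n => f (g n)) limit.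
Proof.
move=> e e0; pose e' := e / 8; have e'0 : 0 < e' by rewrite /e'; lra.
have [k Hk] := uniform_cauchy _ e'0.
exists k => u Ru Iu n kn.
(* [N1] may depend on [n] and [u]; only [k], the index from which [n] is taken, has to be
   uniform. *)
have [N1 [N10 HN1]] := Cf.1 (g n) _ Ru Iu _ e'0.
have [N2 [N20 HN2]] := Cf.2 _ Ru Iu _ e'0.
have i1 : 0 < (io N1)^-1 by rewrite invr_gt0.
have i2 : 0 < (io N2)^-1 by rewrite invr_gt0.
have ball (c : K) : 0 < c -> eventually (fun i => Rlt (dist u (cst (u i))) (cst c)).
  move=> c0; have [|N HN] := Ru.1 (c / 2); first by lra.
  exists N => i Ni; apply: (Rlt_intro _ _ (c / 2)); first by lra.
  by exists N => m Nm; have := HN m i Nm Ni; rewrite /dist /cst; lra.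
have c1 : 0 < (io N1)^-1 / 2 by lra.
have c2 : 0 < (io N2)^-1 / 2 by lra.
apply: (Rlt_intro _ _ (e / 4)); first by lra.
apply: eventually_mono (ev_and _ _ (ev_and _ _ (ball _ c1) (ball _ c2)) (ev_ge (N1 + N2 + k))) => i [[b1 b2] Ni].
have := io_ge0 k; have := io_ge0 N1; have := io_ge0 N2 => x2 x1 xk.
rewrite !ioD in Ni; have gi := g_ge i; have gn := g_ge n.
have b1' := ball_clamp _ _ _ Iu i1 b1.
have b1'' : Rlt (dist u (cst (u i))) (cst (io N1)^-1).
  by apply: ball_mono b1; lra.
have b2' := HN2 _ (ball_clamp _ _ _ Iu i2 b2).
(* Continuity of the single function [f (g n)] moves the argument [u i], which may lie outside the
   unit interval, to its retraction, and at the same time the index [i] to [g i]. *)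
have h1 := HN1 _ _ b1'' b1' i (g i) ltac:(lra) ltac:(lra).
have c01 := clamp_bounds (u i).
have [||l [h2 Nl]] := ev_ex _ (ev_and _ _ (Hk (g n) (g i) (gC n) (gC i) _ _ (clamp (u i)) c01) (ev_ge N2)); try lra.
have h3 := b2' (g n) (g i) l ltac:(lra) Nl.
have h4 := b2' (g i) l (g i) Nl ltac:(lra).
by move: h1 h2 h3 h4; rewrite /dist /limit /e' !ler_norml !ltr_norml; lra.
Qed.

End Cohesive.

Lemma uniformly_convergent_subsequence : exists g, increasing W g /\
  exists h, repr_definable W K io h /\
    ((forall u, isreal u -> I01 u -> Dom h u) /\ family_converges W K io (fun n => f (g n)) h).
Proof.
have [C [inf stable]] := cohesive_ex.
have [g [Ig gC]] := enumeration_ex C inf.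
exists g; split=> //; exists (limit g); split; first exact: limit_definable.
by split; [exact: (limit_continuous C)|exact: (limit_uniform C)].
Qed.
End AscoliProof.

End Analysis.

Theorem StCOH_iff_ArzelaAscoli W : (Sem.COH W /\ Sem.IPP W) <-> Sem.ArzelaAscoli W.
Proof.
have [K [io]] := field_embedding_ex W; rewrite (ArzelaAscoliE W K io) (IPPE W K io).
split=> [[coh ipp] f Df Cf B Bf Ef|AA].
  exact: (uniformly_convergent_subsequence W K io f Df Cf B Bf Ef coh ipp).
have BW := ArzelaAscoli_BolzanoWeierstrass W K io AA.
by split; [apply: (BolzanoWeierstrass_COH W K io BW)|apply: BolzanoWeierstrass_IPP].
Qed.

Theorem theorem7p18 : provable RCA0 (sentence (f_iff StCOH ArzelaAscoli)).
Proof. exact: reduction StCOH_iff_ArzelaAscoli. Qed.
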